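(* Let $P_1\in \mathrm{Mor}_{\mathbf{Sp}}(V_q,V_m)$ and $P_2\in \mathrm{Mor}_{\mathbf{Sp}}(V_n,V_q)$ be linear relations, and let $$S(P_1)=\begin{pmatrix}A&B\\ B^t&C\end{pmatrix},\qquad S(P_2)=\begin{pmatrix}K&L\\ L^t&M\end{pmatrix}$$ be their Potapov transforms ($A$ is $m\times m$, $C$ and $K$ are $q\times q$, $M$ is $n\times n$). Then $$\mathcal Q_{q,m}[S(P_1)]\,\mathcal Q_{n,q}[S(P_2)]=\det(-C-K)^{-1/2}\,\mathcal Q_{n,m}[S(P_1P_2)].$$ In particular, the operators $\mathcal Q_{n,m}[S(P)]$, $P\in\mathrm{Mor}_{\mathbf{Sp}}(V_n,V_m)$, give a projective representation of the category $\mathbf{Sp}$ (products of morphisms go to products of operators up to scalar factors).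
   Context: **Spaces and forms.** $V_n=V_n^+\oplus V_n^-=\mathbb C^n\oplus\mathbb C^n$, with elements $v=(v_+,v_-)$ (also written $(v^+,v^-)$). It carries the skew-symmetric bilinear form $L_n(v,w)=\sum_{j=1}^n (v_+^jw_-^j-v_-^jw_+^j)$ and the Hermitian form $H_n(v,w)=\frac1i\sum_{j=1}^n (v_+^j\overline{w_-^j}-v_-^j\overline{w_+^j})$. On $V_m\oplus V_n$ put $L_{m,n}((v,w),(v',w'))=L_m(v,v')-L_n(w,w')$ and $H_{m,n}((v,w),(v',w'))=H_m(v,v')-H_n(w,w')$. **Category $\mathbf{Sp}$.** Objects are the spaces $V_n$, $n=0,1,2,\dots$. An element of $\mathrm{Mor}_{\mathbf{Sp}}(V_n,V_m)$ is a complex linear subspace $P\subset V_m\oplus V_n$ that is Lagrangian for $L_{m,n}$ (so $L_{m,n}$ vanishes on $P$ and $\dim P=m+n$) and on which $H_{m,n}$ is strictly positive definite. For $P_1\in\mathrm{Mor}_{\mathbf{Sp}}(V_q,V_m)$ and $P_2\in\mathrm{Mor}_{\mathbf{Sp}}(V_n,V_q)$ the product $P_1P_2\in \mathrm{Mor}_{\mathbf{Sp}}(V_n,V_m)$ is the set of $(v,y)\in V_m\oplus V_n$ for which there is $w\in V_q$ with $(v,w)\in P_1$ and $(w,y)\in P_2$. **Potapov transform.** For $P\in\mathrm{Mor}_{\mathbf{Sp}}(V_n,V_m)$, the Potapov transform $S(P)=\begin{pmatrix}A&B\\ B^t&C\end{pmatrix}$ is the $(m+n)\times(m+n)$ matrix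 such that $P$ is the set of $(v,w)\in V_m\oplus V_n$ with $$\begin{pmatrix}-v^+\\ w^+\end{pmatrix}=\begin{pmatrix}A&B\\ B^t&C\end{pmatrix}\begin{pmatrix}v^-\\ w^-\end{pmatrix}.$$ It is stated in the source that $P\mapsto S(P)$ is a bijection of $\mathrm{Mor}_{\mathbf{Sp}}(V_n,V_m)$ onto the set of symmetric complex $(m+n)\times(m+n)$ matrices $S$ with $\operatorname{Re}S<0$ (strictly negative definite); these conditions on $S(P)$ are in force throughout. **Function spaces.** $G(\mathbb R^{2n})$ is the space of $g\in C^\infty(\mathbb R^{2n})$, written $g(x,\xi)$ with $x,\xi\in\mathbb R^n$, such that for all $k\in\mathbb Z^n$ $$g(x,\xi+2\pi k)=g(x,\xi),\qquad g(x+2\pi k,\xi)=e^{-ik\cdot\xi}g(x,\xi).$$ **Operators with theta-kernels.** For a symmetric complex $(m+n)\times(m+n)$ matrix $S$ with $\operatorname{Re}S<0$, and $x,\xi\in\mathbb R^m$, $y,\eta\in\mathbb R^n$, put $b(x,y)=\frac12\begin{pmatrix}x^t&y^t\end{pmatrix}S\begin{pmatrix}x\\ y\end{pmatrix}$ and $$\mathcal K_{n,m}[S](x,\xi;y,\eta)=\sum_{k\in\mathbb Z^m}\sum_{l\in\mathbb Z^n}\exp\{b(x+2\pi k,y+2\pi l)\}\,e^{ik\cdot\xi}e^{-il\cdot\eta}.$$ The operator $\mathcal Q_{n,m}[S]:G(\mathbb R^{2n})\to G(\mathbb R^{2m})$ is $$(\mathcal Q_{n,m}[S]g)(x,\xi)=\frac1{(2\pi)^{3(n+m)/4}}\int_{\mathbb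 T^{2n}}\mathcal K_{n,m}[S](x,\xi;y,\eta)\,g(y,\eta)\,dy\,d\eta ,$$ where $\mathbb T^{2n}=\mathbb R^{2n}/(2\pi\mathbb Z)^{2n}$, i.e. the integral is over $[0,2\pi]^{2n}$. **Determinant convention.** If $T$ is a symmetric complex matrix with $\operatorname{Re}T>0$, all its eigenvalues $\lambda_j$ satisfy $\operatorname{Re}\lambda_j>0$, and $\det(T)^{-1/2}:=\prod_j\lambda_j^{-1/2}$ (principal branch).
   Formalization: The printed H_n makes positivity mean Im S(P)<0, not Re S(P)<0 (S=-i gives a divergent theta series). Proved for the printed H_n with Re S(P)<0 also required, and for H_n(v,w)=sum(v_+ conj w_- + v_- conj w_+), whose morphisms are exactly those with symmetric S(P), Re S(P)<0. *)

(* Defs.v *)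
From mathcomp Require Import all_boot all_order all_algebra.
From mathcomp Require Import complex.
From mathcomp Require Import all_classical all_reals all_analysis.
From mathcomp.analysis.showcase Require Import summability.
Set Implicit Arguments.
Unset Strict Implicit.
Unset Printing Implicit Defensive.
Import Order.TTheory GRing.Theory Num.Theory.
Import numFieldNormedType.Exports.
Local Open Scope classical_set_scope.
Local Open Scope ring_scope.

(* An element [v : V R n] is the pair (v_+, v_-). *)
Definition V (R : realType) (n : nat) : Type :=
  ('cV[R[i]]_n * 'cV[R[i]]_n)%type.

Section Sp.
Variable R : realType.
Local Notation C := R[i].

Definition Lform n (v w : V R n) : C :=
  \sum_(j < n) (v.1 j 0 * w.2 j 0 - v.2 j 0 * w.1 j 0).

Definition Hform n (v w : V R n) : C :=
  'i%C^-1 * \sum_(j < n) (v.1 j 0 * conjc (w.2 j 0) - v.2 j 0 * conjc (w.1 j 0)).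

(* On a Lagrangian subspace with Potapov transform S, positivity of the form
   built from [Hform] says Im S < 0, whereas positivity of the one built from
   [Hform_re] says Re S < 0, the condition under which the theta-series below
   converge. *)
Definition Hform_re n (v w : V R n) : C :=
  \sum_(j < n) (v.1 j 0 * conjc (w.2 j 0) + v.2 j 0 * conjc (w.1 j 0)).

(* F_{m,n}((v,w),(v',w')) = F_m(v,v') - F_n(w,w') for F = L or F = H. *)
Definition form2 (F : forall n, V R n -> V R n -> C) m n
    (p q : (V R m * V R n)%type) : C :=
  F m p.1 q.1 - F n p.2 q.2.

Definition lagrangian m n (P : set (V R m * V R n)) : Prop :=
  (exists U : {vspace (V R m * V R n)%type},
      P = [set` U] /\ \dim U = (m + n)%N) /\
  (forall p q, P p -> P q -> form2 Lform p q = 0).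

(* [MorSp H n m] is Mor(V_n, V_m), relative to a family [H] of Hermitian forms.  A statement
   0 < z about z : R[i] says that z is real and positive. *)
Definition MorSp (H : forall n, V R n -> V R n -> C) n m
    (P : set (V R m * V R n)) : Prop :=
  lagrangian P /\ (forall p, P p -> p != 0 -> 0 < form2 H p p).

Definition rel_comp m q n (P1 : set (V R m * V R q)) (P2 : set (V R q * V R n)) :
    set (V R m * V R n) :=
  [set p | exists w, P1 (p.1, w) /\ P2 (w, p.2)].

Definition is_potapov m n (P : set (V R m * V R n)) (S : 'M[C]_(m + n)) : Prop :=
  forall v w, P (v, w) <-> col_mx (- v.1) w.1 = S *m col_mx v.2 w.2.

(* At most one S satisfies [is_potapov P S]; see [potapovE]. *)
Definition potapov m n (P : set (V R m * V R n)) : 'M[C]_(m + n) :=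
  xget 0 [set S | is_potapov P S].

Lemma potapovE m n (P : set (V R m * V R n)) (S : 'M[C]_(m + n)) :
  is_potapov P S -> potapov P = S.
Proof.
move=> PS; rewrite /potapov; case: xgetP => [S' _ PS' | /(_ S)]; last by [].
apply/eqP; rewrite -subr_eq0; apply/eqP.
apply: (can_inj (@trmxK _ _ _)); apply/row_matrixP => j; rewrite trmx0 row0.
rewrite -tr_col; apply: (can_inj (@trmxK _ _ _)); rewrite trmx0 trmxK colE mulmxBl.
set u := delta_mx _ _; pose y := S *m u.
pose v : V R m := (- usubmx y, usubmx u); pose w : V R n := (dsubmx y, dsubmx u).
have Pvw : P (v, w) by apply/PS; rewrite /= opprK !vsubmxK.
by move/PS': (Pvw); rewrite /= opprK !vsubmxK /y => <-; rewrite subrr.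
Qed.

Definition potapov_domain N (S : 'M[C]_N) : Prop :=
  S^T = S /\
  (forall x : 'cV[R]_N, x != 0 ->
     (x^T *m map_mx (@complex.Re R) S *m x) 0 0 < 0).

End Sp.

Arguments MorSp {R} H n m P.

Section Theta.
Variable R : realType.
Local Notation C := R[i].
Local Notation Rn2 n := ('cV[R]_n * 'cV[R]_n)%type.

Definition cexp (z : C) : C :=
  (expR (complex.Re z) * cos (complex.Im z)
    +i* (expR (complex.Re z) * sin (complex.Im z)))%C.

Definition zvec n (k : 'cV[int]_n) : 'cV[R]_n := map_mx intr k.

Definition dotv n (x y : 'cV[R]_n) : R := \sum_(j < n) x j 0 * y j 0.

Definition echar n (k : 'cV[int]_n) (xi : 'cV[R]_n) : C :=
  cexp (0 +i* dotv (zvec k) xi)%C.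

(* All directions v are allowed, not only those of a basis; by linearity of the
   differential of a C^1 function this is the usual notion. *)
Fixpoint Ck (U : normedModType R) (k : nat) (f : U -> R^o) : Prop :=
  continuous f /\
  if k is k'.+1 then
    forall v : U, (forall x, derivable f x v) /\ Ck k' (fun x => 'D_v f x)
  else True.

Definition smooth (U : normedModType R) (f : U -> C) : Prop :=
  forall k, Ck k (fun x => complex.Re (f x) : R^o) /\ Ck k (fun x => complex.Im (f x) : R^o).

Definition Gspace n : set (Rn2 n -> C) :=
  [set g | [/\ smooth g,
    forall (k : 'cV[int]_n) x xi,
      g (x, xi + (2 * pi) *: zvec k) = g (x, xi) &
    forall (k : 'cV[int]_n) x xi,
      g (x + (2 * pi) *: zvec k, xi) = echar (- k) xi * g (x, xi)]].

(* Unconditional sum, i.e. the limit along the finite subsets of I. *)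
Definition csum (I : choiceType) (f : I -> C) : C :=
  (summability.sum (fun i => complex.Re (f i) : R^o)
    +i* summability.sum (fun i => complex.Im (f i) : R^o))%C.

(* The libraries have no Lebesgue measure on R^n.  The integrands used below are
   continuous, so by Fubini this iterated integral is the integral of F over
   [0, 2 pi]^n. *)
Fixpoint box_integral n : ('cV[R]_n -> R) -> R :=
  match n return ('cV[R]_n -> R) -> R with
  | 0 => fun F => F 0
  | n'.+1 => fun F =>
      \int[lebesgue_measure]_(t in `[0, 2 * pi]%classic)
        box_integral (fun v : 'cV[R]_n' => F (col_mx (const_mx t : 'cV[R]_1) v))
  end.

Definition torus_integral n (F : 'cV[R]_n -> 'cV[R]_n -> C) : C :=
  (box_integral (fun y => box_integral (fun eta => complex.Re (F y eta)))
    +i* box_integral (fun y => box_integral (fun eta => complex.Im (F y eta))))%C.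

Definition bform m n (S : 'M[C]_(m + n)) (x : 'cV[R]_m) (y : 'cV[R]_n) : C :=
  let z := map_mx (real_complex R) (col_mx x y) in
  2^-1 * (z^T *m S *m z) 0 0.

Definition Kkernel n m (S : 'M[C]_(m + n))
    (x xi : 'cV[R]_m) (y eta : 'cV[R]_n) : C :=
  csum (fun kl : 'cV[int]_m * 'cV[int]_n =>
    cexp (bform S (x + (2 * pi) *: zvec kl.1) (y + (2 * pi) *: zvec kl.2))
      * echar kl.1 xi * echar (- kl.2) eta).

Definition Qop n m (S : 'M[C]_(m + n)) (g : Rn2 n -> C) : Rn2 m -> C :=
  fun p =>
    real_complex R (((2 * pi) `^ (3 * (n + m)%:R / 4))^-1) *
    torus_integral (fun y eta => Kkernel S p.1 p.2 y eta * g (y, eta)).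

(* The eigenvalues of T with multiplicity; only their order is unspecified. *)
Definition spectrum N (T : 'M[C]_N) : seq C :=
  sval (closed_field_poly_normal (char_poly T)).

(* [sqrtc] is the principal square root on the right half-plane; [sqrtC] is
   not, its values having nonnegative imaginary part. *)
Definition det_inv_sqrt N (T : 'M[C]_N) : C :=
  \prod_(z <- spectrum T) (sqrtc z)^-1.

(* Projective representation, on the spaces [Gspace n], of the category with
   objects [V R n], morphism sets [Mor n m] and product [rel_comp]. *)
Definition projective_representation
    (Mor : forall n m, set (set (V R m * V R n)))
    (rho : forall n m, set (V R m * V R n) -> (Rn2 n -> C) -> (Rn2 m -> C)) : Prop :=
  [/\ forall m q n P1 P2, Mor q m P1 -> Mor n q P2 -> Mor n m (rel_comp P1 P2),
      forall m n P g, Mor n m P -> Gspace g -> Gspace (rho n m P g),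
      forall m n P (a : C) g1 g2, Mor n m P -> Gspace g1 -> Gspace g2 ->
        rho n m P (fun p => a * g1 p + g2 p) =
        (fun p => a * rho n m P g1 p + rho n m P g2 p) &
      forall m q n P1 P2, Mor q m P1 -> Mor n q P2 ->
        exists c : C, c != 0 /\
          forall g, Gspace g ->
            rho q m P1 (rho n q P2 g) =
            (fun p => c * rho n m (rel_comp P1 P2) g p)].

End Theta.

Arguments Qop {R} n m S g p.

(* Main.v *)
Require Import Defs.
From HB Require Import structures.
From mathcomp Require Import all_boot all_order all_algebra finmap.
From mathcomp Require Import complex ring lra zify.
From mathcomp Require Import all_classical all_reals all_analysis.
From mathcomp.analysis.showcase Require Import summability.
Set Implicit Arguments.
Unset Strict Implicit.
Unset Printing Implicit Defensive.
Import Order.TTheory GRing.Theory Num.Theory.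
Import numFieldNormedType.Exports.
Local Open Scope classical_set_scope.
Local Open Scope ring_scope.

(** Write [Q_1] and [Q_2] for the two operators and [b_1], [b_2] for their quadratic
    forms. The composite [Q_1 (Q_2 g)] is an iterated integral of
    [K_1 (p, w) K_2 (w, s) g (s)], so that, by the theorem of Fubini, it suffices to
    integrate the product of the two theta kernels over the inner torus
    ([kernel_comp]). Both kernels are Gaussian series over a lattice. Integration
    over the dual variable of the torus kills every term in which the inner lattice
    vectors of the two series differ; for equal vectors, the sum over the lattice
    unfolds the integral over a period box into an integral over R^q of
    [exp (b_1 (x, z) + b_2 (z, y))]. In [z] this is a Gaussian with quadratic part
    [- C - K] and linear part [B^t x + L y], hence its integral is
    [(2 pi)^(q/2) det (- C - K)^(-1/2)] times the value of the integrand at the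
    critical point ([gaussian_lattice]). The critical equation
    [B^t x + C z = - (K z + L y)] is the condition which identifies the inner
    components in the product of the relations, so that the critical value is the
    quadratic form of the Potapov transform of [P1 P2] ([is_potapov_comp]).

    The branch of the square root of the determinant needs care. Integration of one
    variable after another yields the product of the principal inverse square roots
    of the successive Schur complements; the convention of the theorem takes the
    eigenvalues instead. Both are continuous inverse square roots of the determinant
    along the segment from the identity to [- C - K], hence they agree
    ([pivot_det_inv_sqrt]). The one-dimensional integral with a complex coefficient
    is obtained by the same argument from its value at one real coefficient.

    That [Q g] is again in the space of quasi-periodic functions follows from
    shifting the summation index, and its smoothness from writing [Q g] as a Gaussian
    times a sum of Laplace transforms with all exponential moments finite
    ([kterm_split], [CkC_laplace]). Finally, products of morphisms are morphisms
    since the Hermitian forms of the two factors add up: the contribution of the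
    intermediate vector cancels ([form_pos_comp]).

    Integrals enter only through linearity, a bound by the supremum over a compact
    set, and the theorem of Fubini for continuous functions; the first two are the notion
    of a bounded functional, the third that of a commuting one. *)

(** * Modulus and exponential of complex numbers *)

Section ComplexPlane.
Variable R : realType.
Local Notation C := R[i].
Implicit Types (z w : C) (x y a b : R).

Local Notation Re := complex.Re.
Local Notation Im := complex.Im.
(** The norm of [R[i]] as a numeric field takes its values in [R[i]]; estimates
    need a modulus valued in [R]. *)
Definition nc (z : C) : R := Normc.normc z.

Lemma Re_add z w : Re (z + w) = Re z + Re w. Proof. by case: z; case: w. Qed.
Lemma Im_add z w : Im (z + w) = Im z + Im w. Proof. by case: z; case: w. Qed.
Lemma Re_opp z : Re (- z) = - Re z. Proof. by case: z. Qed.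
Lemma Im_opp z : Im (- z) = - Im z. Proof. by case: z. Qed.
Lemma Re_mul z w : Re (z * w) = Re z * Re w - Im z * Im w.
Proof. by case: z; case: w. Qed.
Lemma Im_mul z w : Im (z * w) = Re z * Im w + Im z * Re w.
Proof. by case: z; case: w. Qed.
Lemma complexP z w : Re z = Re w -> Im z = Im w -> z = w.
Proof. by case: z; case: w => /= ? ? ? ? -> ->. Qed.
Lemma Re_sum (I : Type) (s : seq I) (P : pred I) (f : I -> C) :
  Re (\sum_(i <- s | P i) f i) = \sum_(i <- s | P i) Re (f i).
Proof. by apply: (big_morph _ Re_add). Qed.
Lemma Im_sum (I : Type) (s : seq I) (P : pred I) (f : I -> C) :
  Im (\sum_(i <- s | P i) f i) = \sum_(i <- s | P i) Im (f i).
Proof. by apply: (big_morph _ Im_add). Qed.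

Lemma ncE z : nc z = Num.sqrt (Re z ^+ 2 + Im z ^+ 2).
Proof. by case: z. Qed.
Lemma nc_ge0 z : 0 <= nc z. Proof. by rewrite ncE sqrtr_ge0. Qed.
Lemma nc0 : nc 0 = 0. Proof. exact: Normc.normc0. Qed.
Lemma ncM z w : nc (z * w) = nc z * nc w. Proof. exact: Normc.normcM. Qed.
Lemma ncD z w : nc (z + w) <= nc z + nc w. Proof. exact: le_normcD. Qed.
Lemma ncN z : nc (- z) = nc z. Proof. exact: normcN. Qed.
Lemma nc0_eq0 z : nc z = 0 -> z = 0. Proof. exact: Normc.eq0_normc. Qed.
Lemma nc_real x : nc (real_complex R x) = `|x|.
Proof. by rewrite ncE /= expr0n /= addr0 sqrtr_sqr. Qed.
Lemma nc_sum (I : Type) (s : seq I) (P : pred I) (f : I -> C) :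
  nc (\sum_(i <- s | P i) f i) <= \sum_(i <- s | P i) nc (f i).
Proof.
elim/big_rec2: _ => [|i y1 y2 _ h]; first by rewrite nc0.
by apply: (le_trans (ncD _ _)); rewrite lerD2l.
Qed.
Lemma Re_le_nc z : `|Re z| <= nc z.
Proof.
rewrite ncE -sqrtr_sqr ler_sqrt; first by rewrite lerDl sqr_ge0.
by rewrite addr_ge0 ?sqr_ge0.
Qed.
Lemma Im_le_nc z : `|Im z| <= nc z.
Proof.
rewrite ncE -sqrtr_sqr ler_sqrt; first by rewrite lerDr sqr_ge0.
by rewrite addr_ge0 ?sqr_ge0.
Qed.
Lemma nc_le z : nc z <= `|Re z| + `|Im z|.
Proof.
have -> : z = real_complex R (Re z) + 'i%C * real_complex R (Im z).
  by case: z => a b /=; apply: complexP => /=; ring.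
apply: (le_trans (ncD _ _)); rewrite ncM !nc_real.
have -> : nc 'i%C = 1 by rewrite ncE /= expr0n expr1n add0r sqrtr1.
by rewrite mul1r /= !(mulr0,mul0r,mulr1,mul1r,subr0,addr0,add0r).
Qed.

Lemma cexpD z w : cexp (z + w) = cexp z * cexp w.
Proof.
rewrite /cexp Re_add Im_add; apply: complexP; rewrite /= expRD ?cosD ?sinD; ring.
Qed.
Lemma cexp0 : cexp (0 : C) = 1.
Proof. by rewrite /cexp /= expR0 cos0 sin0 mulr1 mulr0. Qed.
Lemma nc_cexp z : nc (cexp z) = expR (Re z).
Proof.
rewrite ncE /= !exprMn -mulrDr cos2Dsin2 mulr1 sqrtr_sqr.
by rewrite ger0_norm ?expR_ge0.
Qed.
Lemma cexp_neq0 z : cexp z != 0.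
Proof.
apply/eqP => h; have := nc_cexp z; rewrite h nc0 => /eqP.
by rewrite eq_sym expR_eq0.
Qed.
Lemma norm_sin_le x : `|sin x| <= `|x|.
Proof.
wlog x0 : x / 0 <= x.
  move=> h; case: (leP 0 x) => [/h//|/ltW x0].
  by rewrite -normrN -sinN -(normrN x); apply: h; rewrite oppr_ge0.
rewrite (ger0_norm x0).
move: x0; rewrite le_eqVlt => /predU1P[<-|x0]; first by rewrite sin0 normr0.
have [c _] : exists2 c, c \in `]0, x[%R & sin x - sin 0 = cos c * (x - 0).
  apply: MVT => //.
  by apply: continuous_subspaceT; apply: continuous_sin.
rewrite sin0 !subr0 => ->.
by rewrite normrM (gtr0_norm x0) ler_piMl ?cos_max ?ltW.
Qed.
Lemma norm_cosB1_le x : `|cos x - 1| <= `|x| ^+ 2.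
Proof.
have -> : cos x - 1 = - (2 * sin (x / 2) ^+ 2).
  have hx : x = (x / 2) *+ 2 by rewrite -mulr_natr; field.
  by rewrite {1}hx cos_mulr2n sin2cos2 -mulr_natr; ring.
rewrite normrN normrM normrX (ger0_norm (_ : 0 <= 2))//.
have := norm_sin_le (x / 2); rewrite normrM (gtr0_norm (_ : 0 < 2^-1)) => [h|].
  have : `|sin (x / 2)| ^+ 2 <= (`|x| / 2) ^+ 2.
    by rewrite ler_sqr ?nnegrE ?divr_ge0.
  have := sqr_ge0 `|x|; lra.
by rewrite invr_gt0.
Qed.
Lemma norm_sinB_le x : `|sin x - x| <= `|x| ^+ 2.
Proof.
wlog x0 : x / 0 <= x.
  move=> h; case: (leP 0 x) => [/h//|/ltW x0].
  rewrite -normrN -(normrN x) opprD -sinN.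
  by apply: h; rewrite oppr_ge0.
rewrite (ger0_norm x0).
move: x0; rewrite le_eqVlt => /predU1P[<-|x0]; first by rewrite sin0 subr0 normr0 expr0n.
have [c cx] : exists2 c, c \in `]0, x[%R &
    (sin x - x) - (sin 0 - 0) = (cos c - 1) * (x - 0).
  apply: (@MVT _ (fun x => sin x - x) (fun x => cos x - 1)) => //.
  by apply: continuous_subspaceT => y; apply: cvgB => //; apply: continuous_sin.
rewrite sin0 !subr0 => ->.
rewrite normrM (gtr0_norm x0) expr2 ler_wpM2r ?(ltW x0)//.
have -> : cos c - 1 = - (2 * sin (c / 2) * sin (c / 2)).
  have hc : c = (c / 2) *+ 2 by rewrite -mulr_natr; field.
  by rewrite {1}hc cos_mulr2n -mulr_natr -mulrA -expr2 sin2cos2; ring.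
move: cx; rewrite in_itv /= => /andP[c0 cx].
rewrite normrN !normrM (ger0_norm (_ : 0 <= 2))//.
have := norm_sin_le (c / 2); have := sin_max (c/2).
rewrite (ger0_norm (_ : 0 <= c/2)) ?divr_ge0 ?(ltW c0)//.
have := normr_ge0 (sin (c/2)); nra.
Qed.
Lemma norm_expRB1_le x : `|expR x - 1| <= `|x| * expR `|x|.
Proof.
have h (y : R) : 0 <= y -> expR y - 1 <= y * expR y.
  move=> y0; have := expR_ge1Dx (- y); have := expR_gt0 y.
  rewrite expRN => p; rewrite -(ler_pM2r p) mulVf ?gt_eqF// => ?; lra.
case: (leP 0 x) => x0.
  rewrite !ger0_norm// ?h// subr_ge0 -expR0 ler_expR//.
have lex : expR x <= 1 by rewrite -expR0 ler_expR ltW.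
rewrite ler0_norm ?subr_le0// (ltr0_norm x0).
have := expR_ge1Dx x; have : 1 <= expR (- x) by rewrite -expR0 ler_expR oppr_ge0 ltW.
nra.
Qed.
Lemma norm_expRB1B_le x : `|expR x - 1 - x| <= `|x| ^+ 2 * expR `|x|.
Proof.
have p := expR_gt0 x; have g1 := expR_ge1Dx x.
rewrite ger0_norm; last lra.
have h : expR x - x * expR x <= 1.
  have := expR_ge1Dx (- x).
  by rewrite expRN -(ler_pM2r p) mulVf ?gt_eqF//; lra.
case: (leP 0 x) => x0; first by rewrite ger0_norm//; nra.
rewrite (ltr0_norm x0).
have e1 : 1 <= expR (- x) by rewrite -expR0 ler_expR oppr_ge0 ltW.
have h3 : expR x - 1 - x <= (- x) ^+ 2 by rewrite expr2; nra.
by apply: (le_trans h3); rewrite ler_peMr ?sqr_ge0.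
Qed.

(** Valid for every [z], so that it can be summed and integrated: all
    differentiations of exponentials below rest on it. *)
Lemma nc_cexpB1B z : nc (cexp z - 1 - z) <= 4 * nc z ^+ 2 * expR (nc z).
Proof.
have hr := Re_le_nc z; have hi := Im_le_nc z.
set a := Re z in hr *; set b := Im z in hi *; set r := nc z.
have r0 : 0 <= r := nc_ge0 z.
have ear : expR a <= expR r by rewrite ler_expR (le_trans (ler_norm _)).
have ear' : expR `|a| <= expR r by rewrite ler_expR.
have e1 : 1 <= expR r by rewrite -expR0 ler_expR.
have a2 : `|a| ^+ 2 <= r ^+ 2 by rewrite ler_sqr ?nnegrE.
have b2 : `|b| ^+ 2 <= r ^+ 2 by rewrite ler_sqr ?nnegrE.
have r2 := sqr_ge0 r.
have hRe : `|expR a * cos b - 1 - a| <= 2 * r ^+ 2 * expR r.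
  have -> : expR a * cos b - 1 - a = (expR a - 1 - a) + expR a * (cos b - 1) by ring.
  apply: (le_trans (ler_normD _ _)); rewrite normrM (gtr0_norm (expR_gt0 a)).
  have h1 : `|expR a - 1 - a| <= r ^+ 2 * expR r.
    by apply: (le_trans (norm_expRB1B_le a)); apply: ler_pM => //; rewrite ?exprn_ge0 ?expR_ge0.
  have h2 : expR a * `|cos b - 1| <= expR r * r ^+ 2.
    apply: ler_pM; rewrite ?expR_ge0//.
    exact: (le_trans (norm_cosB1_le b)).
  lra.
have hIm : `|expR a * sin b - b| <= 2 * r ^+ 2 * expR r.
  have -> : expR a * sin b - b = (expR a - 1) * sin b + (sin b - b) by ring.
  apply: (le_trans (ler_normD _ _)); rewrite normrM.
  have h1 : `|expR a - 1| * `|sin b| <= (r * expR r) * r.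
    apply: ler_pM => //.
      by apply: (le_trans (norm_expRB1_le a)); apply: ler_pM; rewrite ?expR_ge0.
    exact: (le_trans (norm_sin_le b)).
  have h2 : `|sin b - b| <= r ^+ 2 := le_trans (norm_sinB_le b) b2.
  nra.
apply: (le_trans (nc_le _)); rewrite !(Re_add,Im_add,Re_opp,Im_opp) /= oppr0 addr0.
rewrite -/a -/b; lra.
Qed.

End ComplexPlane.

(** * Continuity of complex functions and branches of the square root *)

Section ComplexContinuity.
Variable R : realType.
Local Notation C := R[i].
Local Notation Re := complex.Re.
Local Notation Im := complex.Im.

Definition ccont_at (T : topologicalType) (f : T -> C) (x : T) : Prop :=
  (Re (f t) @[t --> x] --> Re (f x)) /\ (Im (f t) @[t --> x] --> Im (f x)).

Definition ccont (T : topologicalType) (f : T -> C) : Prop :=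
  forall x, ccont_at f x.

Lemma ccont_atP (T : topologicalType) (f : T -> C) (x : T) :
  ccont_at f x <->
  forall e : R, 0 < e -> \forall y \near x, nc (f y - f x) <= e.
Proof.
split=> [[/cvgrPdist_le cr /cvgrPdist_le ci] e e0|h].
  have e2 : 0 < e / 2 by rewrite divr_gt0.
  near=> y; apply: (le_trans (nc_le _)).
  rewrite !(Re_add,Im_add,Re_opp,Im_opp) (splitr e) (distrC (Re (f y))) (distrC (Im (f y))).
  by apply: lerD; near: y; [exact: cr|exact: ci].
split; apply/cvgrPdist_le => e e0; near=> y; rewrite distrC.
  rewrite -Re_opp -Re_add; apply: (le_trans (Re_le_nc _)); near: y; exact: h.
rewrite -Im_opp -Im_add; apply: (le_trans (Im_le_nc _)); near: y; exact: h.
Unshelve. all: by end_near. Qed.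

Lemma ccont_at_cst (T : topologicalType) (c : C) (x : T) :
  ccont_at (fun=> c) x.
Proof. by split; apply: cvg_cst. Qed.

Lemma ccont_atD (T : topologicalType) (f g : T -> C) x :
  ccont_at f x -> ccont_at g x -> ccont_at (fun t => f t + g t) x.
Proof.
move=> [fr fi] [gr gi]; split.
  under eq_fun do rewrite Re_add; rewrite Re_add; exact: cvgD.
under eq_fun do rewrite Im_add; rewrite Im_add; exact: cvgD.
Qed.

Lemma ccont_atN (T : topologicalType) (f : T -> C) x :
  ccont_at f x -> ccont_at (fun t => - f t) x.
Proof.
move=> [fr fi]; split.
  under eq_fun do rewrite Re_opp; rewrite Re_opp; exact: cvgN.
under eq_fun do rewrite Im_opp; rewrite Im_opp; exact: cvgN.
Qed.

Lemma ccont_atM (T : topologicalType) (f g : T -> C) x :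
  ccont_at f x -> ccont_at g x -> ccont_at (fun t => f t * g t) x.
Proof.
move=> [fr fi] [gr gi]; split.
  under eq_fun do rewrite Re_mul; rewrite Re_mul; apply: cvgB; exact: cvgM.
under eq_fun do rewrite Im_mul; rewrite Im_mul; apply: cvgD; exact: cvgM.
Qed.

Lemma ccont_at_real (T : topologicalType) (f : T -> R) x :
  f t @[t --> x] --> f x -> ccont_at (fun t => real_complex R (f t)) x.
Proof. by move=> h; split => //=; apply: cvg_cst. Qed.

Lemma ccont_at_comp (T U : topologicalType) (h : T -> U) (f : U -> C) x :
  h t @[t --> x] --> h x -> ccont_at f (h x) -> ccont_at (fun t => f (h t)) x.
Proof.
move=> ch [fr fi]; split.
  exact: (@cvg_comp _ _ _ h (fun u => Re (f u)) _ _ _ ch fr).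
exact: (@cvg_comp _ _ _ h (fun u => Im (f u)) _ _ _ ch fi).
Qed.

Lemma ccont_at_cexp (T : topologicalType) (f : T -> C) x :
  ccont_at f x -> ccont_at (fun t => cexp (f t)) x.
Proof.
move=> [fr fi]; split => /=; apply: cvgM.
- exact: (@cvg_comp _ _ _ (fun t => Re (f t)) (@expR R) _ _ _ fr (@continuous_expR R _)).
- exact: (@cvg_comp _ _ _ (fun t => Im (f t)) (@cos R) _ _ _ fi (@continuous_cos R _)).
- exact: (@cvg_comp _ _ _ (fun t => Re (f t)) (@expR R) _ _ _ fr (@continuous_expR R _)).
- exact: (@cvg_comp _ _ _ (fun t => Im (f t)) (@sin R) _ _ _ fi (@continuous_sin R _)).
Qed.

Lemma ccont_at_sum (T : topologicalType) (I : Type) (s : seq I) (P : pred I)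
    (f : I -> T -> C) x :
  (forall i, ccont_at (f i) x) ->
  ccont_at (fun t => \sum_(i <- s | P i) f i t) x.
Proof.
move=> h; elim: s => [|i s ih].
  under eq_fun do rewrite big_nil; exact: ccont_at_cst.
under eq_fun do rewrite big_cons; case: (P i) => //; exact: ccont_atD.
Qed.

Lemma ccont_at_prod (T : topologicalType) (I : Type) (s : seq I) (P : pred I)
    (f : I -> T -> C) x :
  (forall i, ccont_at (f i) x) ->
  ccont_at (fun t => \prod_(i <- s | P i) f i t) x.
Proof.
move=> h; elim: s => [|i s ih].
  under eq_fun do rewrite big_nil; exact: ccont_at_cst.
under eq_fun do rewrite big_cons; case: (P i) => //; exact: ccont_atM.
Qed.

Lemma complexV (z : C) :
  z^-1 = ((Re z) / (Re z ^+ 2 + Im z ^+ 2) +i* (- (Im z / (Re z ^+ 2 + Im z ^+ 2))))%C.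
Proof. by case: z. Qed.

Lemma sqr_nc_gt0 (z : C) : z != 0 -> 0 < Re z ^+ 2 + Im z ^+ 2.
Proof.
move=> z0; rewrite lt_neqAle eq_sym addr_ge0 ?sqr_ge0// andbT.
rewrite paddr_eq0 ?sqr_ge0// !sqrf_eq0; apply: contra z0 => /andP[/eqP a /eqP b].
by apply/eqP/complexP.
Qed.

Lemma ccont_atV (T : topologicalType) (f : T -> C) x :
  f x != 0 -> ccont_at f x -> ccont_at (fun t => (f t)^-1) x.
Proof.
move=> fx0 [fr fi]; have p := sqr_nc_gt0 fx0.
have h : (Re (f t) ^+ 2 + Im (f t) ^+ 2)^-1 @[t --> x] -->
    (Re (f x) ^+ 2 + Im (f x) ^+ 2)^-1.
  by apply: cvgV; rewrite ?gt_eqF//; apply: cvgD; rewrite !expr2; apply: cvgM.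
split.
  under eq_fun do rewrite complexV; rewrite complexV /=; exact: cvgM.
under eq_fun do rewrite complexV; rewrite complexV /=.
by apply: cvgN; exact: cvgM.
Qed.

Lemma Re_sqrtc (z : C) : Re (sqrtc z) = Num.sqrt ((nc z + Re z) / 2).
Proof. by case: z => a b; rewrite ncE. Qed.

Lemma Re_sqrtc_gt0 (z : C) : 0 < Re z -> 0 < Re (sqrtc z).
Proof.
move=> z0; rewrite Re_sqrtc sqrtr_gt0 divr_gt0// ltr_wpDl ?nc_ge0//.
Qed.

Lemma Im_sqrtc (z : C) : 0 < Re z -> Im (sqrtc z) = Im z / (2 * Re (sqrtc z)).
Proof.
move=> z0; have p := Re_sqrtc_gt0 z0.
rewrite -[in Im z](sqr_sqrtc z) expr2 Im_mul.
by field; rewrite gt_eqF.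
Qed.

Lemma cvg_sqrt (T : topologicalType) (f : T -> R) (x : T) :
  f t @[t --> x] --> f x -> Num.sqrt (f t) @[t --> x] --> Num.sqrt (f x).
Proof.
by move=> h; exact: (@cvg_comp _ _ _ f (@Num.sqrt R) _ _ _ h (@sqrt_continuous R _)).
Qed.

Lemma ccont_at_sqrtc (T : topologicalType) (f : T -> C) x :
  0 < Re (f x) -> ccont_at f x -> ccont_at (fun t => sqrtc (f t)) x.
Proof.
move=> f0 [fr fi].
have nf : nc (f t) @[t --> x] --> nc (f x).
  under eq_fun do rewrite ncE; rewrite ncE.
  apply: (@cvg_sqrt _ (fun t => Re (f t) ^+ 2 + Im (f t) ^+ 2)).
  by apply: cvgD; apply: cvgM.
have h : Re (sqrtc (f t)) @[t --> x] --> Re (sqrtc (f x)).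
  under eq_fun do rewrite Re_sqrtc; rewrite Re_sqrtc.
  apply: (@cvg_sqrt _ (fun t => (nc (f t) + Re (f t)) / 2)).
  by apply: cvgMl; apply: cvgD.
split=> //; rewrite (Im_sqrtc f0).
have near_pos : \forall t \near x, 0 < Re (f t) by exact: (cvgr_gt _ fr).
have : Im (f t) / (2 * Re (sqrtc (f t))) @[t --> x] --> Im (f x) / (2 * Re (sqrtc (f x))).
  apply: cvgM => //; apply: cvgV; first by rewrite gt_eqF// mulr_gt0// Re_sqrtc_gt0.
  exact: cvgMr.
apply: cvg_trans; apply: near_eq_cvg.
by apply: filterS near_pos => t ft; rewrite Im_sqrtc.
Qed.

(** Two continuous square roots of the same nonvanishing function that agree at
    one end of a path agree at the other end: their quotient is real, continuous
    and squares to 1, so it cannot jump from 1 to -1. *)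
Lemma eq_sqrt_path (f g : R -> C) :
  (forall s : R, 0 <= s <= 1 -> ccont_at f s) ->
  (forall s : R, 0 <= s <= 1 -> ccont_at g s) ->
  (forall s : R, 0 <= s <= 1 -> g s != 0) ->
  (forall s : R, 0 <= s <= 1 -> f s ^+ 2 = g s ^+ 2) ->
  f 0 = g 0 -> f 1 = g 1.
Proof.
move=> cf cg g0 fg f0g0.
pose q s := f s / g s.
have q2 s : 0 <= s <= 1 -> q s = 1 \/ q s = -1.
  move=> s01; have : q s ^+ 2 == 1.
    by rewrite /q expr_div_n fg// divff// expf_neq0 ?g0.
  by rewrite sqrf_eq1 => /orP[]/eqP; [left|right].
have q0 : q 0 = 1 by rewrite /q f0g0 divff// g0// lexx ler01.
suff q1 : q 1 = 1.
  have g1 : g 1 != 0 by rewrite g0// lexx ler01.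
  by rewrite -[f 1](divfK g1) -/(q 1) q1 mul1r.
have [//|q1] := q2 1 ltac:(by rewrite lexx ler01).
have cq : {within `[0, 1], continuous (fun s => Re (q s))}.
  apply/continuous_in_subspaceT => s; rewrite inE /= in_itv /= => s01.
  have [] : ccont_at q s; last by [].
  by apply: ccont_atM; [exact: cf|apply: ccont_atV; [exact: g0|exact: cg]].
have [|s s01] := IVT (ler01 : 0 <= 1 :> R) cq (v := 0).
  by rewrite q0 q1 /= minEle maxEle; case: ifPn; rewrite ?oppr_le0 ?ler01 ?lexx //; lra.
move=> qs; move: s01; rewrite in_itv /= => /q2[] e; move: qs; rewrite e /=.
  by move=> /eqP; rewrite oner_eq0.
by move=> /eqP; rewrite oppr_eq0 oner_eq0.
Qed.

End ComplexContinuity.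

(** * Dominated unconditional sums *)

Section UnconditionalSums.
#[local] Existing Instance totally_filter.
Variable R : realType.
Local Notation C := R[i].
Local Notation Re := complex.Re.
Local Notation Im := complex.Im.

Lemma sum_fsetD (I : choiceType) (V : nmodType) (A B : {fset I}) (f : I -> V) :
  (A `<=` B)%fset ->
  \sum_(i <- B) f i = \sum_(i <- A) f i + \sum_(i <- (B `\` A)%fset) f i.
Proof.
move=> AB; rewrite -big_cat; apply: perm_big; apply: uniq_perm.
- exact: fset_uniq.
- rewrite cat_uniq !fset_uniq /= andbT; apply/hasPn => x.
  by rewrite in_fsetD => /andP[].
- move=> x; rewrite mem_cat in_fsetD.
  by case: (boolP (x \in A)) => //= xA; apply: (fsubsetP AB).
Qed.

Lemma partial_sumE (I : choiceType) (f : I -> R) (A : {fset I}) :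
  summability.partial_sum (f : I -> R^o) A = \sum_(i <- A) f i.
Proof. by rewrite /summability.partial_sum big_seq_fsetE. Qed.

(** Summability of a nonnegative family, expressed without its sum. *)
Definition majorant (I : choiceType) (M : I -> R) : Prop :=
  (forall i, 0 <= M i) /\
  exists B : R, forall A : {fset I}, \sum_(i <- A) M i <= B.

Lemma majorant_ge0 (I : choiceType) (M : I -> R) i : majorant M -> 0 <= M i.
Proof. by case. Qed.

(** A finite sum within [e] of the supremum of all finite sums leaves a remainder
    of at most [e]. *)
Lemma majorant_tail (I : choiceType) (M : I -> R) : majorant M ->
  forall e : R, 0 < e -> exists A0 : {fset I}, forall A, (A0 `<=` A)%fset ->
    \sum_(i <- (A `\` A0)%fset) M i <= e.
Proof.
move=> [M0 [B MB]] e e0.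
pose E := [set x | exists A : {fset I}, x = \sum_(i <- A) M i].
have hE : has_sup E.
  by split; [exists (\sum_(i <- (fset0 : {fset I})) M i); exists fset0
            |exists B => _ [A ->]].
have [_ [A0 ->] h] := sup_adherent e0 hE.
exists A0 => A AA0.
have : \sum_(i <- A) M i <= sup E by apply: ub_le_sup; [case: hE|exists A].
rewrite (sum_fsetD _ AA0); lra.
Qed.

(** Finite sums form a Cauchy filter along finite subsets, because they differ by
    tails of the majorant. *)
Lemma real_sum_tail (I : choiceType) (M : I -> R) (A0 : {fset I}) (e : R) :
  majorant M ->
  (forall A, (A0 `<=` A)%fset -> \sum_(i <- (A `\` A0)%fset) M i <= e) ->
  forall f : I -> R, (forall i, `|f i| <= M i) -> forall A, (A0 `<=` A)%fset ->
  `|summability.sum (f : I -> R^o) - \sum_(i <- A) f i| <= e *+ 2.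
Proof.
move=> MM hA0 f fM A AA0.
have dif A1 A2 e1 : (forall A, (A1 `<=` A)%fset -> \sum_(i <- (A `\` A1)%fset) M i <= e1) ->
    (A1 `<=` A2)%fset -> `|\sum_(i <- A1) f i - \sum_(i <- A2) f i| <= e1.
  move=> h1 h12; rewrite (sum_fsetD f h12) opprD addrA subrr add0r normrN.
  by apply: le_trans (h1 _ h12); apply: (le_trans (ler_norm_sum _ _ _)); apply: ler_sum.
have cv : cvg (summability.partial_sum (f : I -> R^o) @ summability.totally).
  apply: (@cauchy_cvg R^o) => //; apply: (@cauchy_exP R R^o _ _) => d d0.
  have [A1 h1] := majorant_tail MM (divr_gt0 d0 (ltr0Sn R 1)).
  exists (\sum_(i <- A1) f i); exists A1 => // A2 /= A12.
  rewrite /ball /= partial_sumE; apply: le_lt_trans (dif _ _ _ h1 A12) _; lra.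
apply/ler_addgt0Pr => d d0.
have [A2 _ hA2] : \forall A' \near summability.totally,
    `|summability.sum (f : I -> R^o) - summability.partial_sum (f : I -> R^o) A'| <= d.
  by move/cvgrPdist_le : cv; apply.
pose A3 := (A2 `|` A)%fset.
have := hA2 A3 (fsubsetUl _ _); rewrite partial_sumE => h3.
have h4 : `|\sum_(i <- A0) f i - \sum_(i <- A3) f i| <= e.
  by apply: dif => //; apply: (fsubset_trans AA0); apply: fsubsetUr.
have h5 : `|\sum_(i <- A0) f i - \sum_(i <- A) f i| <= e by apply: dif.
have -> : summability.sum (f : I -> R^o) - \sum_(i <- A) f i =
  (summability.sum (f : I -> R^o) - \sum_(i <- A3) f i)
  - (\sum_(i <- A0) f i - \sum_(i <- A3) f i)
  + (\sum_(i <- A0) f i - \sum_(i <- A) f i) by ring.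
apply: (le_trans (ler_normD _ _)).
have := ler_normB (summability.sum (f : I -> R^o) - \sum_(i <- A3) f i) (\sum_(i <- A0) f i - \sum_(i <- A3) f i).
rewrite mulr2n; move: h3 h4 h5; lra.
Qed.

(** The finite set beyond which the tails are small depends on the majorant
    only; this uniformity is what makes sums of dominated families commute with
    limits and with bounded linear functionals. *)
Lemma csum_tail (I : choiceType) (M : I -> R) : majorant M ->
  forall e : R, 0 < e -> exists A0 : {fset I},
  forall f : I -> C, (forall i, nc (f i) <= M i) ->
  forall A, (A0 `<=` A)%fset -> nc (csum f - \sum_(i <- A) f i) <= e.
Proof.
move=> MM e e0; have [A0 h0] := majorant_tail MM (divr_gt0 e0 (ltr0Sn R 3)).
exists A0 => f fM A AA0.
apply: (le_trans (nc_le _)).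
have := real_sum_tail MM h0 (fun i => le_trans (Re_le_nc (f i)) (fM i)) AA0.
have := real_sum_tail MM h0 (fun i => le_trans (Im_le_nc (f i)) (fM i)) AA0.
rewrite -Re_sum -Im_sum !(Re_add,Im_add,Re_opp,Im_opp) /csum /=; lra.
Qed.

Definition has_csum (I : choiceType) (f : I -> C) (a : C) : Prop :=
  forall e : R, 0 < e -> exists A0 : {fset I}, forall A, (A0 `<=` A)%fset ->
    nc (a - \sum_(i <- A) f i) <= e.

Lemma csum_unique (I : choiceType) (f : I -> C) (a : C) :
  has_csum f a -> csum f = a.
Proof.
move=> h; apply: complexP => /=; apply: cvg_lim => //;
  apply/cvgrPdist_le => e /h [A0 hA]; exists A0 => // A /= /hA {}hA;
  rewrite partial_sumE.
  rewrite -Re_sum -Re_opp -Re_add; exact: le_trans (Re_le_nc _) hA.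
rewrite -Im_sum -Im_opp -Im_add; exact: le_trans (Im_le_nc _) hA.
Qed.

Lemma csum_norm_le (I : choiceType) (M : I -> R) : majorant M ->
  exists2 B : R, 0 <= B & forall (f : I -> C) (c : R), 0 <= c ->
    (forall i, nc (f i) <= c * M i) -> nc (csum f) <= c * B.
Proof.
move=> MM; have [M0 [B MB]] := MM.
have B0 : 0 <= B by have := MB fset0; rewrite big_seq_fset0.
exists B => // f c c0 fM.
have cM : majorant (fun i => c * M i).
  split=> [i|]; first by rewrite mulr_ge0.
  by exists (c * B) => A; rewrite -mulr_sumr ler_wpM2l.
apply/ler_addgt0Pr => e e0.
have [A0 h] := csum_tail cM e0.
have := h f fM A0 (fsubset_refl _) => h1.
have -> : csum f = (csum f - \sum_(i <- A0) f i) + \sum_(i <- A0) f i by ring.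
apply: (le_trans (ncD _ _)); rewrite addrC lerD//.
apply: (le_trans (nc_sum _ _ _)).
apply: (@le_trans _ _ (\sum_(i <- A0) c * M i)); first exact: ler_sum.
by rewrite -mulr_sumr ler_wpM2l.
Qed.

Lemma csumZD (I : choiceType) (M N : I -> R) (c : C) (f g : I -> C) :
  majorant M -> majorant N ->
  (forall i, nc (f i) <= M i) -> (forall i, nc (g i) <= N i) ->
  csum (fun i => c * f i + g i) = c * csum f + csum g.
Proof.
move=> MM NN fM gN; apply: csum_unique => e e0.
have d0 : 0 < e / (nc c + 1 + 1) by rewrite divr_gt0// ltr_wpDl// addr_ge0// nc_ge0.
have [A1 h1] := csum_tail MM d0; have [A2 h2] := csum_tail NN d0.
exists (A1 `|` A2)%fset => A; rewrite fsubUset => /andP[a1 a2].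
rewrite big_split /= -mulr_sumr.
have -> : c * csum f + csum g - (c * \sum_(i <- A) f i + \sum_(i <- A) g i) =
  c * (csum f - \sum_(i <- A) f i) + (csum g - \sum_(i <- A) g i) by ring.
apply: (le_trans (ncD _ _)); rewrite ncM.
have := h1 f fM A a1; have := h2 g gN A a2.
set d := e / _ in d0 *; have -> : e = (nc c + 1 + 1) * d.
  by rewrite mulrC divfK// gt_eqF// ltr_wpDl// addr_ge0// nc_ge0.
move=> u v; have := ler_wpM2l (nc_ge0 c) v; lra.
Qed.

Lemma majorantZ (I : choiceType) (M : I -> R) (c : R) :
  0 <= c -> majorant M -> majorant (fun i => c * M i).
Proof.
move=> c0 [M0 [B MB]]; split=> [i|]; first by rewrite mulr_ge0.
by exists (c * B) => A; rewrite -mulr_sumr ler_wpM2l.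
Qed.

Lemma majorant_le (I : choiceType) (M N : I -> R) :
  (forall i, 0 <= N i <= M i) -> majorant M -> majorant N.
Proof.
move=> h [M0 [B MB]]; split=> [i|]; first by case/andP: (h i).
by exists B => A; apply: le_trans (MB A); apply: ler_sum => i _; case/andP: (h i).
Qed.

Lemma majorant_inj (I J : choiceType) (M : I -> R) (h : J -> I) :
  injective h -> majorant M -> majorant (fun j => M (h j)).
Proof.
move=> hi [M0 [B MB]]; split=> //; exists B => A.
apply: le_trans (MB [fset h j | j in A]%fset).
by rewrite big_imfset //= => x y _ _ /hi.
Qed.

Lemma sum_fsetM (I J : choiceType) (V : nmodType) (A : {fset I}) (B : {fset J})
    (f : I * J -> V) :
  \sum_(p <- (A `*` B)%fset) f p = \sum_(i <- A) \sum_(j <- B) f (i, j).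
Proof.
rewrite -big_allpairs; apply: perm_big; apply: uniq_perm.
- exact: fset_uniq.
- by apply: allpairs_uniq; rewrite ?fset_uniq// => -[? ?] [? ?] _ _ [-> ->].
- move=> [i j]; rewrite in_fsetM /=; apply/andP/allpairsP => [[iA jB]|].
    by exists (i, j).
  by move=> [[i' j'] [/= iA jB [-> ->]]].
Qed.

Lemma sum_fsetU_le (I : choiceType) (A B : {fset I}) (f : I -> R) :
  (forall i, 0 <= f i) ->
  \sum_(i <- (A `|` B)%fset) f i <= \sum_(i <- A) f i + \sum_(i <- B) f i.
Proof.
move=> f0; rewrite (sum_fsetD _ (fsubsetUl A B)) lerD2l.
have sB : ((A `|` B) `\` A `<=` B)%fset.
  by apply/fsubsetP => x; rewrite in_fsetD in_fsetU => /andP[/negPf->].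
by rewrite [leRHS](sum_fsetD _ sB) lerDl sumr_ge0.
Qed.

Lemma majorant_prod (I J : choiceType) (M : I -> R) (N : J -> R) :
  majorant M -> majorant N -> majorant (fun p : I * J => M p.1 * N p.2).
Proof.
move=> [M0 [B MB]] [N0 [D ND]]; split=> [p|]; first by rewrite mulr_ge0.
exists (B * D) => A.
pose A1 := [fset p.1 | p in A]%fset; pose A2 := [fset p.2 | p in A]%fset.
have sA : (A `<=` A1 `*` A2)%fset.
  apply/fsubsetP => p pA; rewrite in_fsetM; apply/andP; split.
    by apply/imfsetP; exists p.
  by apply/imfsetP; exists p.
apply: (@le_trans _ _ (\sum_(p <- (A1 `*` A2)%fset) M p.1 * N p.2)).
  rewrite (sum_fsetD _ sA) lerDl; apply: sumr_ge0 => i _; exact: mulr_ge0.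
have -> : \sum_(p <- (A1 `*` A2)%fset) M p.1 * N p.2 =
    (\sum_(i <- A1) M i) * (\sum_(j <- A2) N j).
  rewrite sum_fsetM mulr_suml; apply: eq_bigr => i _.
  by rewrite mulr_sumr.
apply: ler_pM => //; apply: sumr_ge0 => //.
Qed.

Lemma majorantM1 (I J : choiceType) (M : I * J -> R) (i : I) :
  majorant M -> majorant (fun j => M (i, j)).
Proof. by move=> MM; apply: (majorant_inj _ MM) => x y []. Qed.

Lemma csum_reindex (I J : choiceType) (M : I -> R) (h : J -> I) (h' : I -> J)
    (f : I -> C) :
  cancel h h' -> cancel h' h -> majorant M -> (forall i, nc (f i) <= M i) ->
  csum f = csum (fun j => f (h j)).
Proof.
move=> hK h'K MM fM; symmetry; apply: csum_unique => e e0.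
have [A0 hA0] := csum_tail MM e0.
exists [fset h' i | i in A0]%fset => A sA.
have := hA0 f fM [fset h j | j in A]%fset.
rewrite big_imfset /=; last by move=> x y _ _ /(can_inj hK).
apply; apply/fsubsetP => i iA0; apply/imfsetP; exists (h' i); rewrite ?h'K//=.
by apply: (fsubsetP sA); apply/imfsetP; exists i.
Qed.

Lemma csum_fubini (I J : choiceType) (M : I * J -> R) (f : I * J -> C) :
  majorant M -> (forall p, nc (f p) <= M p) ->
  csum f = csum (fun i => csum (fun j => f (i, j))).
Proof.
move=> MM fM; symmetry; apply: csum_unique => e e0.
have e20 : 0 < e / 2 by rewrite divr_gt0.
have [A0 hA0] := csum_tail MM e20.
exists [fset p.1 | p in A0]%fset => A sA.
pose d := e / 2 / (size (enum_fset A)).+1%:R.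
have d0 : 0 < d by rewrite divr_gt0.
have hJ i : exists J0 : {fset J}, forall B, (J0 `<=` B)%fset ->
    nc (csum (fun j => f (i, j)) - \sum_(j <- B) f (i, j)) <= d.
  have [J0 hJ0] := csum_tail (majorantM1 i MM) d0.
  by exists J0 => B; apply: hJ0.
pose J0 i := sval (cid (hJ i)).
pose B := ([fset p.2 | p in A0] `|` \bigcup_(i <- A) J0 i)%fset.
have hB i : i \in A -> nc (csum (fun j => f (i, j)) - \sum_(j <- B) f (i, j)) <= d.
  move=> iA; apply: (svalP (cid (hJ i))).
  apply: (@fsubset_trans _ (\bigcup_(i <- A) J0 i)%fset); last exact: fsubsetUr.
  by apply: bigfcup_sup.
have AB : (A0 `<=` A `*` B)%fset.
  apply/fsubsetP => p pA0; rewrite in_fsetM; apply/andP; split.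
    by apply: (fsubsetP sA); apply/imfsetP; exists p.
  by rewrite in_fsetU; apply/orP; left; apply/imfsetP; exists p.
have h1 := hA0 f fM _ AB.
rewrite sum_fsetM in h1.
have -> : csum f - \sum_(i <- A) csum (fun j => f (i, j)) =
  (csum f - \sum_(i <- A) \sum_(j <- B) f (i, j)) -
  \sum_(i <- A) (csum (fun j => f (i, j)) - \sum_(j <- B) f (i, j)).
  by rewrite big_split /= sumrN; ring.
apply: (le_trans (ncD _ _)); rewrite ncN (splitr e); apply: lerD => //.
apply: (le_trans (nc_sum _ _ _)).
apply: (@le_trans _ _ (\sum_(i <- A) d)).
  by rewrite big_seq [leRHS]big_seq; apply: ler_sum.
rewrite big_const_seq count_predT iter_addr_0 /d -[leLHS]mulr_natr -mulrA.
rewrite ler_piMr ?(ltW e20)// mulrC.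
by rewrite ler_pdivrMr ?ltr0Sn// mul1r ler_nat.
Qed.

Lemma csum_eq1 (I : choiceType) (f : I -> C) (a : I) :
  (forall i, i != a -> f i = 0) -> csum f = f a.
Proof.
move=> f0; apply: csum_unique => e e0; exists [fset a]%fset => A.
rewrite fsub1set => aA; rewrite (big_fsetD1 a)//= big_seq big1 ?addr0 ?subrr ?nc0 ?ltW//.
by move=> i; rewrite !inE => /andP[/f0].
Qed.

Lemma csum0 (I : choiceType) : csum (fun _ : I => 0 : C) = 0.
Proof.
by apply: csum_unique => e e0; exists fset0 => A _; rewrite big1// subrr nc0 ltW.
Qed.

Lemma csumZ (I : choiceType) (M : I -> R) (c : C) (f : I -> C) :
  majorant M -> (forall i, nc (f i) <= M i) -> csum (fun i => c * f i) = c * csum f.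
Proof.
move=> MM fM; have m0 i : nc (0 : C) <= M i by rewrite nc0 (majorant_ge0 _ MM).
have := csumZD c MM MM fM m0; rewrite csum0 addr0 => <-.
by congr csum; apply/funext => i; rewrite addr0.
Qed.

Lemma csumM (I J : choiceType) (M : I -> R) (N : J -> R) (f : I -> C) (g : J -> C) :
  majorant M -> majorant N ->
  (forall i, nc (f i) <= M i) -> (forall j, nc (g j) <= N j) ->
  csum f * csum g = csum (fun p : I * J => f p.1 * g p.2).
Proof.
move=> MM NN fM gN.
rewrite (csum_fubini (majorant_prod MM NN)) /=; last first.
  by move=> p; rewrite ncM ler_pM ?nc_ge0.
rewrite mulrC -(csumZ _ MM fM); congr csum; apply/funext => i.
by rewrite (csumZ _ NN gN) mulrC.
Qed.

Lemma majorant_int : majorant (fun k : int => expR (- `|k%:~R : R|)).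
Proof.
split=> [k|]; first exact: expR_ge0.
pose r : R := expR (-1).
have r0 : 0 < r := expR_gt0 _.
have r1 : r < 1 by rewrite /r expR_lt1; lra.
have kE (k : int) : expR (- `|k%:~R : R|) = r ^+ `|k|%N.
  by rewrite /r -expRM_natl mulrN mulr1 -intr_norm -abszE.
exists (2 / (1 - r)) => A.
pose N := \max_(k <- A) `|k|%N.
pose F := [fset n | n in iota 0 N.+1]%fset.
have memF n : (n \in F) = (n < N.+1)%N by rewrite in_fset; apply: (mem_iota 0 N.+1 n).
pose B := ([fset Posz n | n in F] `|` [fset - Posz n | n in F])%fset.
have AB : (A `<=` B)%fset.
  apply/fsubsetP => k kA.
  have kN : (`|k| < N.+1)%N by rewrite ltnS; apply: (@leq_bigmax_seq _ _ _ (fun k : int => `|k|%N)).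
  rewrite in_fsetU; apply/orP; case: (intP k) (kN) => [|n|n] h; [left|left|right];
    apply/imfsetP; [exists 0%N|exists n.+1|exists n.+1] => //; rewrite /= memF; exact: h.
have geo : \sum_(n <- F) r ^+ n <= 1 / (1 - r).
  rewrite (perm_big (iota 0 N.+1)); last first.
    apply: uniq_perm; [exact: fset_uniq|exact: iota_uniq|].
    by move=> x; rewrite memF; symmetry; apply: (mem_iota 0 N.+1 x).
  rewrite -/(index_iota 0 N.+1) big_mkord ler_pdivlMr ?subr_gt0// mulrC.
  have := subrX1 r N.+1; have := exprn_ge0 N.+1 (ltW r0).
  set S := \sum_(i < N.+1) _; lra.
apply: (@le_trans _ _ (\sum_(k <- B) expR (- `|(k : int)%:~R : R|))).
  by rewrite (sum_fsetD _ AB) lerDl; apply: sumr_ge0 => i _; exact: expR_ge0.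
apply: (le_trans (sum_fsetU_le _ _ _)) => [i|]; first exact: expR_ge0.
have -> : 2 / (1 - r) = 1 / (1 - r) + 1 / (1 - r) by ring.
apply: lerD; rewrite big_imfset /=.
- by apply: le_trans geo; apply: ler_sum => n _; rewrite kE.
- by move=> x y _ _ [].
- by apply: le_trans geo; apply: ler_sum => n _; rewrite kE abszN.
- by move=> x y _ _ /oppr_inj [].
Qed.

End UnconditionalSums.

(** * Integration as a bounded functional *)

Section IntegralFunctionals.
Variable R : realType.
Local Notation C := R[i].
Local Notation Re := complex.Re.
Local Notation Im := complex.Im.
Implicit Types (X Y Z : topologicalType).

Lemma ccont_cst Y (c : C) : ccont (fun _ : Y => c).
Proof. by move=> x; apply: ccont_at_cst. Qed.
Lemma ccontD Y (f g : Y -> C) : ccont f -> ccont g -> ccont (fun y => f y + g y).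
Proof. by move=> cf cg x; apply: ccont_atD. Qed.
Lemma ccontN Y (f : Y -> C) : ccont f -> ccont (fun y => - f y).
Proof. by move=> cf x; apply: ccont_atN. Qed.
Lemma ccontM Y (f g : Y -> C) : ccont f -> ccont g -> ccont (fun y => f y * g y).
Proof. by move=> cf cg x; apply: ccont_atM. Qed.
Lemma ccont_comp Y Z (h : Y -> Z) (f : Z -> C) :
  continuous h -> ccont f -> ccont (fun y => f (h y)).
Proof. by move=> ch cf x; apply: (@ccont_at_comp R Y Z h f x) => //; exact: ch. Qed.
Lemma ccont_cexp Y (f : Y -> C) : ccont f -> ccont (fun y => cexp (f y)).
Proof. by move=> cf x; apply: ccont_at_cexp. Qed.
Lemma ccont_real Y (f : Y -> R) : continuous f -> ccont (fun y => real_complex R (f y)).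
Proof. by move=> cf x; apply: ccont_at_real; apply: cf. Qed.
Lemma ccont_sum Y (I : Type) (s : seq I) (P : pred I) (f : I -> Y -> C) :
  (forall i, ccont (f i)) -> ccont (fun y => \sum_(i <- s | P i) f i y).
Proof. by move=> cf x; apply: ccont_at_sum => i; apply: cf. Qed.
Lemma ccontRe Y (f : Y -> C) : ccont f -> continuous (fun y => Re (f y)).
Proof. by move=> cf x; case: (cf x). Qed.
Lemma ccontIm Y (f : Y -> C) : ccont f -> continuous (fun y => Im (f y)).
Proof. by move=> cf x; case: (cf x). Qed.

Lemma continuous_fst X Y : continuous (@fst X Y).
Proof. by move=> p; exact: cvg_fst. Qed.
Lemma continuous_snd X Y : continuous (@snd X Y).
Proof. by move=> p; exact: cvg_snd. Qed.
Lemma continuous_pair X Y Z (f : Z -> X) (g : Z -> Y) :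
  continuous f -> continuous g -> continuous (fun z => (f z, g z)).
Proof.
by move=> cf cg z; apply: cvg_pair; [exact: cf|exact: cg].
Qed.
Lemma continuous_compose X Y Z (f : X -> Y) (g : Y -> Z) :
  continuous f -> continuous g -> continuous (fun x => g (f x)).
Proof. by move=> cf cg x; exact: (@cvg_comp _ _ _ f g _ _ _ (cf x) (cg (f x))). Qed.
Lemma continuous_cst X Y (y : Y) : continuous (fun _ : X => y).
Proof. by move=> x; exact: cvg_cst. Qed.
Lemma continuous_ident X : continuous (fun x : X => x).
Proof. by move=> x; exact: cvg_id. Qed.

Lemma continuous_pairl X Y (y : Y) : continuous (fun x : X => (x, y)).
Proof. exact: (continuous_pair (@continuous_ident X) (@continuous_cst _ _ y)). Qed.
Lemma continuous_pairr X Y (x : X) : continuous (fun y : Y => (x, y)).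
Proof. exact: (continuous_pair (@continuous_cst _ _ x) (@continuous_ident Y)). Qed.
Lemma continuous_swap X Y : continuous (fun p : X * Y => (p.2, p.1)).
Proof. exact: (continuous_pair (@continuous_snd X Y) (@continuous_fst X Y)). Qed.

Lemma ccont_slicer X Y (F : X -> Y -> C) x :
  ccont (fun p : X * Y => F p.1 p.2) -> ccont (F x).
Proof. by move=> cF; exact: (@ccont_comp _ _ (fun y => (x, y)) (fun p => F p.1 p.2) (@continuous_pairr _ _ x) cF). Qed.
Lemma ccont_slicel X Y (F : X -> Y -> C) y :
  ccont (fun p : X * Y => F p.1 p.2) -> ccont (F^~ y).
Proof. by move=> cF; exact: (@ccont_comp _ _ (fun x => (x, y)) (fun p => F p.1 p.2) (@continuous_pairl _ _ y) cF). Qed.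
Lemma ccont_swap X Y (F : X -> Y -> C) :
  ccont (fun p : X * Y => F p.1 p.2) -> ccont (fun p : Y * X => F p.2 p.1).
Proof. by move=> cF; exact: (@ccont_comp _ _ (fun p => (p.2, p.1)) (fun p => F p.1 p.2) (@continuous_swap Y X) cF). Qed.

(** Compactness makes the modulus of continuity in the parameter uniform. *)
Lemma compact_near_param X Y (B : set Y) (F : X -> Y -> C) (x0 : X) (d : R) :
  compact B -> 0 < d -> ccont (fun p : X * Y => F p.1 p.2) ->
  \forall x \near x0, B `<=` (fun y => nc (F x y - F x0 y) <= d).
Proof.
move=> cB d0 cF; move/compact_near_coveringP: cB; apply => y By.
have d20 : 0 < d / 2 by rewrite divr_gt0.
have /ccont_atP/(_ _ d20) := cF (x0, y).
have /ccont_atP/(_ _ d20) h1 := ccont_slicer x0 cF y.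
case=> -[U V] /= [U0 V0] UV.
exists ([set y' | V y' /\ nc (F x0 y' - F x0 y) <= d / 2], U) => /=.
  by split=> //; apply: filterI.
move=> [y' x] /= [[Vy h] Ux].
have -> : F x y' - F x0 y' = (F x y' - F x0 y) - (F x0 y' - F x0 y) by ring.
rewrite (splitr d); apply: (le_trans (ncD _ _)); rewrite ncN lerD//.
exact: (UV (x, y')).
Qed.

(** The two properties of integration over a compact set that are used:
    linearity, and control by the supremum over that set. *)
Definition bounded_functional Y (L : (Y -> C) -> C) : Prop :=
  (forall (a : C) f g, ccont f -> ccont g ->
     L (fun y => a * f y + g y) = a * L f + L g) /\
  exists (B : set Y) (c : R), [/\ compact B, 0 <= c &
    forall f e, ccont f -> 0 <= e -> (forall y, B y -> nc (f y) <= e) ->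
      nc (L f) <= c * e].

Section Theory.
Context (Y : topologicalType) (L : (Y -> C) -> C).
Hypothesis HL : bounded_functional L.

Lemma bfZ a f : ccont f -> L (fun y => a * f y) = a * L f.
Proof.
case: HL => lin _ cf; have := lin a f (fun=> 0) cf (ccont_cst _).
have -> : L (fun=> 0) = 0.
  have := lin (-1) (fun=> 0) (fun=> 0) (ccont_cst _) (ccont_cst _).
  by rewrite mulr0 addr0 mulN1r addNr.
by under eq_fun do rewrite addr0; rewrite addr0.
Qed.
Lemma bfD f g : ccont f -> ccont g -> L (fun y => f y + g y) = L f + L g.
Proof.
case: HL => lin _ cf cg; have := lin 1 f g cf cg.
by under eq_fun do rewrite mul1r; rewrite mul1r.
Qed.
Lemma bfB f g : ccont f -> ccont g -> L (fun y => f y - g y) = L f - L g.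
Proof.
move=> cf cg; rewrite bfD//; last exact: ccontN.
congr (_ + _); rewrite -mulN1r -bfZ//.
by congr L; apply/funext => y; rewrite mulN1r.
Qed.
Lemma bf_sum (I : Type) (s : seq I) (f : I -> Y -> C) :
  (forall i, ccont (f i)) ->
  L (fun y => \sum_(i <- s) f i y) = \sum_(i <- s) L (f i).
Proof.
move=> cf; elim: s => [|i s ih].
  under eq_fun do rewrite big_nil; rewrite big_nil.
  by have := bfZ 0 (@ccont_cst Y 0); rewrite !mul0r.
under eq_fun do rewrite big_cons; rewrite big_cons bfD ?ih//.
exact: ccont_sum.
Qed.

Lemma bf_param X (F : X -> Y -> C) : ccont (fun p : X * Y => F p.1 p.2) ->
  ccont (fun x => L (F x)).
Proof.
move=> cF x0; apply/ccont_atP => e e0.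
case: HL => lin [B [c [cB c0 bd]]].
pose d := e / (c + 1).
have c1 : 0 < c + 1 by rewrite ltr_wpDl.
have d0 : 0 < d by rewrite divr_gt0.
have := compact_near_param x0 cB d0 cF.
apply: filterS => x hx; rewrite -bfB; try exact: ccont_slicer.
apply: le_trans (_ : c * d <= e).
  apply: bd; rewrite ?(ltW d0)//.
  by apply: ccontD; [|apply: ccontN]; exact: ccont_slicer.
by rewrite /d mulrA ler_pdivrMr// mulrC ler_wpM2l ?(ltW e0)// lerDl.
Qed.
End Theory.

Lemma bounded_functional_comp Y Z (L : (Y -> C) -> C) (K : (Z -> C) -> C) :
  bounded_functional L -> bounded_functional K ->
  bounded_functional (fun f : Y * Z -> C => L (fun y => K (fun z => f (y, z)))).
Proof.
move=> HL HK.
have cK (f : Y * Z -> C) : ccont f -> ccont (fun y => K (fun z => f (y, z))).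
  move=> cf; apply: (@bf_param _ _ HK Y (fun y z => f (y, z))).
  by under eq_fun do rewrite -surjective_pairing.
have cs (f : Y * Z -> C) y : ccont f -> ccont (fun z => f (y, z)).
  by move=> cf; exact: (@ccont_comp _ _ (fun z => (y, z)) f (@continuous_pairr _ _ y) cf).
split=> [a f g cf cg|].
  under eq_fun => y do rewrite (HK.1 a _ _ (cs f y cf) (cs g y cg)).
  by rewrite (HL.1 a) //; apply: cK.
case: (HL) => _ [B [c [cB c0 bd]]]; case: (HK) => _ [B' [c' [cB' c'0 bd']]].
exists (B `*` B'), (c * c'); split; [exact: compact_setX|exact: mulr_ge0|].
move=> f e cf e0 fe; rewrite -mulrA; apply: bd; [exact: cK|exact: mulr_ge0|].
by move=> y By; apply: bd' => //; [exact: cs|move=> z Bz; apply: fe].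
Qed.

Lemma bounded_functional_pull Y Z (h : Y -> Z) (L : (Y -> C) -> C) :
  continuous h -> bounded_functional L ->
  bounded_functional (fun f : Z -> C => L (fun y => f (h y))).
Proof.
move=> ch [lin [B [c [cB c0 bd]]]]; split=> [a f g cf cg|].
  by apply: lin; exact: ccont_comp.
exists (h @` B), c; split=> //.
  by apply: continuous_compact => //; exact: continuous_subspaceT.
move=> f e cf e0 fe; apply: bd => //; first exact: ccont_comp.
by move=> y By; apply: fe; exists y.
Qed.

Lemma bounded_functional_eval Y (y : Y) : bounded_functional (fun f : Y -> C => f y).
Proof.
split=> // ; exists [set y], 1; split=> //; first exact: compact_set1.
by move=> f e _ _ /(_ y erefl); rewrite mul1r.
Qed.

(** The theorem of Fubini, with an arbitrary bounded functional in the place of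
    the second integral. This form is inherited by iterated integrals, so that
    only an interval has to be treated. *)
Definition commuting Y (L : (Y -> C) -> C) : Prop :=
  forall (X : topologicalType) (K : (X -> C) -> C) (F : Y -> X -> C),
    bounded_functional K -> ccont (fun p : Y * X => F p.1 p.2) ->
    L (fun y => K (F y)) = K (fun x => L (fun y => F y x)).

Lemma commuting_eval Y (y : Y) : commuting (fun f : Y -> C => f y).
Proof. by []. Qed.

Lemma commuting_pull Y Z (h : Y -> Z) (L : (Y -> C) -> C) :
  continuous h -> commuting L -> commuting (fun f : Z -> C => L (fun y => f (h y))).
Proof.
move=> ch cL X K F HK cF; rewrite -(cL X K (fun y => F (h y)) HK) //.
apply: (@ccont_comp (Y * X)%type (Z * X)%type (fun p => (h p.1, p.2)) _ _ cF).
apply: continuous_pair; last exact: continuous_snd.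
exact: (continuous_compose (@continuous_fst _ _) ch).
Qed.

Lemma commuting_comp Y Z (L : (Y -> C) -> C) (K : (Z -> C) -> C) :
  bounded_functional K -> commuting L -> commuting K ->
  commuting (fun f : Y * Z -> C => L (fun y => K (fun z => f (y, z)))).
Proof.
move=> HK cL cK X N F HN cF.
have cF1 y : ccont (fun p : Z * X => F (y, p.1) p.2).
  apply: (@ccont_comp (Z * X)%type ((Y * Z) * X)%type (fun p => ((y, p.1), p.2)) _ _ cF).
  apply: continuous_pair; last exact: continuous_snd.
  exact: (continuous_pair (@continuous_cst _ _ y) (@continuous_fst _ _)).
under eq_fun => y do rewrite (cK X N (fun z => F (y, z)) HN (cF1 y)).
rewrite (cL X N (fun y x => K (fun z => F (y, z) x)))//.
apply: (@bf_param _ _ HK (Y * X)%type (fun p z => F (p.1, z) p.2)).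
apply: (@ccont_comp ((Y * X) * Z)%type ((Y * Z) * X)%type (fun p => ((p.1.1, p.2), p.1.2)) _ _ cF).
apply: continuous_pair.
  apply: continuous_pair; last exact: continuous_snd.
  exact: (continuous_compose (@continuous_fst _ _) (@continuous_fst _ _)).
exact: (continuous_compose (@continuous_fst _ _) (@continuous_snd _ _)).
Qed.

End IntegralFunctionals.

(** * Complex integrals over an interval *)

Section IntervalIntegral.
Variable R : realType.
Local Notation C := R[i].
Local Notation Re := complex.Re.
Local Notation Im := complex.Im.
Local Notation mu := (@lebesgue_measure R).

Lemma continuous_integrable_itv (a b : R) (f : R -> R) : continuous f ->
  mu.-integrable `[a, b] (EFin \o f).
Proof.
move=> cf; apply: continuous_compact_integrable; first exact: segment_compact.
exact: continuous_subspaceT.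
Qed.

Lemma Rintegral_chasles (a b c : R) (f : R -> R) : continuous f ->
  a <= b -> b <= c ->
  \int[mu]_(t in `[a, c]) f t =
  \int[mu]_(t in `[a, b]) f t + \int[mu]_(t in `[b, c]) f t.
Proof.
move=> cf ab bc.
have h : (BLeft a <= BRight b)%O by rewrite bnd_simp.
have h' : (BRight b <= BRight c)%O by rewrite bnd_simp.
have e := Rintegral_itvB (@continuous_integrable_itv a c f cf) h h'.
rewrite -(@Rintegral_itv_obnd_cbnd R b (BRight c) f); first by rewrite -e addrC subrK.
apply: integrableS (@continuous_integrable_itv b c f cf) => //.
exact: subset_itv_oc_cc.
Qed.

Lemma Rintegral_itv_norm_le (a b e : R) (f : R -> R) : continuous f -> a <= b ->
  (forall t, a <= t <= b -> `|f t| <= e) ->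
  `|\int[mu]_(t in `[a, b]) f t| <= (b - a) * e.
Proof.
move=> cf ab fe.
have ic := @continuous_integrable_itv a b f cf.
apply: (le_trans (le_normr_Rintegral _ ic)) => //.
have cn : continuous (fun t => `|f t|).
  by move=> t; apply: cvg_norm; exact: cf.
apply: (@le_trans _ _ (\int[mu]_(t in `[a, b]) e)).
  have i1 := @continuous_integrable_itv a b _ cn.
  have i2 := @continuous_integrable_itv a b _ (@continuous_cst R R e).
  by apply: le_Rintegral i1 i2 _ => // t; rewrite /= in_itv /=; apply: fe.
rewrite Rintegral_cst//= lebesgue_measure_itv/= lte_fin.
case: ltP => [h|h]; first by rewrite /= mulrC.
by rewrite /= mulr0 (le_anti (introT andP (conj ab h))) subrr mul0r.
Qed.

Definition cint (a b : R) (f : R -> C) : C :=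
  (\int[mu]_(t in `[a, b]) Re (f t) +i* \int[mu]_(t in `[a, b]) Im (f t))%C.

Lemma cint_linear (a b : R) (k : C) (f g : R -> C) : ccont f -> ccont g ->
  cint a b (fun t => k * f t + g t) = k * cint a b f + cint a b g.
Proof.
move=> cf cg.
have [cfr cfi] := (ccontRe cf, ccontIm cf).
have [cgr cgi] := (ccontRe cg, ccontIm cg).
have lin (x y : R) (u v w : R -> R) : continuous u -> continuous v -> continuous w ->
   \int[mu]_(t in `[a, b]) (x * u t + y * v t + w t) =
   x * \int[mu]_(t in `[a, b]) u t + y * \int[mu]_(t in `[a, b]) v t
     + \int[mu]_(t in `[a, b]) w t.
  move=> cu cv cw.
  have cxu (z : R) (h : R -> R) : continuous h -> continuous (fun t => z * h t).
    by move=> ch t; apply: cvgMr; exact: ch.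
  have cD (h1 h2 : R -> R) : continuous h1 -> continuous h2 -> continuous (fun t => h1 t + h2 t).
    by move=> c1 c2 t; apply: cvgD; [exact: c1|exact: c2].
  rewrite RintegralD//; try (apply: continuous_integrable_itv; auto).
  rewrite RintegralD//; try (apply: continuous_integrable_itv; auto).
  by rewrite !RintegralZl//; apply: continuous_integrable_itv.
apply: complexP; rewrite /cint !(Re_add, Im_add, Re_mul, Im_mul) /=.
  under eq_Rintegral do rewrite Re_add Re_mul -mulNr.
  by rewrite lin// mulNr.
under eq_Rintegral do rewrite Im_add Im_mul.
by rewrite lin//.
Qed.

Lemma cint_norm_le (a b e : R) (f : R -> C) : ccont f -> a <= b ->
  (forall t, a <= t <= b -> nc (f t) <= e) ->
  nc (cint a b f) <= 2 * (b - a) * e.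
Proof.
move=> cf ab fe; apply: (le_trans (nc_le _)).
rewrite (_ : 2 * (b - a) * e = (b - a) * e + (b - a) * e); last by ring.
apply: lerD.
  apply: (Rintegral_itv_norm_le (ccontRe cf) ab) => t tab.
  exact: le_trans (Re_le_nc _) (fe _ tab).
apply: (Rintegral_itv_norm_le (ccontIm cf) ab) => t tab.
exact: le_trans (Im_le_nc _) (fe _ tab).
Qed.

Lemma bounded_functional_cint (a b : R) : bounded_functional (cint a b).
Proof.
split; first by move=> k f g; exact: cint_linear.
case: (leP a b) => ab.
  exists `[a, b]%classic, (2 * (b - a)); split; first exact: segment_compact.
    by rewrite mulr_ge0 ?subr_ge0.
  move=> f e cf e0 fe; by apply: cint_norm_le => // t tab; apply: fe.
exists set0, 0; split=> //; first exact: compact0.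
move=> f e _ _ _; rewrite mul0r /cint set_itv_ge ?Rintegral_set0 ?nc0//.
by rewrite bnd_simp -ltNge.
Qed.

Lemma cint_chasles (a b c : R) (f : R -> C) : ccont f -> a <= b -> b <= c ->
  cint a c f = cint a b f + cint b c f.
Proof.
move=> cf ab bc; apply: complexP; rewrite ?Re_add ?Im_add /=;
  apply: Rintegral_chasles => //; [exact: ccontRe|exact: ccontIm].
Qed.

Lemma cint_point (a : R) (f : R -> C) : cint a a f = 0.
Proof. by rewrite /cint set_itv1 !Rintegral_set1. Qed.

Lemma cint_cst (a b : R) (k : C) : a <= b -> cint a b (fun=> k) = real_complex R (b - a) * k.
Proof.
move=> ab; rewrite /cint !Rintegral_cst//= lebesgue_measure_itv/= lte_fin.
have -> : fine (if a < b then (b%:E - a%:E)%E else 0%R) = b - a.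
  case: ltP => //= h; first by rewrite (le_anti (introT andP (conj ab h))) subrr.
by apply: complexP; rewrite ?Re_mul ?Im_mul /=; ring.
Qed.

Lemma is_derive_eps (U : normedModType R) (f : U -> R^o) (x v : U) (l : R) :
  (forall e : R, 0 < e -> \forall h \near (0 : R),
     `|f (h *: v + x) - f x - h * l| <= e * `|h|) ->
  is_derive x v f l.
Proof.
move=> H.
have cv : h^-1 *: ((f \o shift x) (h *: v) - f x) @[h --> (0 : R)^'] --> (l : R^o).
  apply/cvgrPdist_le => e e0; near=> h.
  have h0 : h != 0 by near: h; exact: nbhs_dnbhs_neq.
  have hh : `|f (h *: v + x) - f x - h * l| <= e * `|h|.
    by near: h; apply: nbhs_dnbhs; exact: H.
  rewrite distrC /= (_ : _ - l = h^-1 * (f (h *: v + x) - f x - h * l)).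
    by rewrite normrM normfV mulrC ler_pdivrMr ?normr_gt0.
  by rewrite /GRing.scale /=; field.
apply: DeriveDef; first by apply/cvg_ex; exists l.
exact: cvg_lim.
Unshelve. all: by end_near. Qed.

End IntervalIntegral.

(** * Fubini theorem for boxes and tori *)

Section BoxFunctionals.
Variable R : realType.
Local Notation C := R[i].
Local Notation Re := complex.Re.
Local Notation Im := complex.Im.

Lemma clamp_dist (a t t0 : R) : `|Num.max a t - Num.max a t0| <= `|t - t0|.
Proof.
have h1 := ler_norm (t - t0); have h2 := ler_norm (t0 - t); rewrite distrC in h2.
have h3 := normr_ge0 (t - t0).
by rewrite ler_norml /Num.max; case: ltP => ?; case: ltP => ?; apply/andP; split; lra.
Qed.

(** An additive interval function that is o(length) on short intervals vanishes:
    as a function of the upper end point it has derivative zero. *)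
Lemma interval_defect_eq0 (d : R -> R -> C) (a b : R) :
  (forall u v w, u <= v -> v <= w -> d u w = d u v + d v w) ->
  (forall t0 e : R, 0 < e -> exists2 r : R, 0 < r & forall u v,
    t0 - r < u -> u <= v -> v < t0 + r -> nc (d u v) <= e * (v - u)) ->
  a <= b -> d a b = 0.
Proof.
move=> dch loc ab.
have d0 : d a a = 0 by have /eqP := dch a a a (lexx a) (lexx a); rewrite eq_sym -subr_eq0 addrK => /eqP.
pose D t := d a (Num.max a t).
have Dloc (t0 e : R) : 0 < e -> \forall h \near (0 : R),
    nc (D (h + t0) - D t0) <= e * `|h|.
  move=> e0; have [r r0 hr] := loc (Num.max a t0) _ e0.
  near=> h.
  have hlt : `|h| < r.
    by near: h; exists r => //= z; rewrite /= sub0r normrN.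
  have := clamp_dist a (h + t0) t0; rewrite addrK.
  have ap0 : a <= Num.max a t0 by rewrite le_max lexx.
  have ap : a <= Num.max a (h + t0) by rewrite le_max lexx.
  rewrite /D; move: ap ap0 hr; set p := Num.max a (h + t0); set p0 := Num.max a t0.
  move=> ap ap0 hr; rewrite ler_norml => /andP[h1 h2].
  have e0' := ltW e0.
  case: (leP p0 p) => [le|/ltW le].
    rewrite (dch a p0 p)// addrAC subrr add0r.
    apply: (le_trans (hr _ _ _ le _)); try lra.
    by rewrite ler_wpM2l//; lra.
  rewrite (dch a p p0)// opprD addrA subrr add0r ncN.
  apply: (le_trans (hr _ _ _ le _)); try lra.
  by rewrite ler_wpM2l//; lra.
have Dcst : D b = D a.
  apply: complexP.
    apply: (@is_derive_0_is_cst R (fun t => Re (D t))) => t.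
    apply: is_derive_eps => e /(Dloc t); apply: filterS => h hh.
    rewrite /GRing.scale /= !mulr1 mulr0 subr0 -Re_opp -Re_add.
    exact: le_trans (Re_le_nc _) hh.
  apply: (@is_derive_0_is_cst R (fun t => Im (D t))) => t.
  apply: is_derive_eps => e /(Dloc t); apply: filterS => h hh.
  rewrite /GRing.scale /= !mulr1 mulr0 subr0 -Im_opp -Im_add.
  exact: le_trans (Im_le_nc _) hh.
by move: Dcst; rewrite /D maxxx d0 max_r.
Unshelve. all: by end_near. Qed.

(** The defect of commutation is additive in the interval and, by uniform
    continuity, negligible on short intervals. *)
Lemma commuting_cint (a b : R) : commuting (@cint R a b).
Proof.
move=> X K F HK cF.
have cFs t : ccont (F t) by exact: ccont_slicer.
have cKF : ccont (fun t => K (F t)) by exact: (bf_param HK cF).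
have cIF u v : ccont (fun x => cint u v (F^~ x)).
  apply: (bf_param (bounded_functional_cint u v) (F := fun x t => F t x)).
  exact: (ccont_swap cF).
pose d u v := cint u v (fun t => K (F t)) - K (fun x => cint u v (F^~ x)).
have dch u v w : u <= v -> v <= w -> d u w = d u v + d v w.
  move=> uv vw; rewrite /d (cint_chasles cKF uv vw).
  have -> : (fun x => cint u w (F^~ x)) = (fun x => cint u v (F^~ x) + cint v w (F^~ x)).
    by apply/funext => x; rewrite (cint_chasles (ccont_slicel x cF) uv vw).
  by rewrite (bfD HK)//; ring.
have d0 u v : v <= u -> d u v = 0.
  have K0 : K (fun=> 0) = 0.
    by have := bfZ HK 0 (@ccont_cst R X 0); rewrite !mul0r.
  have c0 f : v <= u -> cint u v f = 0 :> C.
    rewrite le_eqVlt => /predU1P[->|vu]; first exact: cint_point.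
    by rewrite /cint set_itv_ge ?Rintegral_set0// bnd_simp -ltNge.
  move=> vu; rewrite /d c0//.
  have -> : (fun x => cint u v (F^~ x)) = (fun=> 0) by apply/funext => x; rewrite c0.
  by rewrite K0 subrr.
have loc (t0 e : R) : 0 < e -> exists2 r : R, 0 < r & forall u v,
    t0 - r < u -> u <= v -> v < t0 + r -> nc (d u v) <= e * (v - u).
  move=> e0; have [lin [B [c [cB c0 bd]]]] := HK.
  pose e' := e / (2 * (c + 1)).
  have p : 0 < 2 * (c + 1) by rewrite mulr_gt0// ltr_wpDl.
  have e'0 : 0 < e' by rewrite divr_gt0.
  have n1 := compact_near_param t0 cB e'0 cF.
  have /ccont_atP/(_ _ e'0) n2 := cKF t0.
  have [r /= r0 hr] := filterI n1 n2.
  exists r => // u v h1 uv h2.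
  have inr t : u <= t <= v -> `|t0 - t| < r.
    move=> /andP[ut tv]; rewrite ltr_norml; apply/andP; split; lra.
  have -> : d u v = cint u v (fun t => K (F t) - K (F t0)) -
      K (fun x => cint u v (fun t => F t x - F t0 x)).
    rewrite (bfB (bounded_functional_cint u v)) ?cint_cst//; last exact: ccont_cst.
    have -> : (fun x => cint u v (fun t => F t x - F t0 x)) =
        (fun x => cint u v (F^~ x) - real_complex R (v - u) * F t0 x).
      apply/funext => x; rewrite (bfB (bounded_functional_cint u v)) ?cint_cst//.
        exact: ccont_slicel.
      exact: ccont_cst.
    rewrite (bfB HK) ?(bfZ HK)//; first by rewrite /d; ring.
    by apply: ccontM; first exact: ccont_cst.
  apply: (le_trans (ncD _ _)); rewrite ncN.
  have h3 : nc (cint u v (fun t => K (F t) - K (F t0))) <= 2 * (v - u) * e'.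
    apply: cint_norm_le => //.
      by apply: ccontD => //; apply: ccontN; exact: ccont_cst.
    by move=> t /inr /hr [].
  have h4 : nc (K (fun x => cint u v (fun t => F t x - F t0 x))) <= c * (2 * (v - u) * e').
    have cdiff : ccont (fun p : R * X => F p.1 p.2 - F t0 p.2).
      apply: ccontD => //; apply: ccontN.
      exact: (ccont_comp (@continuous_snd _ _) (cFs t0)).
    apply: bd.
    - apply: (bf_param (bounded_functional_cint u v) (F := fun x t => F t x - F t0 x)).
      exact: (@ccont_swap R R X (fun t x => F t x - F t0 x) cdiff).
    - by rewrite mulr_ge0 ?(ltW e'0)// mulr_ge0// subr_ge0.
    - move=> y By; apply: cint_norm_le => //.
        exact: (@ccont_slicel R R X (fun t x => F t x - F t0 x) y cdiff).
      by move=> t /inr /hr [h _]; apply: h.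
  apply: (le_trans (lerD h3 h4)).
  rewrite (_ : 2 * (v - u) * e' + c * (2 * (v - u) * e') = e * (v - u))//.
  by rewrite /e'; field; rewrite gt_eqF// ltr_wpDl.
apply/eqP; rewrite -subr_eq0; apply/eqP; rewrite -/(d a b).
case: (leP b a) => [/d0//|/ltW ab]; exact: interval_defect_eq0.
Qed.

Lemma cint_translate (a b c : R) (f : R -> C) : ccont f -> a <= b ->
  cint a b (fun t => f (t + c)) = cint (a + c) (b + c) f.
Proof.
move=> cf ab.
have cfc : ccont (fun t => f (t + c)).
  apply: (@ccont_comp R R R (fun t => t + c) f) => // t.
  by apply: cvgD; [exact: cvg_id|exact: cvg_cst].
apply/eqP; rewrite -subr_eq0; apply/eqP.
apply: (@interval_defect_eq0 (fun u v => cint u v (fun t => f (t + c)) - cint (u + c) (v + c) f)) => //.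
  move=> u v w uv vw; rewrite (cint_chasles cfc uv vw).
  by rewrite (cint_chasles cf (b := v + c)) ?lerD2r//; ring.
move=> t0 e e0; have e4 : 0 < e / 4 by rewrite divr_gt0.
have /ccont_atP/(_ _ e4)[r r0 hr] := cf (t0 + c).
exists r => // u v h1 uv h2.
have inr t : u <= t <= v -> nc (f (t + c) - f (t0 + c)) <= e / 4.
  move=> /andP[ut tv]; apply: hr => /=; rewrite ltr_norml; apply/andP; split; lra.
have uvc : u + c <= v + c by rewrite lerD2r.
have e1 := cint_cst (f (t0 + c)) uv; have e2 := cint_cst (f (t0 + c)) uvc.
rewrite [X in nc X](_ : _ = cint u v (fun t => f (t + c) - f (t0 + c)) -
  cint (u + c) (v + c) (fun t => f t - f (t0 + c))); last first.
  rewrite (bfB (bounded_functional_cint u v)) ?(bfB (bounded_functional_cint (u + c) (v + c)))//;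
    try exact: ccont_cst.
  by rewrite e1 e2 (_ : v + c - (u + c) = v - u); [ring|ring].
apply: (le_trans (ncD _ _)); rewrite ncN.
have h3 : nc (cint u v (fun t => f (t + c) - f (t0 + c))) <= 2 * (v - u) * (e / 4).
  by apply: cint_norm_le => //; apply: ccontD => //; apply: ccontN; exact: ccont_cst.
have h4 : nc (cint (u + c) (v + c) (fun t => f t - f (t0 + c))) <= 2 * (v + c - (u + c)) * (e / 4).
  apply: cint_norm_le => //; first by apply: ccontD => //; apply: ccontN; exact: ccont_cst.
  move=> t /andP[ut tv]; rewrite -[t](subrK c); apply: inr; apply/andP; split; lra.
lra.
Qed.

Lemma continuous_mx (X : topologicalType) m n (f : X -> 'M[R]_(m, n)) :
  (forall i j, continuous (fun x => f x i j)) -> continuous f.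
Proof.
move=> cf x A [P MP sPA].
have : \forall y \near x, forall i j, P i j (f y i j).
  apply: filter_forall => i; apply: filter_forall => j; exact: (cf i j x _ (MP i j)).
by apply: filterS => y Py; apply: sPA.
Qed.

Lemma continuous_col_mx m n (X : topologicalType) (f : X -> 'cV[R]_m) (g : X -> 'cV[R]_n) :
  continuous f -> continuous g -> continuous (fun x => col_mx (f x) (g x)).
Proof.
move=> cf cg; apply: continuous_mx => i j.
under eq_fun do rewrite mxE; case: (fintype.split i) => k.
  exact: (continuous_compose cf (@coord_continuous R m 1 k j)).
exact: (continuous_compose cg (@coord_continuous R n 1 k j)).
Qed.

Definition cbox n (F : 'cV[R]_n -> C) : C :=
  (box_integral (fun y => Re (F y)) +i* box_integral (fun y => Im (F y)))%C.

Lemma cbox0 (F : 'cV[R]_0 -> C) : cbox F = F 0.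
Proof. by rewrite /cbox /=; case: (F 0). Qed.

Lemma cboxS n (F : 'cV[R]_n.+1 -> C) :
  cbox F = cint 0 (2 * pi) (fun t => cbox (fun v : 'cV[R]_n =>
             F (col_mx (const_mx t : 'cV[R]_1) v))).
Proof. by []. Qed.

Lemma continuous_cons_mx n :
  continuous (fun p : R * 'cV[R]_n => col_mx (const_mx p.1 : 'cV[R]_1) p.2).
Proof.
apply: continuous_col_mx; last exact: continuous_snd.
apply: continuous_mx => i j; under eq_fun do rewrite mxE; exact: continuous_fst.
Qed.

Lemma bounded_functional_cbox n : bounded_functional (@cbox n).
Proof.
elim: n => [|n ih].
  have -> : @cbox 0 = fun F => F 0 by apply/funext => F; exact: cbox0.
  exact: bounded_functional_eval.
exact: (bounded_functional_pull (@continuous_cons_mx n)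
  (bounded_functional_comp (bounded_functional_cint 0 (2 * pi)) ih)).
Qed.

Lemma commuting_cbox n : commuting (@cbox n).
Proof.
elim: n => [|n ih].
  have -> : @cbox 0 = fun F => F 0 by apply/funext => F; exact: cbox0.
  exact: commuting_eval.
exact: (commuting_pull (@continuous_cons_mx n)
  (commuting_comp (@bounded_functional_cbox n) (@commuting_cint 0 (2 * pi)) ih)).
Qed.

Local Notation V2 n := ('cV[R]_n * 'cV[R]_n)%type.

Definition torus n (F : V2 n -> C) : C := torus_integral (fun y eta => F (y, eta)).

Lemma torusE n (F : V2 n -> C) :
  torus F = cbox (fun y => cbox (fun eta => F (y, eta))).
Proof. by []. Qed.

Lemma bounded_functional_torus n : bounded_functional (@torus n).
Proof.
exact: (bounded_functional_comp (@bounded_functional_cbox n) (@bounded_functional_cbox n)).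
Qed.

Lemma commuting_torus n : commuting (@torus n).
Proof.
exact: (commuting_comp (@bounded_functional_cbox n) (@commuting_cbox n) (@commuting_cbox n)).
Qed.

(** Normal convergence on every ball: enough for continuity of the sum and for
    exchanging the sum with integration over a compact set. *)
Definition normal_family (Y : normedModType R) (I : choiceType) (f : I -> Y -> C) : Prop :=
  (forall i, ccont (f i)) /\
  forall r : R, exists M : I -> R, majorant M /\
    forall i y, `|y| <= r -> nc (f i y) <= M i.

Lemma ccont_csum (Y : normedModType R) (I : choiceType) (f : I -> Y -> C) :
  normal_family f -> ccont (fun y => csum (fun i => f i y)).
Proof.
move=> [cf nf] y0; apply/ccont_atP => e e0.
have [M [MM fM]] := nf (`|y0| + 1).
have e30 : 0 < e / 3 by rewrite divr_gt0.
have [A0 hA0] := csum_tail MM e30.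
have /ccont_atP/(_ _ e30) h1 := @ccont_sum R Y I (enum_fset A0) predT f cf y0.
near=> y.
have y0r : `|y0| <= `|y0| + 1 by rewrite lerDl.
have yr : `|y| <= `|y0| + 1.
  have : `|y0 - y| < 1 by near: y; apply/nbhs_ballP; exists 1 => //= z; rewrite -ball_normE.
  have := ler_distD y0 y 0; rewrite !subr0 (distrC y) => ? ?; lra.
have -> : csum (fun i => f i y) - csum (fun i => f i y0) =
  (csum (fun i => f i y) - \sum_(i <- A0) f i y) -
  (csum (fun i => f i y0) - \sum_(i <- A0) f i y0) +
  (\sum_(i <- A0) f i y - \sum_(i <- A0) f i y0) by ring.
have a := hA0 (fun i => f i y) (fun i => fM i y yr) A0 (fsubset_refl _).
have b := hA0 (fun i => f i y0) (fun i => fM i y0 y0r) A0 (fsubset_refl _).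
have c : nc (\sum_(i <- A0) f i y - \sum_(i <- A0) f i y0) <= e / 3.
  by near: y; exact: h1.
apply: (le_trans (ncD _ _)); have := ncD (csum (fun i => f i y) - \sum_(i <- A0) f i y)
  (- (csum (fun i => f i y0) - \sum_(i <- A0) f i y0)); rewrite ncN; lra.
Unshelve. all: by end_near. Qed.

Lemma bf_csum (Y : normedModType R) (L : (Y -> C) -> C) (I : choiceType) (f : I -> Y -> C) :
  bounded_functional L -> normal_family f ->
  (exists M : I -> R, majorant M /\ forall i, nc (L (f i)) <= M i) /\
  L (fun y => csum (fun i => f i y)) = csum (fun i => L (f i)).
Proof.
move=> HL nfam; have [cf nf] := nfam; have [lin [B [c [cB c0 bd]]]] := HL.
have [r [_ hr]] := compact_bounded cB.
have [M [MM fM]] := nf (r + 1).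
have BM i y : B y -> nc (f i y) <= M i.
  by move=> By; apply: fM; apply: hr By; rewrite ltrDl.
have LM i : nc (L (f i)) <= c * M i.
  by apply: bd => //; [exact: majorant_ge0 MM|exact: BM].
split; first by exists (fun i => c * M i); split=> //; exact: majorantZ.
symmetry; apply: csum_unique => e e0.
pose d := e / (c + 1).
have c1 : 0 < c + 1 by rewrite ltr_wpDl.
have d0 : 0 < d by rewrite divr_gt0.
have [A0 hA0] := csum_tail MM d0.
exists A0 => A AA0.
rewrite -(bf_sum HL)// -(bfB HL); last 2 first.
  exact: ccont_csum.
  exact: ccont_sum.
apply: (@le_trans _ _ (c * d)).
  apply: bd; [|exact: ltW|].
    by apply: ccontD; [exact: ccont_csum|apply: ccontN; exact: ccont_sum].
  by move=> y By; apply: hA0 => // i; exact: BM.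
by rewrite /d mulrA ler_pdivrMr// mulrC ler_wpM2l ?(ltW e0)// lerDl.
Qed.

End BoxFunctionals.

(** * Functions of class C^k *)

Section Smoothness.
Variable R : realType.
Local Notation C := R[i].
Local Notation Re := complex.Re.
Local Notation Im := complex.Im.
Implicit Type U : normedModType R.

Definition CkC U k (f : U -> C) : Prop :=
  Ck k (fun x => Re (f x) : R^o) /\ Ck k (fun x => Im (f x) : R^o).

Definition cderive U (f : U -> C) (x v : U) (l : C) : Prop :=
  is_derive x v (fun x => Re (f x) : R^o) (Re l) /\
  is_derive x v (fun x => Im (f x) : R^o) (Im l).

Lemma cderive_eps U (f : U -> C) (x v : U) (l : C) :
  (forall e : R, 0 < e -> \forall h \near (0 : R),
     nc (f (h *: v + x) - f x - real_complex R h * l) <= e * `|h|) ->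
  cderive f x v l.
Proof.
move=> H; split; apply: is_derive_eps => e /H; apply: filterS => h hh.
  have -> : h * Re l = Re (real_complex R h * l) by rewrite Re_mul /=; ring.
  by rewrite -!Re_opp -!Re_add; apply: le_trans (Re_le_nc _) hh.
have -> : h * Im l = Im (real_complex R h * l) by rewrite Im_mul /=; ring.
by rewrite -!Im_opp -!Im_add; apply: le_trans (Im_le_nc _) hh.
Qed.

Lemma cderive_sqr U (f : U -> C) (x v : U) (l : C) (K r : R) : 0 < r ->
  (forall h : R, `|h| <= r ->
     nc (f (h *: v + x) - f x - real_complex R h * l) <= K * `|h| ^+ 2) ->
  cderive f x v l.
Proof.
move=> r0 H; apply: cderive_eps => e e0.
have K0 : 0 < `|K| + 1 by rewrite ltr_wpDl.
near=> h.
have hr : `|h| <= r.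
  by near: h; exists r => //= z; rewrite /= sub0r normrN => /ltW.
have he : `|h| <= e / (`|K| + 1).
  near: h; exists (e / (`|K| + 1)); first by rewrite /= divr_gt0.
  by move=> z; rewrite /= sub0r normrN => /ltW.
apply: (le_trans (H h hr)); rewrite expr2 mulrA ler_wpM2r//.
apply: (@le_trans _ _ ((`|K| + 1) * `|h|)); last by rewrite mulrC -ler_pdivlMr.
by rewrite ler_wpM2r// (le_trans (ler_norm K))// lerDl.
Unshelve. all: by end_near. Qed.

Lemma CkCS U k (f : U -> C) (df : U -> U -> C) :
  ccont f -> (forall v x, cderive f x v (df v x)) ->
  (forall v, CkC k (df v)) -> CkC k.+1 f.
Proof.
move=> cf Df Cdf; split; split.
- exact: ccontRe.
- move=> v; split=> [x|]; first by case: (Df v x) => [[]].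
  rewrite (_ : (fun x => 'D_v _ x) = (fun x => Re (df v x) : R^o)).
    by case: (Cdf v).
  by apply/funext => x; case: (Df v x) => [[]].
- exact: ccontIm.
- move=> v; split=> [x|]; first by case: (Df v x) => [_ []].
  rewrite (_ : (fun x => 'D_v _ x) = (fun x => Im (df v x) : R^o)).
    by case: (Cdf v).
  by apply/funext => x; case: (Df v x) => [_ []].
Qed.

Lemma CkC0 U (f : U -> C) : ccont f -> CkC 0 f.
Proof. by move=> cf; split; split=> //; [exact: ccontRe|exact: ccontIm]. Qed.

Lemma Ck_cont U k (f : U -> R^o) : Ck k f -> continuous f.
Proof. by case: k => [|k] []. Qed.

Lemma Ck_S U k (f : U -> R^o) : Ck k.+1 f -> Ck k f.
Proof.
elim: k f => [|k ih] f [cf Df]; first by split.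
by split=> // v; case: (Df v) => df Cdf; split=> //; apply: ih.
Qed.

Lemma Ck_D U k (f g : U -> R^o) : Ck k f -> Ck k g -> Ck k (fun x => f x + g x : R^o).
Proof.
elim: k f g => [|k ih] f g Cf Cg.
  by split=> // x; apply: cvgD; [exact: (Ck_cont Cf)|exact: (Ck_cont Cg)].
split; first by move=> x; apply: cvgD; [exact: (Ck_cont Cf)|exact: (Ck_cont Cg)].
move=> v; case: Cf => _ /(_ v)[df Cdf]; case: Cg => _ /(_ v)[dg Cdg].
split=> [x|]; first exact: derivableD.
rewrite (_ : (fun x => 'D_v _ x) = (fun x => 'D_v f x + 'D_v g x : R^o)).
  exact: ih.
by apply/funext => x; rewrite -deriveD.
Qed.

Lemma Ck_N U k (f : U -> R^o) : Ck k f -> Ck k (fun x => - f x : R^o).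
Proof.
elim: k f => [|k ih] f Cf.
  by split=> // x; apply: cvgN; exact: (Ck_cont Cf).
split; first by move=> x; apply: cvgN; exact: (Ck_cont Cf).
move=> v; case: Cf => _ /(_ v)[df Cdf].
split=> [x|]; first exact: derivableN.
rewrite (_ : (fun x => 'D_v _ x) = (fun x => - 'D_v f x : R^o)).
  exact: ih.
by apply/funext => x; rewrite -deriveN.
Qed.

Lemma Ck_M U k (f g : U -> R^o) : Ck k f -> Ck k g -> Ck k (fun x => f x * g x : R^o).
Proof.
elim: k f g => [|k ih] f g Cf Cg.
  by split=> // x; apply: cvgM; [exact: (Ck_cont Cf)|exact: (Ck_cont Cg)].
split; first by move=> x; apply: cvgM; [exact: (Ck_cont Cf)|exact: (Ck_cont Cg)].
have [Cf' Cg'] := (Ck_S Cf, Ck_S Cg).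
move=> v; case: Cf => _ /(_ v)[df Cdf]; case: Cg => _ /(_ v)[dg Cdg].
split=> [x|]; first exact: derivableM.
rewrite (_ : (fun x => 'D_v _ x) = (fun x => f x * 'D_v g x + g x * 'D_v f x : R^o)).
  by apply: Ck_D; apply: ih.
by apply/funext => x; rewrite -[LHS]/('D_v (f * g) x) deriveM.
Qed.

Lemma CkC_M U k (f g : U -> C) : CkC k f -> CkC k g -> CkC k (fun x => f x * g x).
Proof.
move=> [fr fi] [gr gi]; split.
  rewrite (_ : (fun x => _) = fun x => Re (f x) * Re (g x) + - (Im (f x) * Im (g x)) : R^o).
    by apply: Ck_D; [exact: Ck_M|apply: Ck_N; exact: Ck_M].
  by apply/funext => x; rewrite Re_mul.
rewrite (_ : (fun x => _) = fun x => Re (f x) * Im (g x) + Im (f x) * Re (g x) : R^o).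
  by apply: Ck_D; exact: Ck_M.
by apply/funext => x; rewrite Im_mul.
Qed.

Lemma ccont_lipschitz_at U (f : U -> C) (K : R) (x : U) :
  (forall w, `|w| <= 1 -> nc (f (w + x) - f x) <= K * `|w|) -> ccont_at f x.
Proof.
move=> H; apply/ccont_atP => e e0.
have K0 : 0 < `|K| + 1 by rewrite ltr_wpDl.
near=> y.
have y1 : `|y - x| <= 1.
  by near: y; apply/nbhs_ballP; exists 1 => //= z; rewrite -ball_normE /= distrC => /ltW.
have ye : `|y - x| <= e / (`|K| + 1).
  near: y; apply/nbhs_ballP; exists (e / (`|K| + 1)); first by rewrite /= divr_gt0.
  by move=> z; rewrite -ball_normE /= distrC => /ltW.
have := H _ y1; rewrite subrK => h; apply: (le_trans h).
apply: (@le_trans _ _ ((`|K| + 1) * `|y - x|)); last by rewrite mulrC -ler_pdivlMr.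
by rewrite ler_wpM2r// (le_trans (ler_norm K))// lerDl.
Unshelve. all: by end_near. Qed.

Definition real_linear U (l : U -> C) : Prop :=
  forall (h : R) v u, l (h *: v + u) = real_complex R h * l v + l u.

Lemma real_linearZ U (l : U -> C) h v : real_linear l ->
  l (h *: v) = real_complex R h * l v.
Proof.
move=> H; have l0 : l 0 = 0.
  have := H 1 0 0; rewrite scaler0 addr0 mul1r => /esym/eqP.
  by rewrite -subr_eq0 addrK => /eqP.
by rewrite -[h *: v]addr0 H l0 addr0.
Qed.
Lemma real_linearD U (l : U -> C) v u : real_linear l -> l (v + u) = l v + l u.
Proof. by move=> H; have := H 1 v u; rewrite scale1r mul1r. Qed.

Lemma CkC_cst U (c : C) k : CkC k (fun _ : U => c).
Proof.
elim: k c => [|k ih] c; first by apply: CkC0; exact: ccont_cst.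
apply: (CkCS (df := fun _ _ => 0)) => //; first exact: ccont_cst.
move=> v x; apply: (cderive_sqr (K := 0) ltr01) => h _.
by rewrite mulr0 subrr subr0 nc0 mul0r.
Qed.

Lemma CkC_linear U (l : U -> C) (N : R) k : real_linear l ->
  (forall u, nc (l u) <= N * `|u|) -> CkC k l.
Proof.
move=> ll lN.
have cl : ccont l.
  by move=> x; apply: (ccont_lipschitz_at (K := N)) => w _; rewrite real_linearD// addrK.
case: k => [|k]; first exact: CkC0.
apply: (CkCS (df := fun v _ => l v)) => //; last by move=> v; exact: CkC_cst.
move=> v x; apply: (cderive_sqr (K := 0) ltr01) => h _.
by rewrite ll addrK subrr nc0 mul0r.
Qed.

Lemma cderiveM U (f g : U -> C) x v df dg :
  cderive f x v df -> cderive g x v dg ->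
  cderive (fun x => f x * g x) x v (f x * dg + df * g x).
Proof.
move=> [fr fi] [gr gi]; split.
  rewrite (_ : (fun x => _) = (fun x => Re (f x) : R^o) * (fun x => Re (g x) : R^o) -
     (fun x => Im (f x) : R^o) * (fun x => Im (g x) : R^o)); last first.
    by apply/funext => y; rewrite Re_mul.
  apply: is_derive_eq; rewrite Re_add !Re_mul /GRing.scale /=; ring.
rewrite (_ : (fun x => _) = (fun x => Re (f x) : R^o) * (fun x => Im (g x) : R^o) +
   (fun x => Im (f x) : R^o) * (fun x => Re (g x) : R^o)); last first.
  by apply/funext => y; rewrite Im_mul.
apply: is_derive_eq; rewrite Im_add !Im_mul /GRing.scale /=; ring.
Qed.

(* The section hypothesis says that [q] is a polynomial of degree two, [b v] being
   its differential in the direction [v] and [q2] its quadratic part. *)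
Section Gaussian.
Variables (U : normedModType R) (q q2 : U -> C) (b : U -> U -> C).
Hypothesis qE : forall (h : R) v u, q (h *: v + u) =
  q u + real_complex R h * b v u + real_complex R (h ^+ 2) * q2 v.

Lemma cderive_gauss x v : cderive (fun u => cexp (q u)) x v (b v x * cexp (q x)).
Proof.
pose B := nc (b v x) + nc (q2 v).
have B0 : 0 <= B by rewrite addr_ge0 ?nc_ge0.
apply: (cderive_sqr (r := 1) (K := nc (cexp (q x)) *
  (4 * B ^+ 2 * expR B + nc (q2 v)))) => // h h1.
set z := real_complex R h * b v x + real_complex R (h ^+ 2) * q2 v.
have zB : nc z <= `|h| * B.
  apply: (le_trans (ncD _ _)); rewrite !ncM !nc_real mulrDr lerD2l.
  by rewrite normrX expr2 ler_wpM2r ?nc_ge0// ler_piMr.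
rewrite qE -[q x + _ + _]addrA -/z cexpD.
rewrite [X in nc X](_ : _ =
   cexp (q x) * ((cexp z - 1 - z) + real_complex R (h ^+ 2) * q2 v)); last first.
  by rewrite /z; ring.
rewrite ncM -mulrA ler_wpM2l ?nc_ge0//.
apply: (le_trans (ncD _ _)); rewrite mulrDl lerD//; last first.
  by rewrite ncM nc_real normrX mulrC.
apply: (le_trans (nc_cexpB1B z)).
have zB' : nc z <= B by apply: (le_trans zB); rewrite ler_piMl.
have e1 : expR (nc z) <= expR B by rewrite ler_expR.
have e2 : nc z ^+ 2 <= `|h| ^+ 2 * B ^+ 2.
  by rewrite -exprMn ler_sqr ?nnegrE ?nc_ge0 ?mulr_ge0.
rewrite -mulrA [leRHS](_ : _ = 4 * ((`|h| ^+ 2 * B ^+ 2) * expR B)); last by ring.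
by rewrite ler_wpM2l// ler_pM ?expR_ge0 ?sqr_ge0.
Qed.

(** Gaussians solve first-order equations with linear coefficients, so each
    derivative is a product of functions already known to be smooth. *)
Lemma CkC_gauss (N : U -> R) k :
  (forall v, real_linear (b v)) -> (forall v u, nc (b v u) <= N v * `|u|) ->
  ccont q -> CkC k (fun u => cexp (q u)).
Proof.
move=> bl bN cq; elim: k => [|k ih]; first by apply: CkC0; exact: ccont_cexp.
apply: (CkCS (df := fun v u => b v u * cexp (q u))); first exact: ccont_cexp.
  by move=> v x; exact: cderive_gauss.
by move=> v; apply: CkC_M => //; apply: CkC_linear (bN v).
Qed.
End Gaussian.

End Smoothness.

(** * Smoothness of Laplace transforms *)

Section LaplaceTransforms.
Variable R : realType.
Local Notation C := R[i].
Local Notation Re := complex.Re.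
Local Notation Im := complex.Im.
Variables (U Y : normedModType R) (I : choiceType) (L : (Y -> C) -> C).
Hypothesis HL : bounded_functional L.

Lemma bf_csum_norm_le : exists r : R, forall M : I -> R, majorant M ->
  exists2 K : R, 0 <= K & forall (f : I -> Y -> C) (s : R), 0 <= s ->
    (forall i, ccont (f i)) ->
    (forall i y, `|y| <= r -> nc (f i y) <= s * M i) ->
    (forall i, nc (L (f i)) <= s * (K * M i)) /\
    nc (csum (fun i => L (f i))) <= s * K.
Proof.
have [lin [B [c [cB c0 bd]]]] := HL.
have [r [_ hr]] := compact_bounded cB.
exists (r + 1) => M MM; have [K K0 hK] := csum_norm_le MM.
have K'0 : 0 <= c * K + c by rewrite addr_ge0 ?mulr_ge0.
exists (c * K + c) => // f s s0 cf fM.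
have LM i : nc (L (f i)) <= (s * c) * M i.
  rewrite -mulrA mulrCA; apply: bd => //.
    by rewrite mulr_ge0// (majorant_ge0 _ MM).
  by move=> y By; apply: fM; apply: hr By; rewrite ltrDl.
split=> [i|].
  apply: (le_trans (LM i)); rewrite -mulrA ler_wpM2l// ler_wpM2r ?(majorant_ge0 _ MM)//.
  by rewrite lerDr mulr_ge0.
apply: (le_trans (hK _ (s * c) (mulr_ge0 s0 c0) LM)).
by rewrite -mulrA ler_wpM2l// lerDl.
Qed.

(** An exponential moment of order [rho]: it makes the transform converge for
    parameters of norm at most [rho], and leaves room for differentiation
    strictly inside that ball. *)
Definition laplace_family (rho : R) (c : I -> Y -> C) (l : I -> Y -> U -> C) : Prop :=
  [/\ forall i, ccont (c i), forall i u, ccont (fun y => l i y u),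
      forall i y, real_linear (l i y) &
      exists N : I -> Y -> R,
        [/\ forall i y, 0 <= N i y,
            forall i y u, nc (l i y u) <= N i y * `|u| &
            forall r : R, exists M : I -> R, majorant M /\
              forall i y, `|y| <= r -> nc (c i y) * expR (rho * N i y) <= M i]].

Definition laplace (c : I -> Y -> C) (l : I -> Y -> U -> C) (u : U) : C :=
  csum (fun i => L (fun y => c i y * cexp (l i y u))).

Lemma le_expR (x : R) : x <= expR x.
Proof. by have := expR_ge1Dx x; lra. Qed.

Lemma laplace_familyW rho rho' c l : rho' <= rho ->
  laplace_family rho c l -> laplace_family rho' c l.
Proof.
move=> le [cc cl ll [N [N0 lN dom]]]; split=> //.
exists N; split=> // r; have [M [MM cM]] := dom r; exists M; split=> // i y yr.
by apply: le_trans (cM i y yr); rewrite ler_wpM2l ?nc_ge0// ler_expR ler_wpM2r.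
Qed.

Lemma laplace_familyM rho c l v : laplace_family (rho + 1) c l ->
  laplace_family rho (fun i y => c i y * l i y v) l.
Proof.
move=> [cc cl ll [N [N0 lN dom]]]; split=> // [i|]; first by apply: ccontM.
exists N; split=> // r; have [M [MM cM]] := dom r.
exists (fun i => `|v| * M i); split; first exact: majorantZ.
move=> i y yr; rewrite ncM.
apply: (@le_trans _ _ (nc (c i y) * (N i y * `|v|) * expR (rho * N i y))).
  by rewrite ler_wpM2r ?expR_ge0// ler_wpM2l ?nc_ge0// lN.
apply: (@le_trans _ _ (`|v| * (nc (c i y) * expR ((rho + 1) * N i y)))); last first.
  by rewrite ler_wpM2l// cM.
rewrite mulrDl mul1r expRD.
rewrite (_ : _ * expR (rho * N i y) = `|v| * (nc (c i y) * (expR (rho * N i y) * N i y))); last by ring.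
by rewrite ler_wpM2l// ler_wpM2l ?nc_ge0// ler_wpM2l ?expR_ge0// le_expR.
Qed.

Lemma laplace_ccont rho c l i u : laplace_family rho c l ->
  ccont (fun y => c i y * cexp (l i y u)).
Proof. by case=> cc cl _ _; apply: ccontM => //; exact: ccont_cexp. Qed.

Lemma laplace_normal rho c l u : laplace_family rho c l -> `|u| <= rho ->
  normal_family (fun i y => c i y * cexp (l i y u)).
Proof.
move=> Hf urho; split=> [i|r]; first exact: laplace_ccont Hf.
case: Hf => cc cl ll [N [N0 lN /(_ r)[M [MM cM]]]].
exists M; split=> // i y yr.
rewrite ncM; apply: le_trans (cM i y yr); rewrite ler_wpM2l ?nc_ge0//.
rewrite nc_cexp ler_expR (le_trans (ler_norm _))// (le_trans (Re_le_nc _))//.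
by apply: (le_trans (lN i y u)); rewrite mulrC ler_wpM2r.
Qed.

(** Second-order Taylor expansion of the transform; differentiating brings down
    a factor that is linear in the frequency. The margin 3 in the moment pays for
    the remainder [N^2 e^N], since [N^2 <= e^(2 N)]. *)
Lemma laplace_expand c l (u : U) : laplace_family (`|u| + 3) c l ->
  exists2 K : R, 0 <= K & forall w, `|w| <= 1 ->
   nc (laplace c l (w + u) - laplace c l u -
       laplace (fun i y => c i y * l i y w) l u) <= K * `|w| ^+ 2 /\
   nc (laplace (fun i y => c i y * l i y w) l u) <= K * `|w|.
Proof.
move=> Hf; have [cc cl ll [N [N0 lN dom]]] := Hf.
have [r hr] := bf_csum_norm_le.
have [M [MM cM]] := dom r.
have Hu : `|u| <= `|u| + 3 by rewrite lerDl.
have Hwu w : `|w| <= 1 -> `|w + u| <= `|u| + 3.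
  move=> w1; apply: (le_trans (ler_normD _ _)); lra.
have Hf1 w : laplace_family `|u| (fun i y => c i y * l i y w) l.
  by apply: laplace_familyM; apply: laplace_familyW Hf; lra.
have [K K0 hK] := hr M MM.
exists (4 * K) => [|w w1]; first by rewrite mulr_ge0.
have Ew i y : `|y| <= r -> nc (c i y * cexp (l i y u)) * expR (3 * N i y) <= M i.
  move=> yr; apply: le_trans (cM i y yr).
  rewrite ncM -mulrA ler_wpM2l ?nc_ge0//.
  have -> : (`|u| + 3) * N i y = `|u| * N i y + 3 * N i y by ring.
  rewrite expRD ler_wpM2r ?expR_ge0//.
  rewrite nc_cexp ler_expR mulrC; apply: le_trans (lN i y u).
  exact: le_trans (ler_norm _) (Re_le_nc _).
have b2 i y : `|y| <= r ->
    nc (c i y * cexp (l i y u) * (cexp (l i y w) - 1 - l i y w)) <= (4 * `|w| ^+ 2) * M i.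
  move=> yr; rewrite ncM.
  have h := lN i y w.
  have e3 : nc (cexp (l i y w) - 1 - l i y w) <= 4 * `|w| ^+ 2 * expR (3 * N i y).
    apply: (le_trans (nc_cexpB1B _)).
    have e1 : expR (nc (l i y w)) <= expR (N i y).
      by rewrite ler_expR (le_trans h)// ler_piMr.
    have e2 : nc (l i y w) ^+ 2 <= `|w| ^+ 2 * expR (2 * N i y).
      apply: (@le_trans _ _ ((N i y * `|w|) ^+ 2)); first by rewrite ler_sqr ?nnegrE ?nc_ge0 ?mulr_ge0.
      rewrite exprMn mulrC ler_wpM2l ?sqr_ge0// expRM_natl ler_sqr ?nnegrE ?expR_ge0//.
      exact: le_expR.
    have -> : 4 * `|w| ^+ 2 * expR (3 * N i y) = 4 * (`|w| ^+ 2 * expR (2 * N i y)) * expR (N i y).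
      by rewrite (_ : 3 * N i y = 2 * N i y + N i y); [rewrite expRD; ring|ring].
    apply: ler_pM => //; first by rewrite mulr_ge0// sqr_ge0.
    by rewrite ler_wpM2l.
  apply: (le_trans (ler_wpM2l (nc_ge0 _) e3)).
  rewrite mulrCA ler_wpM2l ?mulr_ge0 ?sqr_ge0//; exact: Ew.
have b1 i y : `|y| <= r ->
    nc (c i y * l i y w * cexp (l i y u)) <= `|w| * M i.
  move=> yr; rewrite mulrAC ncM.
  have h := lN i y w.
  apply: (@le_trans _ _ (nc (c i y * cexp (l i y u)) * (`|w| * expR (3 * N i y)))).
    rewrite ler_wpM2l ?nc_ge0// (le_trans h)// mulrC ler_wpM2l//.
    apply: (le_trans (le_expR _)); rewrite ler_expR; have := N0 i y; lra.
  by rewrite mulrCA ler_wpM2l//; exact: Ew.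
have c1 i := laplace_ccont i u (Hf1 w).
have [_ h1] := hK _ `|w| (normr_ge0 w) c1 b1.
have s0 : 0 <= 4 * `|w| ^+ 2 by rewrite mulr_ge0 ?sqr_ge0.
have c2 i : ccont (fun y => c i y * cexp (l i y u) * (cexp (l i y w) - 1 - l i y w)).
  apply: ccontM; first exact: laplace_ccont Hf.
  by do 2?[apply: ccontD]; rewrite //; do ?[exact: ccont_cst|apply: ccont_cexp|apply: ccontN].
have [_ h2] := hK _ _ s0 c2 b2.
split; last by apply: (le_trans h1); have := normr_ge0 w; nra.
rewrite (_ : 4 * K * `|w| ^+ 2 = 4 * `|w| ^+ 2 * K); last by ring.
apply: le_trans h2; rewrite le_eqVlt; apply/orP; left; apply/eqP; congr nc.
have [[M1 [MM1 n1]] _] := bf_csum HL (laplace_normal Hf (Hwu w w1)).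
have [[M2 [MM2 n2]] _] := bf_csum HL (laplace_normal Hf Hu).
have [[M3 [MM3 n3]] _] := bf_csum HL (laplace_normal (Hf1 w) (lexx _)).
rewrite /laplace.
set g1 := fun i => L (fun y => c i y * cexp (l i y (w + u))) in n1 *.
set g2 := fun i => L (fun y => c i y * cexp (l i y u)) in n2 *.
set g3 := fun i => L (fun y => c i y * l i y w * cexp (l i y u)) in n3 *.
have MM23 : majorant (fun i => 1 * M2 i + M3 i).
  split=> [i|]; first by rewrite mul1r addr_ge0// ?(majorant_ge0 _ MM2) ?(majorant_ge0 _ MM3).
  case: MM2 => _ [B2 hB2]; case: MM3 => _ [B3 hB3]; exists (B2 + B3) => A.
  by under eq_bigr do rewrite mul1r; rewrite big_split lerD.
have e1 : csum (fun i => 1 * g2 i + g3 i) = csum g2 + csum g3.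
  by rewrite (csumZD 1 MM2 MM3)// mul1r.
have n23 i : nc (1 * g2 i + g3 i) <= 1 * M2 i + M3 i.
  rewrite !mul1r; apply: (le_trans (ncD _ _)); apply: lerD; [exact: n2|exact: n3].
have := csumZD (-1) MM23 MM1 n23 n1.
rewrite e1 => e; transitivity (csum (fun i => -1 * (1 * g2 i + g3 i) + g1 i)).
  by rewrite e; ring.
congr csum; apply/funext => i; rewrite /g1 /g2 /g3 mulN1r mul1r.
rewrite -(bfD HL) ?(addrC (- _)) -?(bfB HL); try exact: (laplace_ccont _ _ Hf); try exact: c1.
- congr L; apply/funext => y; rewrite real_linearD// cexpD; ring.
- apply: ccontD => //; exact: (laplace_ccont _ _ Hf).
Qed.

Lemma ccont_at_laplace c l u : laplace_family (`|u| + 3) c l ->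
  ccont_at (laplace c l) u.
Proof.
move=> Hf; have [K K0 hK] := laplace_expand Hf.
apply: (ccont_lipschitz_at (K := K + K)) => w w1; have [h1 h2] := hK w w1.
set D := laplace (fun i y => c i y * l i y w) l u in h1 h2.
have -> : laplace c l (w + u) - laplace c l u = (laplace c l (w + u) - laplace c l u - D) + D by ring.
apply: (le_trans (ncD _ _)); rewrite mulrDl lerD//; apply: (le_trans h1).
by rewrite ler_wpM2l// expr2 ler_piMl.
Qed.

Lemma laplaceZ c l (h : R) v u : laplace_family (`|u| + 1) c l ->
  laplace (fun i y => c i y * l i y (h *: v)) l u =
  real_complex R h * laplace (fun i y => c i y * l i y v) l u.
Proof.
move=> Hf; have [cc cl ll dom] := Hf; have Hf1 := laplace_familyM v Hf.
have [[M [MM n]] _] := bf_csum HL (laplace_normal Hf1 (lexx _)).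
rewrite /laplace -(csumZ _ MM n); congr csum; apply/funext => i.
rewrite -(bfZ HL); last exact: (laplace_ccont _ _ Hf1).
by congr L; apply/funext => y; rewrite real_linearZ//; ring.
Qed.

Lemma cderive_laplace c l v u : laplace_family (`|u| + 3) c l ->
  cderive (laplace c l) u v (laplace (fun i y => c i y * l i y v) l u).
Proof.
move=> Hf; have [K K0 hK] := laplace_expand Hf.
have Hf1 : laplace_family (`|u| + 1) c l by apply: laplace_familyW Hf; lra.
have r0 : 0 < (`|v| + 1)^-1 by rewrite invr_gt0 ltr_wpDl.
apply: (cderive_sqr (r := (`|v| + 1)^-1) (K := K * `|v| ^+ 2)) => // h hr.
have w1 : `|h *: v| <= 1.
  rewrite normrZ; apply: (@le_trans _ _ (`|h| * (`|v| + 1))); first by rewrite ler_wpM2l// lerDl.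
  by rewrite -ler_pdivlMr ?ltr_wpDl// mul1r.
have [h1 _] := hK _ w1; rewrite laplaceZ// in h1.
by apply: (le_trans h1); rewrite normrZ exprMn (mulrC (`|h| ^+ 2)) mulrA.
Qed.

Lemma CkC_laplace k c l : (forall rho, laplace_family rho c l) -> CkC k (laplace c l).
Proof.
elim: k c => [|k ih] c Hf; first by apply: CkC0 => u; exact: ccont_at_laplace.
apply: (CkCS (df := fun v => laplace (fun i y => c i y * l i y v) l)).
- by move=> u; exact: ccont_at_laplace.
- by move=> v u; exact: cderive_laplace.
- by move=> v; apply: ih => rho; exact: laplace_familyM.
Qed.

End LaplaceTransforms.

(** * Gaussian integrals on the line *)

Section GaussianLine.
Variable R : realType.
Local Notation C := R[i].
Local Notation Re := complex.Re.
Local Notation Im := complex.Im.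
Local Notation rc := (real_complex R).

Lemma cint_FTC (a b : R) (F f : R -> C) : a < b -> ccont f ->
  (forall t, cderive F t 1 (f t)) -> cint a b f = F b - F a.
Proof.
move=> ab cf Df.
have ftc (G g : R -> R) : continuous g -> (forall t, is_derive t (1 : R) G (g t)) ->
    \int[lebesgue_measure]_(t in `[a, b]) g t = G b - G a.
  move=> cg DG; have dG t : derivable G t 1 by case: (DG t).
  have cG t : {for t, continuous G}.
    by apply: differentiable_continuous; apply/derivable1_diffP.
  rewrite /Rintegral (continuous_FTC2 ab (F := G)) //.
  - exact: continuous_subspaceT.
  - split=> //; first exact/cvg_at_right_filter/cG.
    exact/cvg_at_left_filter/cG.
  - by move=> t _; rewrite derive1E; case: (DG t).
apply: complexP; rewrite ?Re_add ?Im_add ?Re_opp ?Im_opp /=.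
  apply: (ftc (fun t => Re (F t))); first exact: ccontRe.
  by move=> t; case: (Df t).
apply: (ftc (fun t => Im (F t))); first exact: ccontIm.
by move=> t; case: (Df t).
Qed.

Lemma cderive_eq0_cst (F : R -> C) (a b : R) : a <= b ->
  (forall t, a <= t <= b -> cderive F t 1 0) -> F a = F b.
Proof.
rewrite le_eqVlt => /predU1P[->//|ab] DF.
have cst (G : R -> R) : (forall t, a <= t <= b -> is_derive t (1 : R) G 0) -> G a = G b.
  move=> DG.
  have [||c _] := @MVT _ G (fun=> 0) a b ab.
  - by move=> t; rewrite in_itv /= => /andP[at_ tb]; apply: DG; rewrite !ltW.
  - apply/continuous_in_subspaceT => t; rewrite inE /= in_itv /= => tab.
    apply: differentiable_continuous; apply/derivable1_diffP.
    by case: (DG t tab).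
  - by rewrite mul0r => /eqP; rewrite subr_eq0 => /eqP.
by apply: complexP; apply: (cst (fun t => _ (F t))) => t /DF [].
Qed.

Lemma cderive_ccont_at (F : R -> C) (t : R) (l : C) : cderive F t 1 l -> ccont_at F t.
Proof.
by move=> [[dr _] [di _]]; split;
  apply: differentiable_continuous; apply/derivable1_diffP.
Qed.

(** Decay that suffices to cut the integral over the line into periods, and that
    polynomials times Gaussians have. *)
Definition rapid (f : R -> C) : Prop :=
  ccont f /\ exists A : R, forall z, nc (f z) <= A * expR (- `|z|).

(** Integration over the line, cut into periods: the form in which Gaussian
    integrals arise from theta series. *)
Definition line (f : R -> C) : C :=
  csum (fun k : int => cint 0 (2 * pi) (fun y => f (y + 2 * pi * k%:~R))).

Lemma continuous_shift (c : R) : continuous (fun y : R => y + c).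
Proof. by move=> t; apply: cvgD; [exact: cvg_id|exact: cvg_cst]. Qed.

Lemma le_2pi_norm (x : R) : `|x| <= `|2 * pi * x|.
Proof.
rewrite normrM ler_peMl// ger0_norm ?mulr_ge0 ?pi_ge0//.
have := @pi_ge2 R; lra.
Qed.

Lemma expR_shift_le (r y x : R) : `|y| <= r ->
  expR (- `|y + 2 * pi * x|) <= expR r * expR (- `|x|).
Proof.
move=> yr; rewrite -expRD ler_expR.
have := le_2pi_norm x; have := ler_normB (y + 2 * pi * x) y.
rewrite (_ : y + 2 * pi * x - y = 2 * pi * x); last by ring.
lra.
Qed.

Lemma shift_majorant (g : R -> R) (A r : R) : (forall z, g z <= A * expR (- `|z|)) ->
  exists M : int -> R, majorant M /\
    forall k y, `|y| <= r -> g (y + 2 * pi * k%:~R) <= M k.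
Proof.
move=> gA; exists (fun k : int => `|A| * expR r * expR (- `|k%:~R : R|)); split.
  apply: majorantZ (majorant_int R); by rewrite mulr_ge0 ?expR_ge0.
move=> k y yr; apply: (le_trans (gA _)); rewrite -[leRHS]mulrA.
apply: (@le_trans _ _ (`|A| * expR (- `|y + 2 * pi * k%:~R|))).
  by rewrite ler_wpM2r ?expR_ge0 ?ler_norm.
by rewrite ler_wpM2l// expR_shift_le.
Qed.

Lemma rapid_normal f : rapid f ->
  normal_family (fun (k : int) (y : R) => f (y + 2 * pi * k%:~R)).
Proof.
move=> [cf [A fA]]; split=> [k|r].
  exact: (@ccont_comp R R R _ _ (@continuous_shift _) cf).
exact: (@shift_majorant (fun z => nc (f z)) A r fA).
Qed.

Lemma line_linear (a : C) (f g : R -> C) : rapid f -> rapid g ->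
  line (fun z => a * f z + g z) = a * line f + line g.
Proof.
move=> rf rg; rewrite /line.
have HL := bounded_functional_cint 0 (2 * pi : R).
have [[M [MM fM]] _] := bf_csum HL (rapid_normal rf).
have [[N [NN gN]] _] := bf_csum HL (rapid_normal rg).
rewrite -(csumZD a MM NN fM gN); congr csum; apply/funext => k.
by rewrite cint_linear//; apply: (@ccont_comp R R R _ _ (@continuous_shift _));
  [case: rf|case: rg].
Qed.

Lemma lineZ (a : C) (f : R -> C) : rapid f -> line (fun z => a * f z) = a * line f.
Proof.
move=> rf; have r0 : rapid (fun=> 0).
  by split; [exact: ccont_cst|exists 0 => z; rewrite nc0 mul0r].
have l0 : line (fun=> 0) = 0.
  by have := line_linear (-1) r0 r0; rewrite mulr0 addr0 mulN1r addNr.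
have := line_linear a rf r0; rewrite l0 addr0 => <-.
by congr line; apply/funext => z; rewrite addr0.
Qed.

Lemma rapidD f g : rapid f -> rapid g -> rapid (fun z => f z + g z).
Proof.
move=> [cf [A fA]] [cg [B gB]]; split; first exact: ccontD.
by exists (A + B) => z; rewrite mulrDl (le_trans (ncD _ _))// lerD.
Qed.

Lemma rapidZ (a : C) f : rapid f -> rapid (fun z => a * f z).
Proof.
move=> [cf [A fA]]; split; first by apply: ccontM => //; exact: ccont_cst.
by exists (nc a * A) => z; rewrite ncM -mulrA ler_wpM2l ?nc_ge0.
Qed.

(** Integration by parts: the boundary terms of consecutive periods cancel. *)
Lemma line_derive_eq0 (F f : R -> C) : rapid F -> rapid f ->
  (forall t, cderive F t 1 (f t)) -> line f = 0.
Proof.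
move=> rF rf DF; have [cf _] := rf.
have tp : 0 < 2 * pi :> R by rewrite mulr_gt0 ?pi_gt0.
pose G (k : int) := F (2 * pi * k%:~R).
have [_ /(_ 0)[M [MM GM]]] := rapid_normal rF.
have {}GM k : nc (G k) <= M k.
  by have := GM k 0; rewrite normr0 add0r; apply.
pose h (k : int) := k + 1; pose h' (k : int) := k - 1.
have hK : cancel h h' by move=> k; rewrite /h /h' addrK.
have h'K : cancel h' h by move=> k; rewrite /h /h' subrK.
have MM1 : majorant (fun k => M (h k)) := majorant_inj (can_inj hK) MM.
have := csumZD (-1) MM MM1 GM (fun k => GM (h k)).
rewrite -(csum_reindex hK h'K MM GM) mulN1r addNr => <-.
congr csum; apply/funext => k.
rewrite (cint_translate _ cf (ltW tp)) add0r (cint_FTC _ cf DF).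
  rewrite /G /h mulN1r [RHS]addrC; congr (F _ - _).
  by rewrite intrD; ring.
by rewrite ltrDr.
Qed.

Definition gauss1 (a b : C) (z : R) : C := cexp (- (a / 2) * rc (z ^+ 2) + b * rc z).

(** Completing the square: any linear exponent is dominated by a negative
    quadratic one. *)
Lemma sqr_sub_le (p q z : R) : 0 < p ->
  - p * z ^+ 2 + q * `|z| <= q ^+ 2 / (4 * p).
Proof.
move=> p0; rewrite -[z ^+ 2]real_normK ?num_real// ler_pdivlMr ?mulr_gt0//.
have := sqr_ge0 (2 * p * `|z| - q); nra.
Qed.

Lemma Re_mulr (z : C) (x : R) : Re (z * rc x) = Re z * x.
Proof. by rewrite Re_mul /= mulr0 subr0. Qed.

Lemma nc_gauss1_le (a b : C) (z : R) :
  nc (gauss1 a b z) <= expR (- (Re a / 2) * z ^+ 2 + nc b * `|z|).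
Proof.
rewrite nc_cexp ler_expR Re_add !Re_mulr Re_opp.
have -> : Re (a / 2) = Re a / 2.
  have -> : (2 : C)^-1 = rc 2^-1 by rewrite (rmorphV (real_complex R)) ?unitfE// rmorph_nat.
  by rewrite Re_mulr.
rewrite lerD2l (le_trans (ler_norm _))// normrM ler_wpM2r//.
exact: Re_le_nc.
Qed.

Lemma gauss1_decay (a b : C) (rho : R) : 0 < Re a ->
  exists2 A : R, 0 <= A & forall z, nc (gauss1 a b z) <= A * expR (- (rho * `|z|)).
Proof.
move=> a0; exists (expR ((nc b + rho) ^+ 2 / (4 * (Re a / 2)))); first exact: expR_ge0.
move=> z; apply: (le_trans (nc_gauss1_le _ _ _)); rewrite -expRD ler_expR.
have := @sqr_sub_le (Re a / 2) (nc b + rho) z; rewrite divr_gt0// => /(_ isT).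
lra.
Qed.

Lemma continuous_sqr : continuous (fun z : R => z ^+ 2).
Proof. by move=> z; exact: exprn_continuous. Qed.

Lemma ccont_gauss1 (a b : C) : ccont (gauss1 a b).
Proof.
apply: ccont_cexp; apply: ccontD; apply: ccontM;
  try exact: ccont_cst; apply: ccont_real.
  exact: continuous_sqr.
exact: continuous_ident.
Qed.

Lemma rapid_gauss1 (a b : C) n : 0 < Re a -> rapid (fun z => rc (z ^+ n) * gauss1 a b z).
Proof.
move=> a0; split.
  apply: ccontM; last exact: ccont_gauss1.
  by apply: ccont_real; move=> z; exact: exprn_continuous.
have [A A0 hA] := gauss1_decay b (n%:R + 1) a0.
exists A => z; rewrite ncM nc_real normrX.
apply: (@le_trans _ _ (expR (n%:R * `|z|) * (A * expR (- ((n%:R + 1) * `|z|))))).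
  apply: ler_pM; rewrite ?exprn_ge0 ?nc_ge0//.
  by rewrite expRM_natl lerXn2r ?nnegrE ?expR_ge0// le_expR.
rewrite mulrCA ler_wpM2l// -expRD ler_expR; lra.
Qed.

Definition moment n (a b : C) : C := line (fun z => rc (z ^+ n) * gauss1 a b z).

Lemma cderive_gauss1 (a b : C) (t : R) :
  cderive (gauss1 a b) t 1 ((- a * rc t + b) * gauss1 a b t).
Proof.
have := @cderive_gauss R R (fun z => - (a / 2) * rc (z ^+ 2) + b * rc z)
  (fun z => - (a / 2) * rc (z ^+ 2))
  (fun v u => - a * rc u * rc v + b * rc v).
have rcD x y : rc (x + y) = rc x + rc y by rewrite rmorphD.
have rcM x y : rc (x * y) = rc x * rc y by rewrite rmorphM.
move=> /(_ _ t 1) h.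
have -> : (- a * rc t + b) = - a * rc t * rc 1 + b * rc 1 by rewrite rmorph1 !mulr1.
apply: h => h v u; rewrite /GRing.scale /= !(rcD, rcM, expr2); field.
by [].
Qed.

Lemma cderive_rc (t : R) : cderive rc t 1 1.
Proof.
apply: (cderive_sqr (r := 1) (K := 0)) => // h _.
rewrite (_ : h *: (1 : R) = h); last exact: mulr1.
by rewrite rmorphD mulr1 addrK subrr nc0 mul0r.
Qed.

(** The integral of the derivative of [gauss1 a b] vanishes. *)
Lemma moment1 (a b : C) : 0 < Re a -> a * moment 1 a b = b * moment 0 a b.
Proof.
move=> a0; have r0 := rapid_gauss1 b 0 a0; have r1 := rapid_gauss1 b 1 a0.
have rg : rapid (gauss1 a b).
  by have := r0; under eq_fun do rewrite expr0 rmorph1 mul1r.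
have h : line (fun z => - a * (rc (z ^+ 1) * gauss1 a b z) + b * (rc (z ^+ 0) * gauss1 a b z)) = 0.
  apply: (line_derive_eq0 rg); first by apply: rapidD; apply: rapidZ.
  move=> t; rewrite expr1 expr0 rmorph1.
  rewrite (_ : _ + _ = (- a * rc t + b) * gauss1 a b t); first exact: cderive_gauss1.
  by ring.
move: h; rewrite (line_linear _ r1 (rapidZ b r0)).
rewrite (lineZ b r0) mulNr => /eqP; rewrite addrC subr_eq0 => /eqP <-; by [].
Qed.

(** The same for the derivative of [z * gauss1 a b z]. *)
Lemma moment2 (a b : C) : 0 < Re a ->
  a * moment 2 a b = moment 0 a b + b * moment 1 a b.
Proof.
move=> a0; have r0 := rapid_gauss1 b 0 a0; have r1 := rapid_gauss1 b 1 a0.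
have r2 := rapid_gauss1 b 2 a0.
have h : line (fun z => - a * (rc (z ^+ 2) * gauss1 a b z) +
    (b * (rc (z ^+ 1) * gauss1 a b z) + rc (z ^+ 0) * gauss1 a b z)) = 0.
  apply: (line_derive_eq0 r1); first by do 2?[apply: rapidD]; try apply: rapidZ.
  move=> t; have := cderiveM (cderive_rc t) (cderive_gauss1 a b t).
  rewrite expr0 !expr1 rmorph1 expr2 rmorphM.
  rewrite (_ : _ + 1 * _ = - a * (rc t * rc t * gauss1 a b t) + (b * (rc t * gauss1 a b t) + 1 * gauss1 a b t)) //.
  by ring.
move: h; rewrite (line_linear _ r2); last by apply: rapidD => //; apply: rapidZ.
rewrite (line_linear _ r1 r0) mulNr => /eqP; rewrite addrC subr_eq0 => /eqP <-.
by rewrite addrC.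
Qed.

Lemma cderive_transport (U V : normedModType R) (f : U -> C) (g : V -> C) x v y w l :
  (forall h : R, g (h *: w + y) = f (h *: v + x)) -> cderive f x v l -> cderive g y w l.
Proof.
move=> gf.
have e (P : C -> R) : (fun h : R => h^-1 *: (((fun x => P (g x)) \o shift y) (h *: w) - P (g y) : R^o)) =
    (fun h : R => h^-1 *: (((fun x => P (f x)) \o shift x) (h *: v) - P (f x) : R^o)).
  apply/funext => h /=; rewrite gf; congr (_ *: (_ - P _)).
  by have := gf 0; rewrite !scale0r !add0r.
move=> [[fr1 fr2] [fi1 fi2]]; split; apply: DeriveDef.
- by rewrite /derivable e.
- by rewrite /derive e.
- by rewrite /derivable e.
- by rewrite /derive e.
Qed.

(** Completing the square in the linear term: both sides satisfy the same
    linear differential equation along the segment from [0] to [b]. *)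
Lemma moment0_linear (a b : C) : 0 < Re a ->
  moment 0 a b = moment 0 a 0 * cexp (b ^+ 2 / (2 * a)).
Proof.
move=> a0.
have an0 : a != 0 by apply: contraTneq a0 => ->; rewrite ltxx.
have HL := bounded_functional_cint 0 (2 * pi : R).
pose z (k : int) (y : R) := y + 2 * pi * k%:~R.
pose c (k : int) (y : R) := gauss1 a 0 (z k y).
pose l (k : int) (y t : R) := rc t * (b * rc (z k y)).
have cz k : continuous (z k) by exact: continuous_shift.
have Hf rho : laplace_family rho c l.
  split.
  - by move=> k; apply: (ccont_comp (cz k)); exact: ccont_gauss1.
  - move=> k t; apply: ccontM; first exact: ccont_cst.
    by apply: ccontM; [exact: ccont_cst|exact: ccont_real].
  - by move=> k y h v u; rewrite /l rmorphD /GRing.scale /= rmorphM; ring.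
  exists (fun k y => nc b * `|z k y|); split.
  - by move=> k y; rewrite mulr_ge0 ?nc_ge0.
  - by move=> k y u; rewrite !ncM !nc_real mulrC.
  move=> r; have [A A0 hA] := gauss1_decay 0 (rho * nc b + 1) a0.
  apply: (@shift_majorant (fun z => nc (gauss1 a 0 z) * expR (rho * (nc b * `|z|))) A r) => x.
  apply: (le_trans (ler_wpM2r (expR_ge0 _) (hA x))).
  rewrite -mulrA -expRD ler_wpM2l// ler_expR; lra.
have key (x m0 m1 : C) : a * m1 = x * b * m0 -> b * m1 = x * (b ^+ 2 / a) * m0.
  move=> e; apply: (mulfI an0); rewrite mulrCA e; field; exact: an0.
pose F t := moment 0 a (rc t * b).
have cE (k : int) (y t : R) : c k y * cexp (l k y t) = gauss1 a (rc t * b) (z k y).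
  by rewrite /c /gauss1 -cexpD /l; congr cexp; ring.
have FE : F = laplace (cint 0 (2 * pi)) c l.
  apply/funext => t; rewrite /F /moment /line /laplace; congr csum; apply/funext => k.
  by congr cint; apply/funext => y; rewrite cE expr0 rmorph1 mul1r.
have DF t : cderive F t 1 (rc t * (b ^+ 2 / a) * F t).
  have := cderive_laplace HL (1 : R) (Hf (`|t| + 3)).
  rewrite -FE (_ : laplace _ _ _ _ = rc t * (b ^+ 2 / a) * F t) //.
  have m1 := moment1 (rc t * b) a0.
  transitivity (b * moment 1 a (rc t * b)); last first.
    exact: key m1.
  rewrite /moment -lineZ; last exact: rapid_gauss1.
  rewrite /laplace /line; congr csum; apply/funext => k; congr cint; apply/funext => y.
  by rewrite mulrAC cE /l rmorph1 expr1 -/(z k y); ring.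
pose E (t : R) := cexp (- (b ^+ 2 / (2 * a)) * rc (t ^+ 2)).
have DE t : cderive E t 1 (- (rc t * (b ^+ 2 / a)) * E t).
  have rcD x y : rc (x + y) = rc x + rc y by rewrite rmorphD.
  have rcM x y : rc (x * y) = rc x * rc y by rewrite rmorphM.
  have := @cderive_gauss R R (fun t => - (b ^+ 2 / (2 * a)) * rc (t ^+ 2))
    (fun t => - (b ^+ 2 / (2 * a)) * rc (t ^+ 2)) (fun v u => - (rc u * (b ^+ 2 / a)) * rc v).
  move=> /(_ _ t 1) h.
  have -> : - (rc t * (b ^+ 2 / a)) = - (rc t * (b ^+ 2 / a)) * rc 1 by rewrite rmorph1 mulr1.
  apply: h => h v u; rewrite /GRing.scale /= !(rcD, rcM, expr2); field; exact: an0.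
have cst : F 0 * E 0 = F 1 * E 1.
  apply: (@cderive_eq0_cst (fun t => F t * E t) 0 1 ler01) => t _.
  have := cderiveM (DF t) (DE t).
  by rewrite (_ : _ + _ = 0)//; ring.
move: cst; rewrite /F /E rmorph0 mul0r rmorph1 mul1r expr0n expr1n /= rmorph0 rmorph1 !mulr1 mulr0.
rewrite cexp0 mulr1 => e; rewrite e -mulrA -cexpD addNr cexp0.
exact/esym/mulr1.
Qed.

(** Differentiation in the quadratic coefficient brings down [- d z^2 / 2]. The
    integral is a Laplace transform in the coefficient, so that its derivative
    is already known. *)
Lemma cderive_moment0_path (a d : C) : 0 < Re a -> forall s0 : R,
  cderive (fun s => moment 0 (a + rc (s - s0) * d) 0) s0 1 (- (d / 2) * moment 2 a 0).
Proof.
move=> a0 s0.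
have HL := bounded_functional_cint 0 (2 * pi : R).
pose z (k : int) (y : R) := y + 2 * pi * k%:~R.
(* The path parameter is rescaled by [ep]: the quadratic frequency, taken with the
   weight 3 of [cderive_laplace], then costs at most half of the decay of the
   Gaussian. *)
pose ep : R := Re a / (12 * (nc (d / 2) + 1)).
have dp : 0 < nc (d / 2) + 1 by rewrite ltr_wpDl ?nc_ge0.
have ep0 : 0 < ep by rewrite divr_gt0// mulr_gt0.
pose c (k : int) (y : R) := gauss1 a 0 (z k y).
pose l (k : int) (y t : R) := rc t * (rc ep * (- (d / 2)) * rc (z k y ^+ 2)).
have cz k : continuous (z k) by exact: continuous_shift.
have Hf : laplace_family (`|0 : R| + 3) c l.
  split.
  - by move=> k; apply: (ccont_comp (cz k)); exact: ccont_gauss1.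
  - move=> k t; apply: ccontM; first exact: ccont_cst.
    apply: ccontM; first exact: ccont_cst.
    by apply: ccont_real; exact: (continuous_compose (cz k) continuous_sqr).
  - by move=> k y h v u; rewrite /l rmorphD /GRing.scale /= rmorphM; ring.
  exists (fun k y => ep * nc (d / 2) * `|z k y| ^+ 2); split.
  - by move=> k y; rewrite mulr_ge0 ?sqr_ge0// mulr_ge0 ?nc_ge0// ltW.
  - by move=> k y u; rewrite /l ncM (ncM (rc ep * _)) (ncM (rc ep)) !nc_real ncN (gtr0_norm ep0) mulrC normrX.
  move=> r; pose A := expR (1 ^+ 2 / (4 * (Re a / 4))).
  apply: (@shift_majorant (fun z => nc (gauss1 a 0 z) * expR ((`|0 : R| + 3) * (ep * nc (d / 2) * `|z| ^+ 2))) A r) => x.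
  rewrite -expRD; apply: (le_trans (ler_wpM2r (expR_ge0 _) (nc_gauss1_le _ _ _))).
  rewrite -expRD ler_expR nc0 mul0r addr0 normr0 add0r real_normK ?num_real//.
  have := @sqr_sub_le (Re a / 4) 1 x; rewrite divr_gt0// => /(_ isT).
  have : 3 * (ep * nc (d / 2)) <= Re a / 4.
    rewrite (_ : Re a / 4 = 3 * (ep * (nc (d / 2) + 1))); last first.
      by rewrite /ep; field; rewrite gt_eqF.
    by rewrite ler_wpM2l// ler_wpM2l ?(ltW ep0)// lerDl.
  move=> h1 h2; have := ler_wpM2r (sqr_ge0 x) h1; lra.
have FE (h : R) : moment 0 (a + rc (h * ep) * d) 0 = laplace (cint 0 (2 * pi)) c l h.
  rewrite /moment /line /laplace; congr csum; apply/funext => k.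
  congr cint; apply/funext => y.
  rewrite expr0 rmorph1 mul1r /c /l /gauss1 -cexpD /z; congr cexp.
  by rewrite rmorphM; field.
have := cderive_laplace HL (ep^-1) Hf.
have -> : laplace (cint 0 (2 * pi)) (fun i y => c i y * l i y ep^-1) l 0 = - (d / 2) * moment 2 a 0.
  rewrite /moment -lineZ; last exact: rapid_gauss1.
  rewrite /laplace /line; congr csum; apply/funext => k; congr cint; apply/funext => y.
  rewrite /l rmorph0 mul0r cexp0 mulr1 /c -/(z k y).
  have e1 : rc ep^-1 * rc ep = 1 by rewrite -rmorphM mulVf ?gt_eqF// rmorph1.
  transitivity ((rc ep^-1 * rc ep) * (- (d / 2) * (rc (z k y ^+ 2) * gauss1 a 0 (z k y)))).
    by ring.
  by rewrite e1 mul1r.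
apply: (@cderive_transport R R (laplace (cint 0 (2 * pi)) c l)
  (fun s => moment 0 (a + rc (s - s0) * d) 0)) => h.
have e1 : h *: (1 : R) + s0 - s0 = (h / ep) * ep.
  by rewrite addrK divfK ?gt_eqF//; exact: mulr1.
have e2 : h *: ep^-1 + 0 = h / ep :> R by rewrite addr0.
by rewrite e1 e2; exact: FE.
Qed.

Lemma telescope_cint (f : R -> C) (a : R) (N : nat) : ccont f ->
  cint a (a + 2 * pi * N%:R) f =
  \sum_(j < N) cint (a + 2 * pi * j%:R) (a + 2 * pi * j.+1%:R) f.
Proof.
move=> cf; elim: N => [|N ih]; first by rewrite big_ord0 mulr0 addr0 cint_point.
rewrite big_ord_recr /= -ih; apply: cint_chasles => //.
  by rewrite lerDl mulr_ge0// mulr_ge0// pi_ge0.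
by rewrite lerD2l ler_wpM2l ?mulr_ge0 ?pi_ge0// ler_nat.
Qed.

(** For [a = 2] the integrand is [exp (- z^2)]. Its known integral is the limit of
    the integrals over [- 2 pi n, 2 pi n], which are partial sums of [line]. *)
Lemma moment0_real : moment 0 2 0 = rc (Num.sqrt pi).
Proof.
pose g (z : R) : C := rc (gauss_fun z).
have gE : (fun z => rc (z ^+ 0) * gauss1 2 0 z) = g.
  apply/funext => z; rewrite expr0 rmorph1 mul1r /gauss1 mul0r addr0 divff//.
  rewrite mulN1r -rmorphN /g /gauss_fun /cexp; apply: complexP => /=.
    by rewrite ?oppr0 cos0 mulr1.
  by rewrite ?oppr0 sin0 mulr0.
have rg : rapid g.
  rewrite -gE; apply: rapid_gauss1.
  by rewrite (_ : (2 : C) = rc 2) ?rmorph_nat//= ltr0n.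
have [cg _] := rg.
rewrite /moment gE /line.
have := rapid_normal rg => nf.
have [[M [MM hM]] _] := bf_csum (bounded_functional_cint 0 (2 * pi : R)) nf.
set f := (fun k : int => cint _ _ _) in hM *.
have tp : 0 < 2 * pi :> R by rewrite mulr_gt0 ?pi_gt0.
have fE k : f k = cint (2 * pi * k%:~R) (2 * pi * (k + 1)%:~R) g.
  rewrite /f (cint_translate _ cg (ltW tp)) add0r intrD; congr (cint _ _ _); ring.
pose I (n : nat) : R := \int[lebesgue_measure]_(t in `[- (2 * pi * n%:R), 2 * pi * n%:R]) gauss_fun t.
have cvgI : I n @[n --> \oo] --> Num.sqrt pi.
  pose F (n : nat) : set R := [set` `[- (2 * pi * n%:R), 2 * pi * n%:R]].
  have : (\int[lebesgue_measure]_(x in F n) (gauss_fun x)%:E)%E @[n --> \oo] -->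
         (\int[lebesgue_measure]_(x in \bigcup_n F n) (gauss_fun x)%:E)%E.
    apply: ge0_nondecreasing_set_cvg_integral.
    - move=> m n mn; rewrite subsetEset /F; apply: subset_itv; rewrite bnd_simp.
        by rewrite lerN2 ler_wpM2l ?(ltW tp)// ler_nat.
      by rewrite ler_wpM2l ?(ltW tp)// ler_nat.
    - by move=> n; exact: measurable_itv.
    - move=> n; apply/measurable_realfun.measurable_EFinP; apply: measurable_funTS.
      exact: measurable_gauss_fun.
    - by move=> n x _; rewrite lee_fin gauss_fun_ge0.
  have -> : \bigcup_n F n = setT.
    apply/seteqP; split=> // x _; exists (Num.truncn `|x|).+1 => //=.
    rewrite /F /= in_itv /= -ler_norml.
    apply: (@le_trans _ _ (Num.truncn `|x|).+1%:R).
      by rewrite ltW// truncnS_gt.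
    by rewrite ler_peMl//; have := @pi_ge2 R; lra.
  rewrite integralT_gauss => /fine_cvg; exact.
have InE n : rc (I n) = \sum_(j < n.*2) f (Posz j - Posz n).
  have -> : rc (I n) = cint (- (2 * pi * n%:R)) (2 * pi * n%:R) g.
    rewrite /cint /g /= ; apply: complexP => //=.
    by rewrite Rintegral_cst//= mul0r.
  have e : - (2 * pi * n%:R) + 2 * pi * n.*2%:R = 2 * pi * n%:R :> R.
    by rewrite -addnn natrD; ring.
  have := telescope_cint (- (2 * pi * n%:R)) n.*2 cg; rewrite e => ->.
  apply: eq_bigr => j _; rewrite fE.
  have e1 (i : nat) : - (2 * pi * n%:R) + 2 * pi * i%:R = 2 * pi * (Posz i - Posz n)%:~R :> R.
    by rewrite intrB -!pmulrn; ring.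
  have -> : Posz j - Posz n + 1 = Posz j.+1 - Posz n by lia.
  by rewrite !e1.
apply/eqP; rewrite -subr_eq0; apply/eqP; apply: nc0_eq0; apply: le_anti.
rewrite nc_ge0 andbT; apply/ler_addgt0Pr => e e0; rewrite add0r.
have e20 : 0 < e / 2 by rewrite divr_gt0.
have [A0 hA0] := csum_tail MM e20.
have /cvgrPdist_le/(_ _ e20)[N _ hN] := cvgI.
pose n := maxn N (\max_(k <- A0) `|k|%N.+1).
have h1 := hN n (leq_maxl _ _).
pose A := [fset Posz j - Posz n | j in [fset j | j in iota 0 n.*2]]%fset.
have memF j : (j \in [fset j | j in iota 0 n.*2]%fset) = (j < n.*2)%N.
  by rewrite in_fset; apply: (mem_iota 0 n.*2 j).
have sA : (A0 `<=` A)%fset.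
  apply/fsubsetP => k kA0.
  have kn : (`|k| < n)%N.
    rewrite /n leq_max; apply/orP; right.
    exact: (@leq_bigmax_seq _ _ xpredT (fun k : int => `|k|%N.+1)).
  apply/imfsetP; move: kn; clear; move: (k : int) => {}k kn.
  exists (absz (k + Posz n)%R); first by rewrite /= in_fset; apply/idP; rewrite (mem_iota 0 n.*2); lia.
  lia.
have := hA0 f hM A sA.
have -> : \sum_(k <- A) f k = rc (I n).
  rewrite InE big_imfset /=; last by move=> x y _ _; lia.
  rewrite (perm_big (iota 0 n.*2)); last first.
    apply: uniq_perm; [exact: fset_uniq|exact: iota_uniq|].
    by move=> x; rewrite memF; symmetry; apply: (mem_iota 0 n.*2 x).
  by rewrite -(big_mkord xpredT (fun j => f (Posz j - Posz n))) /index_iota subn0.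
move=> h2.
have -> : csum f - rc (Num.sqrt pi) = (csum f - rc (I n)) - rc (Num.sqrt pi - I n).
  by rewrite rmorphB; ring.
apply: (le_trans (ncD _ _)); rewrite ncN nc_real; lra.
Qed.

(** By [moment2] the function [J (a)^2 * a], where [J (a)] is the left-hand side,
    has derivative zero along the segment from [2] to [a]. Hence both sides are
    square roots of [2 pi / a] there, and continuity selects the branch. *)
Lemma moment0_zero (a : C) : 0 < Re a ->
  moment 0 a 0 = rc (Num.sqrt (2 * pi)) * (sqrtc a)^-1.
Proof.
move=> a0; pose d := a - 2; pose p (s : R) := 2 + rc s * d.
have two : (2 : C) = rc 2 by rewrite rmorph_nat.
have p0 (s : R) : 0 <= s <= 1 -> 0 < Re (p s).
  move=> /andP[s0 s1]; rewrite /p /d two Re_add Re_mul Re_add Re_opp /= mul0r subr0.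
  have : 0 <= s * Re a by rewrite mulr_ge0// ltW.
  case: (ltP s 1) => s1'; first nra.
  have -> : s = 1 by apply/le_anti; rewrite s1. 
  lra.
have pn0 (s : R) : 0 <= s <= 1 -> p s != 0.
  by move=> /p0; apply: contraTneq => ->; rewrite ltxx.
pose f (s : R) := moment 0 (p s) 0.
have Df (s : R) : 0 <= s <= 1 -> cderive f s 1 (- (d / 2) * moment 2 (p s) 0).
  move=> s01; have := cderive_moment0_path d (p0 s s01) s.
  apply: (@cderive_transport R R (fun t => moment 0 (p s + rc (t - s) * d) 0) f s 1 s 1 _ _).
  move=> h; have e : p (h *: 1 + s) = p s + rc (h *: 1 + s - s) * d.
    by rewrite /p rmorphB; ring.
  by rewrite /f e.
have Dp (s : R) : cderive p s 1 d.
  apply: (cderive_sqr (r := 1) (K := 0)) => // h _.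
  rewrite (_ : h *: (1 : R) = h); last exact: mulr1.
  rewrite /p rmorphD [X in nc X](_ : _ = 0); first by rewrite nc0 mul0r.
  by ring.
have fsq (s : R) : 0 <= s <= 1 -> f s ^+ 2 * p s = f 0 ^+ 2 * p 0.
  move=> /andP[s0 s1]; symmetry.
  apply: (@cderive_eq0_cst (fun s => f s ^+ 2 * p s) 0 s s0) => t /andP[t0 ts].
  have t01 : 0 <= t <= 1 by rewrite t0 (le_trans ts).
  have := cderiveM (cderiveM (Df t t01) (Df t t01)) (Dp t).
  rewrite (_ : _ * d + _ = 0) //.
  have := @moment2 (p t) 0 (p0 t t01); rewrite mul0r addr0 -/(f t) => m2.
  transitivity (d * f t * (f t - p t * moment 2 (p t) 0)); first by field.
  by rewrite m2 subrr mulr0.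
have f0 : f 0 = rc (Num.sqrt pi) by rewrite /f /p rmorph0 mul0r addr0 moment0_real.
have sq2pi : Num.sqrt (2 * pi : R) ^+ 2 = 2 * pi by rewrite sqr_sqrtr// mulr_ge0// pi_ge0.
pose g (s : R) := rc (Num.sqrt (2 * pi)) * (sqrtc (p s))^-1.
have sn0 (s : R) : 0 <= s <= 1 -> sqrtc (p s) != 0 by move=> /pn0; rewrite sqrtc_eq0.
have p1 : p 1 = a by rewrite /p rmorph1 mul1r /d; ring.
suff : f 1 = g 1 by rewrite /f /g p1.
apply: eq_sqrt_path.
- by move=> s /Df; exact: cderive_ccont_at.
- move=> s s01; apply: ccont_atM; first exact: ccont_at_cst.
  apply: ccont_atV; first exact: sn0.
  by apply: ccont_at_sqrtc; [exact: p0|exact: cderive_ccont_at (Dp s)].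
- move=> s s01; rewrite mulf_neq0 ?invr_eq0 ?sn0//.
  apply/eqP => /complexI/eqP; rewrite sqrtr_eq0 leNgt mulr_gt0// pi_gt0//.
- move=> s s01; rewrite /g exprMn exprVn sqr_sqrtc -rmorphXn sq2pi.
  apply: (mulIf (pn0 s s01)); rewrite fsq// divfK ?pn0// f0 -rmorphXn sqr_sqrtr ?pi_ge0//.
  by rewrite /p rmorph0 mul0r addr0 two -rmorphM mulrC.
- rewrite f0 /g /p rmorph0 mul0r addr0 two sqrtc_sqrtr; last by rewrite lecR ler0n.
  rewrite /= sqrtrM// rmorphM mulrC mulKf//.
  apply/eqP => /complexI/eqP; rewrite sqrtr_eq0 leNgt ltr0n//.
Qed.

Theorem gaussian_line (a b : C) : 0 < Re a ->
  line (gauss1 a b) =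
  rc (Num.sqrt (2 * pi)) * (sqrtc a)^-1 * cexp (b ^+ 2 / (2 * a)).
Proof.
move=> a0; rewrite -moment0_zero// -moment0_linear// /moment.
by congr line; apply/funext => z; rewrite expr0 rmorph1 mul1r.
Qed.

End GaussianLine.

(** * Symmetric matrices with positive real part *)

Section PositiveRealPart.
Variable R : realType.
Local Notation C := R[i].
Local Notation Re := complex.Re.
Local Notation Im := complex.Im.
Local Notation rc := (real_complex R).

Definition hform n (T : 'M[C]_n) (z : 'cV[C]_n) : C :=
  ((map_mx conjc z)^T *m T *m z) 0 0.

Lemma hformE n (T : 'M[C]_n) z :
  hform T z = \sum_(j < n) \sum_(i < n) conjc (z i 0) * T i j * z j 0.
Proof.
rewrite /hform mxE; apply: eq_bigr => j _; rewrite mxE mulr_suml.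
by apply: eq_bigr => i _; rewrite !mxE.
Qed.

(** Positivity of the real part, tested on complex vectors: invertibility, the
    location of the spectrum and the stability under Schur complements are then
    read off from single vectors. [Re_hform] reduces it to real vectors. *)
Definition posC n (T : 'M[C]_n) : Prop :=
  T^T = T /\ forall z : 'cV[C]_n, z != 0 -> 0 < Re (hform T z).

Lemma hform1 n (z : 'cV[C]_n) :
  hform 1%:M z = rc (\sum_(i < n) nc (z i 0) ^+ 2).
Proof.
rewrite /hform mulmx1 mxE rmorph_sum; apply: eq_bigr => i _.
rewrite !mxE; case: (z i 0) => a b; rewrite ncE sqr_sqrtr ?addr_ge0 ?sqr_ge0//=.
by apply: complexP => /=; ring.
Qed.

Lemma norm2_gt0 n (z : 'cV[C]_n) : z != 0 -> 0 < \sum_(i < n) nc (z i 0) ^+ 2.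
Proof.
move=> z0; rewrite lt_neqAle sumr_ge0 ?andbT => [|i _]; last exact: sqr_ge0.
apply: contra z0; rewrite eq_sym psumr_eq0 => [/allP h|i _]; last exact: sqr_ge0.
apply/eqP/colP => i; rewrite mxE; apply: nc0_eq0.
by have /implyP/(_ isT) := h i (mem_index_enum i); rewrite sqrf_eq0 => /eqP.
Qed.

Lemma hformD n (S T : 'M[C]_n) z : hform (S + T) z = hform S z + hform T z.
Proof. by rewrite /hform mulmxDr mulmxDl mxE. Qed.
Lemma hformZ n (a : C) (T : 'M[C]_n) z : hform (a *: T) z = a * hform T z.
Proof. by rewrite /hform -scalemxAr -scalemxAl mxE. Qed.
Lemma hformN n (T : 'M[C]_n) z : hform (- T) z = - hform T z.
Proof. by rewrite -scaleN1r hformZ mulN1r. Qed.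

Lemma hform_real n (T : 'M[C]_n) (x : 'cV[R]_n) :
  Re (hform T (map_mx rc x)) = (x^T *m map_mx (@complex.Re R) T *m x) 0 0.
Proof.
rewrite hformE [RHS]mxE Re_sum; apply: eq_bigr => j _; rewrite [in RHS]mxE mulr_suml Re_sum.
apply: eq_bigr => i _; rewrite !mxE /= Re_mul Re_mul /= oppr0; ring.
Qed.

(** On a complex vector [a + ib], the real part of the Hermitian form of a
    symmetric matrix is the sum of its values on [a] and [b]; the mixed terms
    cancel by symmetry. *)
Lemma Re_hform n (T : 'M[C]_n) (z : 'cV[C]_n) : T^T = T ->
  Re (hform T z) = Re (hform T (map_mx rc (map_mx (@complex.Re R) z))) +
                   Re (hform T (map_mx rc (map_mx (@complex.Im R) z))).
Proof.
move=> sT; rewrite !hformE !Re_sum.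
pose m i j := Im (z i 0) * Im (T i j) * Re (z j 0).
have -> : \sum_(j < n) Re (\sum_(i < n) conjc (z i 0) * T i j * z j 0) =
  \sum_(j < n) (Re (\sum_(i < n) conjc (map_mx rc (map_mx (@complex.Re R) z) i 0) * T i j *
                     map_mx rc (map_mx (@complex.Re R) z) j 0) +
    Re (\sum_(i < n) conjc (map_mx rc (map_mx (@complex.Im R) z) i 0) * T i j *
                     map_mx rc (map_mx (@complex.Im R) z) j 0) +
    \sum_(i < n) (m i j - m j i)).
  apply: eq_bigr => j _; rewrite !Re_sum -!big_split /=; apply: eq_bigr => i _.
  have Tji : T j i = T i j by rewrite -[in LHS]sT mxE.
  rewrite /m Tji !mxE; case: (z i 0) => a b; case: (z j 0) => c d; case: (T i j) => u v /=.
  ring.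
rewrite !big_split /= -[RHS]addr0; congr (_ + _).
under eq_bigr do rewrite sumrB.
by rewrite sumrB exchange_big /= subrr.
Qed.

Lemma posC_domain n (S : 'M[C]_n) : potapov_domain S <-> posC (- S).
Proof.
split=> [[sS neg]|[sS pos]].
  split=> [|z z0]; first by rewrite linearN /= sS.
  rewrite hformN Re_opp oppr_gt0 Re_hform// !hform_real.
  set a := map_mx _ z; set b := map_mx _ z.
  have nonpos (x : 'cV[R]_n) : (x^T *m map_mx (@complex.Re R) S *m x) 0 0 <= 0.
    have [->|/neg/ltW//] := eqVneq x 0; by rewrite mulmx0 mxE.
  have [a0|/neg h] := eqVneq a 0; last by rewrite -[ltRHS]addr0 ltr_leD.
  have [b0|/neg h] := eqVneq b 0; last by rewrite -[ltRHS]addr0 addrC ltr_leD.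
  case/eqP: z0; apply/colP => i; rewrite mxE.
  by apply: complexP; [have := congr1 (fun M : 'cV[R]_n => M i 0) a0
    |have := congr1 (fun M : 'cV[R]_n => M i 0) b0]; rewrite !mxE.
have sS' : S^T = S by apply: oppr_inj; rewrite -linearN.
split=> // x x0; rewrite -hform_real -oppr_gt0 -Re_opp -hformN; apply: pos.
apply: contra x0 => /eqP h; apply/eqP/colP => i.
have := congr1 (fun M : 'cV[C]_n => M i 0) h; rewrite !mxE => /complexI//.
Qed.

(** The form vanishes on a kernel vector. *)
Lemma posC_unit n (T : 'M[C]_n) : posC T -> T \in unitmx.
Proof.
move=> [sT pos]; rewrite unitmxE unitfE; apply/det0P => -[v v0 vT].
have : 0 < Re (hform T v^T).
  by apply: pos; apply: contra v0 => /eqP h; rewrite -[v]trmxK h trmx0.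
rewrite /hform -mulmxA (_ : T *m v^T = 0) ?mulmx0 ?mxE ?ltxx//.
by rewrite -[T]sT -trmx_mul vT trmx0.
Qed.

Lemma posC_dr m n (T : 'M[C]_(m + n)) : posC T -> posC (drsubmx T).
Proof.
move=> [sT pos]; split; first by rewrite trmx_drsub sT.
move=> z z0.
have : 0 < Re (hform T (col_mx 0 z)).
  apply: pos; apply: contra z0 => /eqP h.
  by rewrite -(col_mxKd (0 : 'cV_m) z) h linear0.
rewrite /hform map_col_mx tr_col_mx -{1}[T]submxK mul_row_block mul_row_col.
by rewrite map_mx0 trmx0 mulmx0 !mul0mx !add0r.
Qed.

Definition schur n (T : 'M[C]_(1 + n)) : C :=
  (ulsubmx T - ursubmx T *m invmx (drsubmx T) *m dlsubmx T) 0 0.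

Lemma schur_elim n (T : 'M[C]_(1 + n)) : drsubmx T \in unitmx ->
  T *m block_mx 1%:M 0 (- (invmx (drsubmx T) *m dlsubmx T)) 1%:M =
  block_mx (schur T)%:M (ursubmx T) 0 (drsubmx T).
Proof.
move=> uT; rewrite -{1}[T]submxK mulmx_block !mulmx1 !mulmx0 !add0r mulmxN.
by rewrite mulmxN !mulmxA mulmxV// mul1mx subrr [X in block_mx X](mx11_scalar).
Qed.

Lemma det_schur n (T : 'M[C]_(1 + n)) : drsubmx T \in unitmx ->
  \det T = schur T * \det (drsubmx T).
Proof.
move=> uT; have := congr1 determinant (schur_elim uT).
by rewrite det_mulmx det_lblock !det1 !mulr1 det_ublock det_scalar1.
Qed.

(** The Schur complement is the value of the form at the vector [(1, w)] whose
    image under [T] has only its first coordinate nonzero. *)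
Lemma Re_schur_gt0 n (T : 'M[C]_(1 + n)) : posC T -> 0 < Re (schur T).
Proof.
move=> pT; have uT := posC_unit (posC_dr pT); have [sT pos] := pT.
pose w := - (invmx (drsubmx T) *m dlsubmx T).
pose z : 'cV[C]_(1 + n) := col_mx 1%:M w.
have Tz : T *m z = col_mx (schur T)%:M 0.
  have := congr1 lsubmx (schur_elim uT).
  by rewrite -/w -mulmx_lsub !block_mxEh !row_mxKl -/z.
have : 0 < Re (hform T z).
  apply: pos; apply/eqP => h; have := congr1 usubmx h.
  rewrite col_mxKu linear0 => /matrixP/(_ 0 0); rewrite !mxE eqxx /=.
  by move/eqP; rewrite oner_eq0.
rewrite /hform -mulmxA Tz map_col_mx tr_col_mx mul_row_col mulmx0 addr0.
by rewrite map_mx1 trmx1 mul1mx mxE eqxx mulr1n.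
Qed.

(** The branch of the inverse square root of the determinant that iterated
    Gaussian integration produces: one principal square root for each pivot. *)
Fixpoint pivot_inv_sqrt n : 'M[C]_n -> C :=
  match n with
  | 0 => fun _ => 1
  | n'.+1 => fun T => pivot_inv_sqrt (drsubmx (T : 'M[C]_(1 + n'))) *
                      (sqrtc (schur (T : 'M[C]_(1 + n'))))^-1
  end.

Lemma sqr_pivot n (T : 'M[C]_n) : posC T -> pivot_inv_sqrt T ^+ 2 * \det T = 1.
Proof.
elim: n T => [|n ih] T pT; first by rewrite /= det_mx00 expr1n mulr1.
have pT' := @posC_dr 1 n T pT; have uT := posC_unit pT'.
have s0 : schur (T : 'M[C]_(1 + n)) != 0.
  by apply: contraTneq (Re_schur_gt0 (n := n) pT) => ->; rewrite ltxx.
rewrite [pivot_inv_sqrt _]/= (@det_schur n T uT) exprMn exprVn sqr_sqrtc.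
by rewrite mulrA divfK// ih.
Qed.

Definition mxpath n (T : 'M[C]_n) (s : R) : 'M[C]_n := (rc (1 - s))%:M + rc s *: T.

Lemma mxpath0 n (T : 'M[C]_n) : mxpath T 0 = 1%:M.
Proof. by rewrite /mxpath rmorph0 scale0r addr0 subr0 rmorph1. Qed.
Lemma mxpath1 n (T : 'M[C]_n) : mxpath T 1 = T.
Proof. by rewrite /mxpath subrr !rmorph0 rmorph1 scale1r ?raddf0 add0r. Qed.

Lemma posC_path n (T : 'M[C]_n) (s : R) : posC T -> 0 <= s <= 1 -> posC (mxpath T s).
Proof.
move=> [sT pos] /andP[s0 s1]; split.
  by rewrite /mxpath linearD /= linearZ /= tr_scalar_mx sT.
move=> z z0; rewrite /mxpath hformD -scalemx1 !hformZ hform1 Re_add !Re_mul /= !mul0r !subr0.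
have := pos z z0; have := norm2_gt0 z0.
set a := \sum_(i < n) _; set b := Re _ => a0 b0.
case: (ltP s 1) => h; last by rewrite (le_anti (introT andP (conj s1 h))) subrr mul0r add0r mul1r.
by rewrite ltr_pwDl ?mulr_gt0 ?subr_gt0// mulr_ge0// ltW.
Qed.

Lemma dr_path n (T : 'M[C]_(1 + n)) s :
  drsubmx (mxpath T s) = mxpath (drsubmx T) s.
Proof.
by apply/matrixP => i j; rewrite !mxE (inj_eq (@rshift_inj _ _)).
Qed.

Lemma ccont_det_path n (T : 'M[C]_n) : ccont (fun s => \det (mxpath T s)).
Proof.
rewrite /determinant; apply: ccont_sum => p; apply: ccontM; first exact: ccont_cst.
move=> s; apply: ccont_at_prod => i; rewrite /mxpath.
under eq_fun do rewrite !mxE.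
have c1 : continuous (fun s : R => 1 - s).
  by move=> t; apply: cvgB; [exact: cvg_cst|exact: cvg_id].
move: s; apply: ccontD; last first.
  apply: ccontM; [apply: ccont_real; exact: continuous_ident|exact: ccont_cst].
by case: (_ == _); rewrite /=; [under eq_fun do rewrite mulr1n; exact: ccont_real
   |under eq_fun do rewrite mulr0n; exact: ccont_cst].
Qed.

Lemma ccont_pivot_path n (T : 'M[C]_n) (s : R) : posC T -> 0 <= s <= 1 ->
  ccont_at (fun s => pivot_inv_sqrt (mxpath T s)) s.
Proof.
elim: n T => [|n ih] T pT s01; first exact: ccont_at_cst.
have pT' := @posC_dr 1 n T pT.
have pos := Re_schur_gt0 (@posC_path n.+1 T s pT s01).
rewrite /=; apply: ccont_atM.
  under eq_fun do rewrite (@dr_path n); exact: ih.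
have detE (t : R) : \det (mxpath (drsubmx (T : 'M[C]_(1 + n))) t) != 0 ->
    schur (mxpath T t : 'M[C]_(1 + n)) =
    \det (mxpath T t) / \det (mxpath (drsubmx (T : 'M[C]_(1 + n))) t).
  move=> d0; have u : drsubmx (mxpath T t : 'M[C]_(1 + n)) \in unitmx.
    by rewrite (@dr_path n) unitmxE unitfE.
  by rewrite (det_schur u) (@dr_path n) mulfK.
have d0 : \det (mxpath (drsubmx (T : 'M[C]_(1 + n))) s) != 0.
  by have := posC_unit (posC_path pT' s01); rewrite unitmxE unitfE.
apply: ccont_atV.
  by rewrite sqrtc_eq0; apply: contraTneq pos => ->; rewrite ltxx.
apply: ccont_at_sqrtc => //.
apply/ccont_atP => e e0.
have cq : ccont_at (fun t => \det (mxpath T t) / \det (mxpath (drsubmx (T : 'M[C]_(1 + n))) t)) s.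
  apply: ccont_atM; first exact: ccont_det_path.
  by apply: ccont_atV => //; exact: ccont_det_path.
have /ccont_atP/(_ _ e0) n1 := cq.
have /ccont_atP := @ccont_det_path _ (drsubmx (T : 'M[C]_(1 + n))) s.
have half : 0 < nc (\det (mxpath (drsubmx (T : 'M[C]_(1 + n))) s)) / 2.
  by rewrite divr_gt0// lt_neqAle nc_ge0 andbT eq_sym; apply: contra d0 => /eqP/nc0_eq0 ->.
move=> /(_ _ half) n2; near=> t.
have dt : \det (mxpath (drsubmx (T : 'M[C]_(1 + n))) t) != 0.
  have : nc (\det (mxpath (drsubmx (T : 'M[C]_(1 + n))) t) - \det (mxpath (drsubmx (T : 'M[C]_(1 + n))) s))
     <= nc (\det (mxpath (drsubmx (T : 'M[C]_(1 + n))) s)) / 2 by near: t.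
  by apply: contraTneq => ->; rewrite sub0r ncN -ltNge; lra.
rewrite (detE t dt) (detE s d0); near: t; exact: n1.
Unshelve. all: by end_near. Qed.

Lemma pivot_inv_sqrt1 n : pivot_inv_sqrt (1%:M : 'M[C]_n) = 1.
Proof.
elim: n => [//|n ih] /=.
rewrite /schur -[n.+1]/(1 + n)%N (scalar_mx_block 1 n 1).
rewrite block_mxKul block_mxKur block_mxKdr block_mxKdl mul0mx mul0mx subr0 ih.
by rewrite mxE eqxx mulr1n sqrtc1 invr1 mulr1.
Qed.

Lemma horner_char_poly n (T : 'M[C]_n) (x : C) : (char_poly T).[x] = \det (x%:M - T).
Proof.
rewrite /char_poly -horner_evalE -det_map_mx; congr determinant.
apply/matrixP => i j; rewrite !mxE /= /horner_eval. by case: (i == j); rewrite ?mulr1n ?mulr0n !hornerE.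

Qed.

Lemma char_poly_spectrum n (T : 'M[C]_n) :
  char_poly T = \prod_(z <- spectrum T) ('X - z%:P).
Proof.
rewrite /spectrum; case: (closed_field_poly_normal _) => /= r.
by rewrite (monicP (char_poly_monic T)) scale1r.
Qed.

Lemma size_spectrum n (T : 'M[C]_n) : size (spectrum T) = n.
Proof.
have := size_char_poly T; rewrite char_poly_spectrum size_prod_XsubC.
by move=> [].
Qed.

Lemma det_affine n (T : 'M[C]_n) (a b : C) :
  \det (a%:M + b *: T) = \prod_(z <- spectrum T) (a + b * z).
Proof.
have [->|b0] := eqVneq b 0.
  rewrite scale0r addr0 det_scalar; under eq_bigr do rewrite mul0r addr0.
  by rewrite big_const_seq count_predT size_spectrum iter_mulr_1.
have -> : a%:M + b *: T = - b *: ((- (a / b))%:M - T).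
  rewrite scalerBr scale_scalar_mx scaleNr opprK; congr (_%:M + _).
  by rewrite mulrNN mulrC divfK.
rewrite detZ -horner_char_poly char_poly_spectrum horner_prod -[X in _ ^+ X](size_spectrum T).
elim: (spectrum T) => [|z r ih]; first by rewrite !big_nil mulr1.
rewrite !big_cons -ih /= exprS hornerXsubC.
by move: (\prod_(_ <- r) _) ((- b) ^+ size r) => P Q; field; exact: b0.
Qed.

(** The form at an eigenvector is the eigenvalue times the squared norm. *)
Lemma spectrum_Re_gt0 n (T : 'M[C]_n) (z : C) : posC T -> z \in spectrum T -> 0 < Re z.
Proof.
move=> [sT pos] zs.
have : root (char_poly T) z by rewrite char_poly_spectrum root_prod_XsubC.
rewrite -eigenvalue_root_char => /eigenvalueP[v vT v0].
have w0 : v^T != 0 by apply: contra v0 => /eqP h; rewrite -[v]trmxK h trmx0.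
have := pos _ w0; have := norm2_gt0 w0.
have -> : hform T v^T = z * hform 1%:M v^T.
  have Tv : T *m v^T = z *: v^T by rewrite -{1}sT -trmx_mul vT linearZ.
  by rewrite /hform mulmx1 -mulmxA Tv -scalemxAr mxE.
by rewrite hform1 Re_mulr => a0; rewrite pmulr_lgt0.
Qed.

(** The determinant convention through eigenvalues agrees with the product of
    the pivots: both are continuous square roots of the inverse determinant
    along the segment from the identity to [T]. *)
Lemma pivot_det_inv_sqrt n (T : 'M[C]_n) : posC T -> pivot_inv_sqrt T = det_inv_sqrt T.
Proof.
move=> pT.
pose g (s : R) := \prod_(z <- spectrum T) (sqrtc (rc (1 - s) + rc s * z))^-1.
pose f (s : R) := pivot_inv_sqrt (mxpath T s).
have Re0 (s : R) z : 0 <= s <= 1 -> z \in spectrum T -> 0 < Re (rc (1 - s) + rc s * z).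
  move=> /andP[s0 s1] /(spectrum_Re_gt0 pT) z0; rewrite Re_add Re_mul /= mul0r subr0.
  case: (ltP s 1) => h; last first.
    by rewrite (le_anti (introT andP (conj s1 h))) subrr add0r mul1r.
  by rewrite ltr_pwDl ?subr_gt0// mulr_ge0// ltW.
have n0 (s : R) z : 0 <= s <= 1 -> z \in spectrum T -> sqrtc (rc (1 - s) + rc s * z) != 0.
  by move=> s01 /(Re0 s z s01) h; rewrite sqrtc_eq0; apply: contraTneq h => ->; rewrite ltxx.
suff : f 1 = g 1.
  rewrite /f /g mxpath1 => ->; apply: eq_bigr => z _.
  by rewrite subrr rmorph0 add0r rmorph1 mul1r.
apply: eq_sqrt_path.
- by move=> s s01; exact: ccont_pivot_path.
- move=> s s01.
  have H (r : seq C) : {subset r <= spectrum T} ->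
      ccont_at (fun s : R => \prod_(z <- r) (sqrtc (rc (1 - s) + rc s * z))^-1) s.
    elim: r => [_|z r ih rT].
      by under eq_fun do rewrite big_nil; exact: ccont_at_cst.
    have zT : z \in spectrum T by apply: rT; rewrite inE eqxx.
    under eq_fun do rewrite big_cons; apply: ccont_atM; last first.
      by apply: ih => y yr; apply: rT; rewrite inE yr orbT.
    apply: ccont_atV; first exact: n0.
    apply: ccont_at_sqrtc; first exact: Re0.
    have c1 : continuous (fun s : R => 1 - s).
      by move=> t; apply: cvgB; [exact: cvg_cst|exact: cvg_id].
    move: (s); apply: ccontD; first exact: ccont_real.
    by apply: ccontM; [apply: ccont_real; exact: continuous_ident|exact: ccont_cst].
  exact: H.
- move=> s s01; rewrite /g prodf_seq_neq0; apply/allP => z zs /=.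
  by rewrite invr_eq0 n0.
- move=> s s01.
  have pTs := posC_path pT s01.
  have d0 : \det (mxpath T s) != 0 by have := posC_unit pTs; rewrite unitmxE unitfE.
  apply: (mulIf d0); rewrite sqr_pivot// /mxpath det_affine /g -prodrXl -big_split /= big_seq.
  rewrite big1// => z zs; rewrite exprVn sqr_sqrtc mulVf//.
  by apply: contraTneq (Re0 s z s01 zs) => ->; rewrite ltxx.
- rewrite /f /g mxpath0 pivot_inv_sqrt1 big1// => z _.
  by rewrite subr0 rmorph0 mul0r addr0 rmorph1 sqrtc1 invr1.
Qed.

End PositiveRealPart.

(** * Gaussian integrals in several variables *)

Section GaussianLattice.
Variable R : realType.
Local Notation C := R[i].
Local Notation Re := complex.Re.
Local Notation Im := complex.Im.
Local Notation rc := (real_complex R).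

Definition dotc n (a b : 'cV[C]_n) : C := (a^T *m b) 0 0.

Lemma dotcE n (a b : 'cV[C]_n) : dotc a b = \sum_(i < n) a i 0 * b i 0.
Proof. by rewrite /dotc mxE; apply: eq_bigr => i _; rewrite mxE. Qed.
Lemma dotcC n (a b : 'cV[C]_n) : dotc a b = dotc b a.
Proof. by rewrite !dotcE; apply: eq_bigr => i _; rewrite mulrC. Qed.
Lemma dotcDr n (a b c : 'cV[C]_n) : dotc a (b + c) = dotc a b + dotc a c.
Proof. by rewrite /dotc mulmxDr mxE. Qed.
Lemma dotcDl n (a b c : 'cV[C]_n) : dotc (b + c) a = dotc b a + dotc c a.
Proof. by rewrite dotcC dotcDr !(dotcC a). Qed.
Lemma dotcZr n k (a b : 'cV[C]_n) : dotc a (k *: b) = k * dotc a b.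
Proof. by rewrite /dotc -scalemxAr mxE. Qed.
Lemma dotcZl n k (a b : 'cV[C]_n) : dotc (k *: a) b = k * dotc a b.
Proof. by rewrite dotcC dotcZr dotcC. Qed.
Lemma dotcNr n (a b : 'cV[C]_n) : dotc a (- b) = - dotc a b.
Proof. by rewrite -scaleN1r dotcZr mulN1r. Qed.
Lemma dotcNl n (a b : 'cV[C]_n) : dotc (- a) b = - dotc a b.
Proof. by rewrite dotcC dotcNr dotcC. Qed.
Lemma dotc_col m n (a c : 'cV[C]_m) (b d : 'cV[C]_n) :
  dotc (col_mx a b) (col_mx c d) = dotc a c + dotc b d.
Proof. by rewrite /dotc tr_col_mx mul_row_col mxE. Qed.
Lemma dotc_mul m n (T : 'M[C]_(m, n)) a b : dotc a (T *m b) = dotc (T^T *m a) b.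
Proof. by rewrite /dotc trmx_mul trmxK mulmxA. Qed.
Lemma dotc_sym n (T : 'M[C]_n) a b : T^T = T -> dotc a (T *m b) = dotc b (T *m a).
Proof. by move=> sT; rewrite dotc_mul sT dotcC. Qed.

Definition toC n (z : 'cV[R]_n) : 'cV[C]_n := map_mx rc z.

Lemma toC_col m n (x : 'cV[R]_m) (y : 'cV[R]_n) : toC (col_mx x y) = col_mx (toC x) (toC y).
Proof. exact: map_col_mx. Qed.
Lemma toCD n (x y : 'cV[R]_n) : toC (x + y) = toC x + toC y.
Proof. exact: map_mxD. Qed.
Lemma toCZ n k (x : 'cV[R]_n) : toC (k *: x) = rc k *: toC x.
Proof. exact: map_mxZ. Qed.

Definition gaussn n (T : 'M[C]_n) (u : 'cV[C]_n) (z : 'cV[R]_n) : C :=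
  cexp (- (2^-1 * dotc (toC z) (T *m toC z)) + dotc u (toC z)).

Lemma norm_entry n (x : 'cV[R]_n) i : `|x i 0| <= `|x|.
Proof.
by rewrite [leRHS]/Num.Def.normr /= mx_normrE; apply/bigmax_geP; right => /=; exists (i, 0).
Qed.

Lemma norm_le_entries n (x : 'cV[R]_n) (r : R) : 0 <= r ->
  (forall i, `|x i 0| <= r) -> `|x| <= r.
Proof.
move=> r0 h; rewrite [leLHS]/Num.Def.normr /= mx_normrE; apply/bigmax_leP; split=> //.
by move=> [i j] _ /=; rewrite (ord1 j).
Qed.

Lemma norm_col_mx_le m n (x : 'cV[R]_m) (y : 'cV[R]_n) (r : R) :
  `|x| <= r -> `|y| <= r -> `|col_mx x y| <= r.
Proof.
move=> xr yr; apply: norm_le_entries => [|i]; first exact: le_trans xr.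
by rewrite mxE; case: (fintype.split i) => a; apply: le_trans (norm_entry _ _) _.
Qed.

Lemma ccont_toC n i : ccont (fun z : 'cV[R]_n => toC z i 0).
Proof.
under eq_fun do rewrite mxE; apply: ccont_real.
exact: (@coord_continuous R n 1 i 0).
Qed.

Lemma ccont_dotc_mul n (T : 'M[C]_n) :
  ccont (fun z : 'cV[R]_n => dotc (toC z) (T *m toC z)).
Proof.
under eq_fun do rewrite dotcE; apply: ccont_sum => i.
under eq_fun do rewrite [X in _ * X]mxE; apply: ccontM; first exact: ccont_toC.
by apply: ccont_sum => j; apply: ccontM; [exact: ccont_cst|exact: ccont_toC].
Qed.

Lemma ccont_dotc n (u : 'cV[C]_n) : ccont (fun z : 'cV[R]_n => dotc u (toC z)).
Proof.
under eq_fun do rewrite dotcE; apply: ccont_sum => i.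
by apply: ccontM; [exact: ccont_cst|exact: ccont_toC].
Qed.

Lemma ccont_gaussn n (T : 'M[C]_n) u : ccont (gaussn T u).
Proof.
apply: ccont_cexp; apply: ccontD; last exact: ccont_dotc.
apply: ccontN; apply: ccontM; [exact: ccont_cst|exact: ccont_dotc_mul].
Qed.

Lemma nc_dotc_le n (u : 'cV[C]_n) : exists2 q : R, 0 <= q &
  forall z : 'cV[R]_n, nc (dotc u (toC z)) <= q * `|z|.
Proof.
exists (\sum_(i < n) nc (u i 0)) => [|z]; first by apply: sumr_ge0 => i _; exact: nc_ge0.
rewrite dotcE (le_trans (nc_sum _ _ _))// mulr_suml ler_sum// => i _.
by rewrite ncM mxE nc_real ler_wpM2l ?nc_ge0// norm_entry.
Qed.

Lemma dotc_hform n (T : 'M[C]_n) (z : 'cV[R]_n) :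
  dotc (toC z) (T *m toC z) = hform T (toC z).
Proof.
rewrite /hform /dotc mulmxA; congr (((_ : 'M[C]_(1, n)) *m _ *m _) 0 0).
by apply/matrixP => i j; rewrite !mxE conjc_real.
Qed.

(** The form has a positive minimum on the compact unit sphere. *)
Lemma posC_coercive n (T : 'M[C]_n) : posC T -> exists2 d : R, 0 < d &
  forall z : 'cV[R]_n, d * `|z| ^+ 2 <= Re (dotc (toC z) (T *m toC z)).
Proof.
move=> [sT pos].
pose f (v : 'rV[R]_n) : R := Re (dotc (toC v^T) (T *m toC v^T)).
have tr_cont : continuous (fun v : 'rV[R]_n => v^T).
  apply: continuous_mx => i j; under eq_fun do rewrite mxE.
  exact: (@coord_continuous R 1 n j i).
have cf : continuous f.
  exact: (ccontRe (ccont_comp tr_cont (@ccont_dotc_mul n T))).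
have norm_tr (z : 'cV[R]_n) : `|z^T| = `|z|.
  apply/eqP; rewrite eq_le; apply/andP; split.
    rewrite [leLHS]/Num.Def.normr /= mx_normrE; apply/bigmax_leP; split=> // -[i j] _ /=.
    by rewrite mxE (ord1 i) norm_entry.
  rewrite [leLHS]/Num.Def.normr /= mx_normrE; apply/bigmax_leP; split=> // -[i j] _ /=.
  rewrite (ord1 j) [leRHS]/Num.Def.normr /= mx_normrE; apply/bigmax_geP; right.
  by exists (0, i) => //=; rewrite mxE.
pose A := [set v : 'rV[R]_n | `|v| = 1].
have hom (k : R) (z : 'cV[R]_n) : Re (dotc (toC (k *: z)) (T *m toC (k *: z))) =
    k ^+ 2 * Re (dotc (toC z) (T *m toC z)).
  by rewrite toCZ -scalemxAr dotcZl dotcZr mulrA -rmorphM mulrC Re_mulr mulrC expr2.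
have scaled (z : 'cV[R]_n) : z != 0 -> A (`|z|^-1 *: z)^T.
  move=> z0; rewrite /A /= norm_tr normrZ normfV normr_id mulVf//.
  by rewrite normr_eq0.
have [[v0 Av0]|noA] := pselect (exists v, A v); last first.
  exists 1 => // z; have [->|z0] := eqVneq z 0; last by case: noA; exists (`|z|^-1 *: z)^T; exact: scaled.
  have /eqP : toC (0 : 'cV[R]_n) == 0 by apply/eqP; exact: map_mx0.
  by move=> ->; rewrite mulmx0 normr0 expr0n mulr0 dotcE big1// => i _; rewrite mxE mul0r.
have cA : compact A.
  apply: bounded_closed_compact.
    by exists 1; split=> // x x1 v /= ->; exact: ltW.
  have -> : A = (fun v : 'rV[R]_n => `|v|) @^-1` [set 1] by [].
  apply: closed_comp => [v _|]; first exact: norm_continuous.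
  exact: closed_eq.
have [v /set_mem Av vmin] := @compact_EVT_min _ R f A (ex_intro _ v0 Av0) cA (continuous_subspaceT cf).
have pf : 0 < f v.
  rewrite /f dotc_hform; apply: pos; apply/eqP => h.
  have v0' : v = 0.
    apply/rowP => i; rewrite mxE; apply: (@complexI R).
    by have := congr1 (fun M : 'cV[C]_n => M i 0) h; rewrite !mxE.
  move: Av; rewrite /A /= v0' normr0 => /eqP; by rewrite eq_sym oner_eq0.
exists (f v) => // z; have [->|z0] := eqVneq z 0.
  by rewrite normr0 expr0n mulr0 /toC map_mx0 mulmx0 dotcE big1// => i _; rewrite mxE mul0r.
have nz : 0 < `|z| by rewrite normr_gt0.
have := vmin (`|z|^-1 *: z)^T (mem_set (scaled z z0)).
rewrite /f trmxK hom exprVn mulrC ler_pdivlMr ?exprn_gt0//.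
Qed.

(** The negative quadratic exponent given by coercivity dominates any linear one. *)
Lemma gaussn_decay n (T : 'M[C]_n) u (rho : R) : posC T -> exists2 A : R, 0 <= A &
  forall z, nc (gaussn T u z) <= A * expR (- (rho * `|z|)).
Proof.
move=> pT; have [d d0 hd] := posC_coercive pT; have [q q0 hq] := nc_dotc_le u.
exists (expR ((q + rho) ^+ 2 / (4 * (d / 2)))); first exact: expR_ge0.
move=> z; rewrite nc_cexp -expRD ler_expR Re_add Re_opp.
have -> : Re (2^-1 * dotc (toC z) (T *m toC z)) = Re (dotc (toC z) (T *m toC z)) / 2.
  have -> : (2 : C)^-1 = rc 2^-1 by rewrite (rmorphV (real_complex R)) ?unitfE// rmorph_nat.
  by rewrite mulrC Re_mulr.
have := @sqr_sub_le R (d / 2) (q + rho) `|z|; rewrite divr_gt0// => /(_ isT).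
rewrite normr_id; have := hd z; have := hq z.
have := le_trans (ler_norm _) (Re_le_nc (dotc u (toC z))).
lra.
Qed.

Lemma majorant_lattice n :
  majorant (fun k : 'cV[int]_n => expR (- \sum_(i < n) `|(k i 0)%:~R : R|)).
Proof.
elim: n => [|n ih].
  split=> [k|]; first exact: expR_ge0.
  exists 1 => A; apply: (@le_trans _ _ (\sum_(i <- [fset (0 : 'cV[int]_0)]%fset) (1 : R))).
    apply: (@le_trans _ _ (\sum_(i <- A) 1)).
      by apply: ler_sum => i _; rewrite big_ord0 oppr0 expR0.
    have sA : (A `<=` [fset (0 : 'cV[int]_0)])%fset.
      by apply/fsubsetP => k _; rewrite inE; apply/eqP/matrixP => -[].
    by rewrite (sum_fsetD _ sA) lerDl sumr_ge0.
  by rewrite big_seq_fset1.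
have := majorant_inj (h := fun k : 'cV[int]_(1 + n) => (usubmx k 0 0, dsubmx k)) _ (majorant_prod (majorant_int R) ih).
move=> /(_ _)/wrap[|M].
  move=> x y [xu xd]; rewrite -[x]vsubmxK -[y]vsubmxK xd; congr col_mx.
  by apply/matrixP => i j; rewrite !ord1 xu.
apply: majorant_le M => k; rewrite expR_ge0 /= -expRD ler_expR -opprD lerN2.
rewrite big_ord_recl !mxE; apply: lerD.
  by rewrite le_eqVlt; apply/orP; left; apply/eqP; congr `|(k _ _)%:~R|; apply: val_inj.
apply: ler_sum => i _; rewrite !mxE le_eqVlt; apply/orP; left; apply/eqP.
by congr `|(k _ _)%:~R|; apply: val_inj.
Qed.

(** Decay at rate [n] in the sup norm gives decay at rate 1 in each of the [n]
    coordinates, which is summable over the lattice. *)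
Lemma lattice_shift_majorant n (g : 'cV[R]_n -> R) (A r : R) :
  (forall z, g z <= A * expR (- (n%:R * `|z|))) ->
  exists M : 'cV[int]_n -> R, majorant M /\
    forall k y, `|y| <= r -> g (y + (2 * pi) *: zvec R k) <= M k.
Proof.
move=> gA.
exists (fun k : 'cV[int]_n => `|A| * expR (n%:R * r) * expR (- \sum_(i < n) `|(k i 0)%:~R : R|)); split.
  by apply: majorantZ (majorant_lattice n); rewrite mulr_ge0 ?expR_ge0.
move=> k y yr; apply: (le_trans (gA _)); rewrite -[leRHS]mulrA.
apply: (@le_trans _ _ (`|A| * expR (- (n%:R * `|y + (2 * pi) *: zvec R k|)))).
  by rewrite ler_wpM2r ?expR_ge0 ?ler_norm.
rewrite ler_wpM2l// -expRD ler_expR.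
have h1 : \sum_(i < n) `|(k i 0)%:~R : R| <= n%:R * `|zvec R k|.
  rewrite -[X in X%:R * _](card_ord n) mulr_natl -sumr_const ler_sum// => i _.
  by have := norm_entry (zvec R k) i; rewrite mxE.
have h2 : `|zvec R k| <= `|y + (2 * pi) *: zvec R k| + r.
  apply: (@le_trans _ _ `|(2 * pi) *: zvec R k|).
    rewrite normrZ ler_peMl// ger0_norm ?mulr_ge0 ?pi_ge0//; have := @pi_ge2 R; lra.
  rewrite -{1}[(2 * pi) *: zvec R k](addKr y) addrC (le_trans (ler_normB _ _))//.
  by rewrite lerD2l.
have := ler_wpM2l (ler0n R n) h2; lra.
Qed.

Lemma continuous_addr n (c : 'cV[R]_n) : continuous (fun y : 'cV[R]_n => y + c).
Proof.
apply: continuous_mx => i j; under eq_fun do rewrite mxE.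
exact: (continuous_compose (@coord_continuous R n 1 i j) (@continuous_shift R (c i j))).
Qed.

Lemma gaussn_normal n (T : 'M[C]_n) u : posC T ->
  normal_family (fun (k : 'cV[int]_n) (y : 'cV[R]_n) => gaussn T u (y + (2 * pi) *: zvec R k)).
Proof.
move=> pT; split=> [k|r].
  exact: (ccont_comp (@continuous_addr _ _) (ccont_gaussn T u)).
have [A A0 hA] := gaussn_decay u n%:R pT.
exact: (@lattice_shift_majorant n (fun z => nc (gaussn T u z)) A r hA).
Qed.

Lemma gaussn_split n (T : 'M[C]_(1 + n)) (u : 'cV[C]_(1 + n)) (t : R) (z : 'cV[R]_n) :
  T^T = T ->
  gaussn T u (col_mx (const_mx t) z) =
  gauss1 (ulsubmx T 0 0) (usubmx u 0 0) t *
  gaussn (drsubmx T) (dsubmx u - rc t *: dlsubmx T) z.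
Proof.
move=> sT; rewrite /gaussn /gauss1 -cexpD; congr cexp.
rewrite toC_col -{1}[T]submxK mul_block_col dotc_col -{1}[u]vsubmxK dotc_col.
rewrite !dotcDr dotcDl dotcNl dotcZl.
set tc := toC (const_mx t); set zc := toC z.
have dot1 (a b : 'cV[C]_1) : dotc a b = a 0 0 * b 0 0 by rewrite dotcE big_ord1.
have tc00 : tc 0 0 = rc t by rewrite !mxE.
have -> : dotc tc (ursubmx T *m zc) = rc t * dotc (dlsubmx T) zc.
  by rewrite dot1 tc00 -[in ursubmx T]sT -trmx_dlsub.
have -> : dotc zc (dlsubmx T *m tc) = rc t * dotc (dlsubmx T) zc.
  rewrite dotcC /dotc trmx_mul -mulmxA mxE big_ord1; congr (_ * _).
  by rewrite mxE tc00.
have -> : dotc tc (ulsubmx T *m tc) = rc t * (ulsubmx T 0 0 * rc t).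
  by rewrite dot1 tc00 mxE big_ord1 tc00.
by rewrite dot1 tc00 expr2 rmorphM; field.
Qed.

Lemma csum_vecS n (M : 'cV[int]_(1 + n) -> R) (f : 'cV[int]_(1 + n) -> C) :
  majorant M -> (forall k, nc (f k) <= M k) ->
  csum f = csum (fun k : int => csum (fun l : 'cV[int]_n => f (col_mx (const_mx k) l))).
Proof.
move=> MM fM.
pose h (p : int * 'cV[int]_n) : 'cV[int]_(1 + n) := col_mx (const_mx p.1) p.2.
pose h' (k : 'cV[int]_(1 + n)) := (usubmx k 0 0, dsubmx k).
have hK : cancel h h' by move=> [a b]; rewrite /h /h' col_mxKu col_mxKd mxE.
have h'K : cancel h' h.
  move=> k; rewrite /h /h' /= -[RHS]vsubmxK; congr col_mx.
  by apply/matrixP => i j; rewrite !ord1 mxE.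
rewrite (csum_reindex hK h'K MM fM).
by rewrite (csum_fubini (majorant_inj (can_inj hK) MM) (fun p => fM (h p))).
Qed.

Lemma zvec_col m n (k : 'cV[int]_m) (l : 'cV[int]_n) :
  zvec R (col_mx k l) = col_mx (zvec R k) (zvec R l).
Proof. exact: map_col_mx. Qed.

Lemma mul_col11 n (a : 'cV[C]_n) (b : 'cV[C]_1) : a *m b = b 0 0 *: a.
Proof. by apply/matrixP => i j; rewrite !mxE big_ord1 !ord1 mulrC. Qed.

(** Integrate the last coordinates first: by induction the inner integral is a
    Gaussian in the first coordinate, whose quadratic coefficient is the Schur
    complement. *)
Theorem gaussian_lattice n (T : 'M[C]_n) (u v : 'cV[C]_n) : posC T -> T *m v = u ->
  csum (fun l : 'cV[int]_n => cbox (fun y => gaussn T u (y + (2 * pi) *: zvec R l))) =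
  rc (Num.sqrt (2 * pi) ^+ n) * pivot_inv_sqrt T * cexp (2^-1 * dotc u v).
Proof.
elim: n T u v => [|n ih] T u v pT Tv.
  rewrite expr0 rmorph1 /= mulr1 mul1r.
  have e0 (x y : 'cV[C]_0) : dotc x y = 0 by rewrite dotcE big_ord0.
  rewrite e0 mulr0 cexp0; apply: csum_unique => e e0'.
  exists [fset (0 : 'cV[int]_0)]%fset => A sA.
  have -> : A = [fset (0 : 'cV[int]_0)]%fset.
    apply/eqP; rewrite eqEfsubset sA andbT; apply/fsubsetP => k _.
    by rewrite inE; apply/eqP/matrixP => -[].
  rewrite big_seq_fset1 cbox0 /gaussn !e0 mulr0 oppr0 addr0 cexp0 subrr nc0; exact: ltW.
have [sT _] := pT; have pT' := @posC_dr R 1 n T pT.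
have uT := posC_unit pT'.
set T' := drsubmx (T : 'M[C]_(1 + n)) in pT' uT.
pose s := dlsubmx (T : 'M[C]_(1 + n)); pose u' := dsubmx (u : 'cV[C]_(1 + n)).
pose u0 := usubmx (u : 'cV[C]_(1 + n)) 0 0.
pose t0 := ulsubmx (T : 'M[C]_(1 + n)) 0 0.
pose p := invmx T' *m u'; pose w := invmx T' *m s.
have Tp : T' *m p = u' by rewrite mulKVmx.
have Tw : T' *m w = s by rewrite mulKVmx.
have sT' : T'^T = T' by case: pT'.
have upw : dotc u' w = dotc s p.
  by have := dotc_sym w p sT'; rewrite Tp Tw dotcC => ->; exact: dotcC.
have HL := bounded_functional_cint 0 (2 * pi : R).
pose G (k : int) (l : 'cV[int]_n) (t : R) : C :=
  cbox (fun y : 'cV[R]_n => gaussn T u (col_mx (const_mx t : 'cV[R]_1) y + (2 * pi) *: zvec R (col_mx (const_mx k : 'cV[int]_1) l))).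
have nf := @gaussn_normal n.+1 T u pT.
have [[M [MM hM]] _] := bf_csum (@bounded_functional_cbox R n.+1) nf.
rewrite (csum_vecS MM hM).
pose z (k : int) (t : R) := t + 2 * pi * k%:~R.
have shiftE (k : int) (l : 'cV[int]_n) (t : R) (y : 'cV[R]_n) :
    col_mx (const_mx t : 'cV[R]_1) y + (2 * pi) *: zvec R (col_mx (const_mx k : 'cV[int]_1) l) =
    col_mx (const_mx (z k t) : 'cV[R]_1) (y + (2 * pi) *: zvec R l).
  rewrite zvec_col scale_col_mx add_col_mx; congr col_mx.
  by apply/matrixP => i j; rewrite !mxE.
have normG k : normal_family (G k).
  case: nf => cf nf; split=> [l|r].
    apply: (@bf_param R _ _ (@bounded_functional_cbox R n) R
      (fun t y => gaussn T u (col_mx (const_mx t : 'cV[R]_1) y + (2 * pi) *: zvec R (col_mx (const_mx k : 'cV[int]_1) l)))).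
    exact: (ccont_comp (@continuous_cons_mx R n) (cf _)).
  have [B [c [cB c0 bd]]] := (@bounded_functional_cbox R n).2.
  have [rB [_ hrB]] := compact_bounded cB.
  have [N [NN hN]] := nf (Num.max r (rB + 1)).
  exists (fun l => c * N (col_mx (const_mx k : 'cV[int]_1) l)); split.
    apply: (majorantZ c0); apply: (majorant_inj _ NN) => x y h.
    by have := congr1 (fun v : 'cV[int]_(1 + n) => dsubmx v) h; rewrite !col_mxKd.
  move=> l t tr; apply: bd.
  - exact: (ccont_comp (continuous_col_mx (@continuous_cst 'cV[R]_n _ (const_mx t : 'cV[R]_1))
      (@continuous_ident _)) (cf _)).
  - exact: majorant_ge0 NN.
  - move=> y By; apply: hN.
    apply: (@norm_col_mx_le 1 n); rewrite le_max.
      apply/orP; left; apply: le_trans tr; apply: norm_le_entries => // a.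
      by rewrite mxE.
    by apply/orP; right; apply: hrB By; rewrite ltrDl.
transitivity (csum (fun k : int => cint 0 (2 * pi) (fun t => csum (fun l => G k l t)))).
  by congr csum; apply/funext => k; rewrite (bf_csum HL (normG k)).2.
(* The quadratic and linear coefficients of the Gaussian left after the inner
   integration, and the constant factor. *)
pose al := schur (T : 'M[C]_(1 + n)).
pose be := u0 - dotc s p.
pose K := rc (Num.sqrt (2 * pi) ^+ n) * pivot_inv_sqrt T' * cexp (2^-1 * dotc u' p).
have ur : ursubmx (T : 'M[C]_(1 + n)) = s^T by rewrite /s trmx_dlsub sT.
have alE : al = t0 - dotc s w.
  have sub00 (A B : 'M[C]_1) : (A - B) 0 0 = A 0 0 - B 0 0 by rewrite !mxE.
  by rewrite /al /schur sub00 ur -mulmxA.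
have alg0 (a b x c d e : C) : - (a / 2) * (x * x) + b * x +
    2^-1 * (c - x * d + (- (x * d) - - (x * (x * e)))) =
    2^-1 * c + (- ((a - e) / 2) * (x * x) + (b - d) * x) by field.
have inner k t : csum (fun l => G k l t) = K * gauss1 al be (z k t).
  transitivity (csum (fun l => gauss1 t0 u0 (z k t) *
      cbox (fun y => gaussn T' (u' - rc (z k t) *: s) (y + (2 * pi) *: zvec R l)))).
    congr csum; apply/funext => l.
    rewrite -(bfZ (@bounded_functional_cbox R n)); last first.
      exact: (ccont_comp (@continuous_addr _ _) (ccont_gaussn _ _)).
    by congr cbox; apply/funext => y; rewrite shiftE gaussn_split.
  have nf' := gaussn_normal (u' - rc (z k t) *: s) pT'.
  have [[N [NN hN]] _] := bf_csum (@bounded_functional_cbox R n) nf'.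
  rewrite (csumZ _ NN hN).
  rewrite (ih T' _ (p - rc (z k t) *: w) pT'); last first.
    by rewrite mulmxBr -scalemxAr Tp Tw.
  rewrite mulrCA /K -[RHS]mulrA; congr (_ * _).
  rewrite /gauss1 -!cexpD; congr cexp.
  rewrite dotcDl !dotcDr !dotcNl !dotcNr !dotcZl !dotcZr.
  rewrite upw alE /be expr2 rmorphM.
  exact: alg0.
transitivity (K * line (gauss1 al be)).
  have al0 : 0 < Re al by exact: (@Re_schur_gt0 R n T pT).
  have rg : rapid (gauss1 al be).
    have := rapid_gauss1 be 0 al0.
    by under eq_fun do rewrite expr0 rmorph1 mul1r.
  rewrite -lineZ// /line; congr csum; apply/funext => k; congr cint.
  by apply/funext => t; rewrite inner.
have al0 : 0 < Re al by exact: (@Re_schur_gt0 R n T pT).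
have aln0 : al != 0 by apply: contraTneq al0 => ->; rewrite ltxx.
pose v0 := usubmx (v : 'cV[C]_(1 + n)) 0 0; pose v' := dsubmx (v : 'cV[C]_(1 + n)).
have Tvb : u = col_mx
    (ulsubmx (T : 'M[C]_(1 + n)) *m usubmx (v : 'cV[C]_(1 + n)) + s^T *m v')
    (s *m usubmx (v : 'cV[C]_(1 + n)) + T' *m v').
  by rewrite -ur -mul_block_col (@submxK C 1 n 1 n) (@vsubmxK C 1 n 1).
have Tv2 : s *m usubmx (v : 'cV[C]_(1 + n)) + T' *m v' = u'.
  by rewrite /u' Tvb col_mxKd.
have Tv1 : t0 * v0 + dotc s v' = u0.
  by rewrite /u0 Tvb col_mxKu mxE [in RHS]mxE big_ord1.
have pE : p = v' + v0 *: w.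
  apply: (can_inj (mulKmx uT)); rewrite Tp mulmxDr -scalemxAr Tw -Tv2 addrC; congr (_ + _).
  exact: mul_col11.
have beE : be = al * v0.
  by rewrite /be -Tv1 pE dotcDr dotcZr alE; ring.
have -> : dotc u v = u0 * v0 + dotc u' v'.
  have e := @dotc_col 1 n (usubmx (u : 'cV[C]_(1 + n))) (usubmx (v : 'cV[C]_(1 + n)))
    (dsubmx (u : 'cV[C]_(1 + n))) (dsubmx (v : 'cV[C]_(1 + n))).
  rewrite !(@vsubmxK C 1 n 1) in e; rewrite [LHS]e; congr (_ + _).
  by rewrite dotcE big_ord1.
have upE : dotc u' p = dotc u' v' + v0 * dotc s p.
  by rewrite {1}pE dotcDr dotcZr; rewrite upw.
have u0E : u0 = be + dotc s p by rewrite /be subrK.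
have alg (x y a d : C) : a != 0 ->
    2^-1 * ((a * x + y) * x + d) = 2^-1 * (d + x * y) + (a * x) ^+ 2 / (2 * a).
  by move=> an0; field.
have e1 : rc (Num.sqrt (2 * pi) ^+ n.+1) = rc (Num.sqrt (2 * pi) ^+ n) * rc (Num.sqrt (2 * pi)).
  by rewrite exprSr rmorphM.
have e2 : pivot_inv_sqrt T = pivot_inv_sqrt T' * (sqrtc al)^-1 by [].
have e3 : 2^-1 * (u0 * v0 + dotc u' v') = 2^-1 * dotc u' p + be ^+ 2 / (2 * al).
  by rewrite upE u0E beE; exact: alg.
have e4 := gaussian_line be al0.
have perm_mul (x y d a b c : C) : x * y * d * (a * b * c) = x * a * (y * b) * (d * c) by ring.
by rewrite e4 e1 e2 e3 cexpD /K; exact: perm_mul.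
Qed.

End GaussianLattice.

(** * Characters and theta kernels *)

Section Characters.
Variable R : realType.
Local Notation C := R[i].
Local Notation Re := complex.Re.
Local Notation Im := complex.Im.
Local Notation rc := (real_complex R).

Lemma dotvDl n (x y z : 'cV[R]_n) : dotv (x + y) z = dotv x z + dotv y z.
Proof. by rewrite /dotv -big_split; apply: eq_bigr => i _; rewrite mxE mulrDl. Qed.
Lemma dotvC n (x y : 'cV[R]_n) : dotv x y = dotv y x.
Proof. by rewrite /dotv; apply: eq_bigr => i _; rewrite mulrC. Qed.
Lemma dotvDr n (x y z : 'cV[R]_n) : dotv z (x + y) = dotv z x + dotv z y.
Proof. by rewrite dotvC dotvDl !(dotvC z). Qed.
Lemma dotvZr n k (x y : 'cV[R]_n) : dotv x (k *: y) = k * dotv x y.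
Proof. by rewrite /dotv mulr_sumr; apply: eq_bigr => i _; rewrite mxE; ring. Qed.

Lemma dotv_col m n (a c : 'cV[R]_m) (b d : 'cV[R]_n) :
  dotv (col_mx a b) (col_mx c d) = dotv a c + dotv b d.
Proof.
rewrite /dotv big_split_ord /=; congr (_ + _); apply: eq_bigr => i _.
  by rewrite !col_mxEu.
by rewrite !col_mxEd.
Qed.

Lemma zvecD n (k l : 'cV[int]_n) : zvec R (k + l) = zvec R k + zvec R l.
Proof. exact: map_mxD. Qed.
Lemma zvec0 n : zvec R (0 : 'cV[int]_n) = 0.
Proof. exact: map_mx0. Qed.

Definition unit_phase (x : R) : C := cexp (0 +i* x)%C.

Lemma unit_phaseD x y : unit_phase (x + y) = unit_phase x * unit_phase y.
Proof. by rewrite /unit_phase -cexpD; congr cexp; apply: complexP => //=; rewrite addr0. Qed.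
Lemma unit_phase0 : unit_phase 0 = 1. Proof. exact: cexp0. Qed.
Lemma nc_unit_phase x : nc (unit_phase x) = 1.
Proof. by rewrite nc_cexp expR0. Qed.
Lemma ccont_unit_phase (T : topologicalType) (f : T -> R) :
  continuous f -> ccont (fun t => unit_phase (f t)).
Proof.
move=> cf; apply: ccont_cexp => t; split; [exact: cvg_cst|exact: cf].
Qed.
Lemma unit_phase_2pi (k : int) : unit_phase (2 * pi * k%:~R) = 1.
Proof.
have nat1 n : unit_phase (2 * pi * n%:R) = 1.
  elim: n => [|n ih]; first by rewrite mulr0 unit_phase0.
  rewrite -(addn1 n) natrD mulrDr mulr1 unit_phaseD ih mul1r.
  rewrite /unit_phase /cexp /= expR0 mulr_natl cos2pi sin2pi.
  by apply: complexP => /=; rewrite ?mulr1 ?mulr0.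
case: (intP k) => [|n|n]; first by rewrite mulr0 unit_phase0.
  by rewrite -pmulrn; exact: nat1.
apply: (mulIf (x := unit_phase (2 * pi * n.+1%:R))); first exact: cexp_neq0.
by rewrite -unit_phaseD -mulrDr nat1 mul1r intrN addNr mulr0 unit_phase0.
Qed.

Lemma echarDl n (k l : 'cV[int]_n) (xi : 'cV[R]_n) : echar (k + l) xi = echar k xi * echar l xi.
Proof. by rewrite /echar zvecD dotvDl; exact: unit_phaseD. Qed.
Lemma echarDr n (k : 'cV[int]_n) (xi eta : 'cV[R]_n) : echar k (xi + eta) = echar k xi * echar k eta.
Proof. by rewrite /echar dotvDr; exact: unit_phaseD. Qed.
Lemma echar0 n (xi : 'cV[R]_n) : echar 0 xi = 1.
Proof. by rewrite /echar zvec0 /dotv big1 ?cexp0// => i _; rewrite mxE mul0r. Qed.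
Lemma nc_echar n (k : 'cV[int]_n) (xi : 'cV[R]_n) : nc (echar k xi) = 1.
Proof. exact: nc_unit_phase. Qed.
Lemma echar_period n (k l : 'cV[int]_n) (xi : 'cV[R]_n) :
  echar k (xi + (2 * pi) *: zvec R l) = echar k xi.
Proof.
rewrite echarDr -[RHS]mulr1; congr (_ * _).
rewrite /echar dotvZr (_ : dotv _ _ = (\sum_(i < n) k i 0 * l i 0)%:~R).
  exact: unit_phase_2pi.
by rewrite /dotv rmorph_sum /=; apply: eq_bigr => i _; rewrite !mxE intrM.
Qed.

Lemma continuous_dotv n (x : 'cV[R]_n) : continuous (dotv x).
Proof.
have h : ccont (fun z => dotc (toC x) (toC z)) by exact: ccont_dotc.
have := ccontRe h; rewrite (_ : (fun y => Re _) = dotv x)//.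
apply/funext => z; rewrite dotcE Re_sum /dotv; apply: eq_bigr => i _.
by rewrite !mxE Re_mulr.
Qed.

Lemma ccont_echar n (k : 'cV[int]_n) : ccont (@echar R n k).
Proof. exact: ccont_unit_phase (@continuous_dotv n (zvec R k)). Qed.

Lemma cint_unit_phase (k : int) :
  cint 0 (2 * pi) (fun t => unit_phase (k%:~R * t)) = if k == 0 then rc (2 * pi) else 0.
Proof.
have tp : 0 < 2 * pi :> R by rewrite mulr_gt0 ?pi_gt0.
case: eqVneq => [->|k0].
  have -> : (fun t : R => unit_phase (0%:~R * t)) = fun=> 1.
    by apply/funext => t; rewrite mul0r unit_phase0.
  by rewrite cint_cst ?ltW// subr0 mulr1.
have cu : ccont (fun t : R => unit_phase (k%:~R * t)).
  by apply: ccont_unit_phase => t; apply: cvgMr; exact: cvg_id.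
pose q (t : R) : C := (0 +i* (k%:~R * t))%C.
have D t : cderive (fun t => cexp (q t)) t (1 : R) (q 1 * cexp (q t)).
  apply: (@cderive_gauss R R q (fun=> 0) (fun v _ => q v)) => h v u.
  rewrite mulr0 addr0 /q; apply: complexP; rewrite ?Re_add ?Im_add ?Re_mul ?Im_mul /=; first by ring.
  by rewrite /GRing.scale /=; ring.
have := cint_FTC tp (ccontM (ccont_cst _) cu) D.
rewrite (bfZ (bounded_functional_cint 0 (2 * pi)) _ cu).
have -> : cexp (q (2 * pi)) = 1.
  by rewrite /q mulrC; exact: unit_phase_2pi.
rewrite /q mulr0 cexp0 subrr => /eqP; rewrite mulf_eq0 => /orP[|/eqP//].
by rewrite mulr1 eq_complex /= eqxx /= intr_eq0 (negPf k0).
Qed.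

Lemma cbox_echar n (k : 'cV[int]_n) :
  cbox (@echar R n k) = if k == 0 then rc ((2 * pi) ^+ n) else 0.
Proof.
elim: n k => [|n ih] k.
  rewrite cbox0 (_ : k = 0) ?eqxx; last by apply/matrixP => -[].
  by rewrite echar0 expr0.
pose k0 := usubmx (k : 'cV[int]_(1 + n)) 0 0; pose k' := dsubmx (k : 'cV[int]_(1 + n)).
have eE t (v : 'cV[R]_n) : echar k (col_mx (const_mx t : 'cV[R]_1) v) =
    unit_phase (k0%:~R * t) * echar k' v.
  rewrite /echar -unit_phaseD; congr unit_phase.
  have := @dotv_col 1 n (zvec R (usubmx (k : 'cV[int]_(1 + n)))) (const_mx t) (zvec R k') v.
  rewrite -zvec_col (@vsubmxK _ 1 n 1) => e; rewrite [LHS]e; congr (_ + _).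
  by rewrite /dotv big_ord1 /k0 !mxE.
rewrite cboxS; under eq_fun => t.
  under eq_fun => v do rewrite eE.
  rewrite (bfZ (@bounded_functional_cbox R n) _ (@ccont_echar n k')) ih mulrC.
  over.
have cu : ccont (fun t : R => unit_phase (k0%:~R * t)).
  by apply: ccont_unit_phase => t; apply: cvgMr; exact: cvg_id.
rewrite (bfZ (bounded_functional_cint 0 (2 * pi)) _ cu) cint_unit_phase.
have -> : (k == 0) = (k0 == 0) && (k' == 0).
  apply/eqP/andP => [h|[/eqP h0 /eqP h']].
    split; apply/eqP; first by rewrite /k0 h !mxE.
    by apply/matrixP => i j; rewrite /k' h !mxE.
  rewrite -[k](@vsubmxK _ 1 n 1) -/k' h' (_ : usubmx _ = 0) ?col_mx0//.
  by apply/matrixP => i j; rewrite !ord1 [RHS]mxE.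
case: (k0 == 0); case: (k' == 0); rewrite ?mulr0 ?mul0r//.
by rewrite /= exprSr [RHS]rmorphM.
Qed.

End Characters.

Section Kernels.
Variable R : realType.
Local Notation C := R[i].
Local Notation Re := complex.Re.
Local Notation Im := complex.Im.
Local Notation rc := (real_complex R).
Local Notation V2 n := ('cV[R]_n * 'cV[R]_n)%type.

Definition kterm n m (S : 'M[C]_(m + n)) (kl : 'cV[int]_m * 'cV[int]_n)
    (p : V2 m * V2 n) : C :=
  cexp (bform S (p.1.1 + (2 * pi) *: zvec R kl.1) (p.2.1 + (2 * pi) *: zvec R kl.2))
    * echar kl.1 p.1.2 * echar (- kl.2) p.2.2.

Lemma cexp_bform m n (S : 'M[C]_(m + n)) x y :
  cexp (bform S x y) = gaussn (- S) 0 (col_mx x y).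
Proof.
rewrite /gaussn; congr cexp.
rewrite mulNmx dotcNr mulrN opprK (_ : dotc 0 _ = 0) ?addr0; last first.
  by rewrite dotcE big1// => i _; rewrite mxE mul0r.
by rewrite /bform /dotc /toC mulmxA.
Qed.

Lemma nc_kterm n m (S : 'M[C]_(m + n)) kl p :
  nc (kterm S kl p) = nc (gaussn (- S) 0 (col_mx p.1.1 p.2.1 + (2 * pi) *: zvec R (col_mx kl.1 kl.2))).
Proof.
rewrite /kterm ncM nc_echar mulr1 ncM nc_echar mulr1.
by rewrite cexp_bform zvec_col scale_col_mx add_col_mx.
Qed.

Lemma col_mx_pair_inj m n : injective (fun kl : 'cV[int]_m * 'cV[int]_n => col_mx kl.1 kl.2).
Proof. by move=> [a b] [c d] /= /eq_col_mx[-> ->]. Qed.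

Lemma norm_fst_le (X Y : normedModType R) (p : X * Y) : `|p.1| <= `|p|.
Proof. by rewrite [leRHS]prod_normE le_max lexx. Qed.
Lemma norm_snd_le (X Y : normedModType R) (p : X * Y) : `|p.2| <= `|p|.
Proof. by rewrite [leRHS]prod_normE le_max lexx orbT. Qed.

Lemma ccont_kterm n m (S : 'M[C]_(m + n)) kl : ccont (kterm S kl).
Proof.
have cf11 : continuous (fun p : V2 m * V2 n => p.1.1 : 'cV[R]_m).
  exact: (continuous_compose (@continuous_fst _ _) (@continuous_fst _ _)).
have cf21 : continuous (fun p : V2 m * V2 n => p.2.1 : 'cV[R]_n).
  exact: (continuous_compose (@continuous_snd _ _) (@continuous_fst _ _)).
have cf12 : continuous (fun p : V2 m * V2 n => p.1.2 : 'cV[R]_m).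
  exact: (continuous_compose (@continuous_fst _ _) (@continuous_snd _ _)).
have cf22 : continuous (fun p : V2 m * V2 n => p.2.2 : 'cV[R]_n).
  exact: (continuous_compose (@continuous_snd _ _) (@continuous_snd _ _)).
apply: ccontM; last exact: (ccont_comp cf22 (@ccont_echar R n _)).
apply: ccontM; last exact: (ccont_comp cf12 (@ccont_echar R m _)).
under eq_fun do rewrite cexp_bform.
have ca := continuous_compose cf11 (@continuous_addr R m ((2 * pi) *: zvec R kl.1)).
have cb := continuous_compose cf21 (@continuous_addr R n ((2 * pi) *: zvec R kl.2)).
exact: (ccont_comp (continuous_col_mx ca cb) (ccont_gaussn _ _)).
Qed.

Lemma kterm_normal n m (S : 'M[C]_(m + n)) : posC (- S) -> normal_family (kterm S).
Proof.
move=> pS; split=> [kl|r]; first exact: ccont_kterm.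
have [_ /(_ r)[M [MM hM]]] := gaussn_normal 0 pS.
exists (fun kl => M (col_mx kl.1 kl.2)); split.
  exact: (majorant_inj (@col_mx_pair_inj m n) MM).
move=> kl p pr; rewrite nc_kterm; apply: hM; apply: norm_col_mx_le.
  exact: le_trans (norm_fst_le _) (le_trans (norm_fst_le _) pr).
exact: le_trans (norm_fst_le _) (le_trans (norm_snd_le _) pr).
Qed.

Definition kernel n m (S : 'M[C]_(m + n)) (p : V2 m) (r : V2 n) : C :=
  Kkernel S p.1 p.2 r.1 r.2.

Lemma kernelE n m (S : 'M[C]_(m + n)) p r :
  kernel S p r = csum (fun kl => kterm S kl (p, r)).
Proof. by []. Qed.

Lemma ccont_kernel n m (S : 'M[C]_(m + n)) : posC (- S) ->
  ccont (fun q : V2 m * V2 n => kernel S q.1 q.2).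
Proof.
move=> pS; have := ccont_csum (kterm_normal pS).
rewrite (_ : (fun y => csum _) = fun q => kernel S q.1 q.2)//.
Qed.

Lemma normal_slicer (X Y : normedModType R) (I : choiceType) (f : I -> X * Y -> C) x :
  normal_family f -> normal_family (fun i y => f i (x, y)).
Proof.
move=> [cf nf]; split=> [i|r].
  exact: (ccont_comp (@continuous_pairr X Y x) (cf i)).
have [M [MM hM]] := nf (Num.max `|x| r); exists M; split=> // i y yr; apply: hM.
by rewrite prod_normE /= ge_max le_max lexx le_max yr orbT.
Qed.

Lemma normal_slicel (X Y : normedModType R) (I : choiceType) (f : I -> X * Y -> C) y :
  normal_family f -> normal_family (fun i x => f i (x, y)).
Proof.
move=> [cf nf]; split=> [i|r].
  exact: (ccont_comp (@continuous_pairl X Y y) (cf i)).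
have [M [MM hM]] := nf (Num.max `|y| r); exists M; split=> // i x xr; apply: hM.
by rewrite prod_normE /= ge_max le_max xr orbT le_max lexx.
Qed.

Lemma normal_prod (Y : normedModType R) (I J : choiceType) (f : I -> Y -> C) (g : J -> Y -> C) :
  normal_family f -> normal_family g ->
  normal_family (fun (p : I * J) y => f p.1 y * g p.2 y).
Proof.
move=> [cf nf] [cg ng]; split=> [p|r]; first exact: ccontM.
have [M [MM hM]] := nf r; have [N [NN hN]] := ng r.
exists (fun p => M p.1 * N p.2); split; first exact: majorant_prod.
by move=> p y yr; rewrite ncM ler_pM ?nc_ge0 ?hM ?hN.
Qed.

End Kernels.

(** * Composition of theta kernels *)

Section Composition.
Variable R : realType.
Local Notation C := R[i].
Local Notation Re := complex.Re.
Local Notation Im := complex.Im.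
Local Notation rc := (real_complex R).
Local Notation V2 n := ('cV[R]_n * 'cV[R]_n)%type.

Lemma posC_ul m n (T : 'M[C]_(m + n)) : posC T -> posC (ulsubmx T).
Proof.
move=> [sT pos]; split; first by rewrite trmx_ulsub sT.
move=> z z0.
have : 0 < Re (hform T (col_mx z 0)).
  apply: pos; apply: contra z0 => /eqP h.
  by rewrite -(col_mxKu z (0 : 'cV_n)) h linear0.
rewrite /hform map_col_mx tr_col_mx -{1}[T]submxK mul_row_block mul_row_col.
by rewrite map_mx0 trmx0 mulmx0 !mul0mx !addr0.
Qed.

Lemma posCD n (S T : 'M[C]_n) : posC S -> posC T -> posC (S + T).
Proof.
move=> [sS pS] [sT pT]; split; first by rewrite linearD /= sS sT.
by move=> z z0; rewrite hformD Re_add addr_gt0 ?pS ?pT.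
Qed.

Lemma hform_col m n (S : 'M[C]_(m + n)) (a c : 'cV[C]_m) (b d : 'cV[C]_n) :
  S *m col_mx a b = col_mx c d ->
  hform S (col_mx a b) = dotc (map_mx conjc a) c + dotc (map_mx conjc b) d.
Proof.
move=> e; rewrite /hform -mulmxA e map_col_mx; exact: dotc_col.
Qed.

Lemma bformE m n (S : 'M[C]_(m + n)) (x : 'cV[R]_m) (y : 'cV[R]_n) c d :
  S *m col_mx (toC x) (toC y) = col_mx c d ->
  bform S x y = 2^-1 * (dotc (toC x) c + dotc (toC y) d).
Proof.
move=> e; rewrite /bform map_col_mx -mulmxA e; congr (_ * _); exact: dotc_col.
Qed.

Section Matrices.
Variables (m q n : nat).
Variables (A : 'M[C]_m) (B : 'M[C]_(m, q)) (D K : 'M[C]_q) (L : 'M[C]_(q, n)) (M : 'M[C]_n).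
Let S1 : 'M[C]_(m + q) := block_mx A B B^T D.
Let S2 : 'M[C]_(q + n) := block_mx K L L^T M.
Let T := - D - K.

(** The Potapov transform of the composite, by [is_potapov_comp] below; it arises
    from eliminating the intermediate vector. *)
Definition comp_mx : 'M[C]_(m + n) :=
  block_mx (A + B *m invmx T *m B^T) (B *m invmx T *m L)
           (L^T *m invmx T *m B^T) (M + L^T *m invmx T *m L).

Lemma comp_mx_mul (x : 'cV[C]_m) (y : 'cV[C]_n) (w : 'cV[C]_q) :
  w = invmx T *m (B^T *m x + L *m y) ->
  comp_mx *m col_mx x y = col_mx (A *m x + B *m w) (L^T *m w + M *m y).
Proof.
move=> ->; rewrite mul_block_col !mulmxDl !mulmxDr !mulmxA; congr col_mx.
  by rewrite addrA.
by rewrite -[RHS]addrA (addrC (M *m y)).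
Qed.

Hypotheses (p1 : posC (- S1)) (p2 : posC (- S2)).

Lemma posC_T : posC T.
Proof.
have := posCD (posC_dr p1) (posC_ul p2).
by rewrite /S1 /S2 !opp_block_mx block_mxKdr block_mxKul.
Qed.

Lemma blocks1_sym : A^T = A /\ D^T = D.
Proof.
have [e _] := p1; have {}e : S1^T = S1 by apply: oppr_inj; rewrite -linearN.
by move: e; rewrite /S1 tr_block_mx => /eq_block_mx[].
Qed.
Lemma blocks2_sym : K^T = K /\ M^T = M.
Proof.
have [e _] := p2; have {}e : S2^T = S2 by apply: oppr_inj; rewrite -linearN.
by move: e; rewrite /S2 tr_block_mx => /eq_block_mx[].
Qed.

Lemma trmx_inv_T : (invmx T)^T = invmx T.
Proof. by case: posC_T => sT _; rewrite trmx_inv sT. Qed.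

Lemma comp_mx_sym : comp_mx^T = comp_mx.
Proof.
have [sA sD] := blocks1_sym; have [sK sM] := blocks2_sym.
rewrite /comp_mx tr_block_mx; congr block_mx.
- by rewrite linearD /= sA !trmx_mul trmxK trmx_inv_T mulmxA.
- by rewrite !trmx_mul trmxK trmx_inv_T trmxK mulmxA.
- by rewrite !trmx_mul trmx_inv_T mulmxA.
- by rewrite linearD /= sM !trmx_mul trmxK trmx_inv_T mulmxA.
Qed.

(** The vector [w] is the critical point, in the inner variable, of the sum of the
    two quadratic forms. *)
Lemma T_saddle (x : 'cV[C]_m) (y : 'cV[C]_n) (w : 'cV[C]_q) : w = invmx T *m (B^T *m x + L *m y) ->
  B^T *m x + D *m w = - (K *m w + L *m y).
Proof.
move=> we; have : T *m w = B^T *m x + L *m y by rewrite we mulKVmx// posC_unit//; exact: posC_T.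
move=> e; apply/eqP; rewrite -subr_eq0 opprK.
rewrite (addrC (K *m w)) addrACA -e.
by rewrite -!mulmxDl /T (_ : - D - K + (D + K) = 0) ?mul0mx// -opprD addNr.
Qed.

(** The form of the composite is the sum of the two forms at the intermediate
    vector that makes the inner components match. *)
Lemma posC_comp : posC (- comp_mx).
Proof.
split; first by rewrite linearN /= comp_mx_sym.
move=> z; rewrite -[z]vsubmxK; set x := usubmx z; set y := dsubmx z => z0.
pose w := invmx T *m (B^T *m x + L *m y).
have e := comp_mx_mul (erefl w).
have sad := T_saddle (erefl w).
have e1 : S1 *m col_mx x w = col_mx (A *m x + B *m w) (- (K *m w + L *m y)).
  by rewrite /S1 mul_block_col sad.
have e2 : S2 *m col_mx w y = col_mx (K *m w + L *m y) (L^T *m w + M *m y).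
  by rewrite /S2 mul_block_col.
have : hform (- comp_mx) (col_mx x y) = hform (- S1) (col_mx x w) + hform (- S2) (col_mx w y).
  by rewrite !hformN (hform_col e) (hform_col e1) (hform_col e2) dotcNr; ring.
move=> ->; rewrite Re_add.
have nn N (U : 'M[C]_N) v : posC U -> 0 <= Re (hform U v).
  move=> [_ pU]; have [->|v0] := eqVneq v 0; last by rewrite ltW// pU.
  by rewrite /hform mulmx0 mxE.
have [x0|x0] := eqVneq x 0; last first.
  rewrite ltr_pwDl ?nn//; apply: p1.2; apply: contra x0 => /eqP h.
  by rewrite -(col_mxKu x w) h linear0.
rewrite ltr_wpDl ?nn//; apply: p2.2; apply: contra z0 => /eqP h.
by rewrite x0 -(col_mxKd w y) h linear0 col_mx0.
Qed.

(** As a function of the inner variable the product is a Gaussian with matrix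
    [- D - K]; this is where the determinant of the theorem comes from. *)
Lemma kernel_integrand (x : 'cV[R]_m) (y : 'cV[R]_n) (z : 'cV[R]_q) :
  cexp (bform S1 x z) * cexp (bform S2 z y) =
  cexp (2^-1 * (dotc (toC x) (A *m toC x) + dotc (toC y) (M *m toC y))) *
  gaussn T (B^T *m toC x + L *m toC y) z.
Proof.
rewrite /gaussn -!cexpD; congr cexp.
rewrite (bformE (mul_block_col A B B^T D (toC x) (toC z))).
rewrite (bformE (mul_block_col K L L^T M (toC z) (toC y))).
rewrite !dotcDr !dotcDl /T mulmxBl mulNmx !dotcDr !dotcNr.
have -> : dotc (toC x) (B *m toC z) = dotc (B^T *m toC x) (toC z) by rewrite dotc_mul.
rewrite (dotcC (toC z) (B^T *m _)) (dotcC (toC z) (L *m _)).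
have -> : dotc (toC y) (L^T *m toC z) = dotc (L *m toC y) (toC z) by rewrite dotc_mul trmxK.
by field.
Qed.

Lemma kernel_result (x : 'cV[R]_m) (y : 'cV[R]_n) :
  let u := B^T *m toC x + L *m toC y in
  2^-1 * (dotc (toC x) (A *m toC x) + dotc (toC y) (M *m toC y)) +
    2^-1 * dotc u (invmx T *m u) = bform comp_mx x y.
Proof.
move=> u; rewrite (bformE (comp_mx_mul (erefl (invmx T *m u)))).
set v := invmx T *m u; rewrite !dotcDr {1}/u dotcDl.
have -> : dotc (toC x) (B *m v) = dotc (B^T *m toC x) v by rewrite dotc_mul.
have -> : dotc (toC y) (L^T *m v) = dotc (L *m toC y) v by rewrite dotc_mul trmxK.
by field.
Qed.

(** The first factor is the volume of the dual torus, the others come from the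
    Gaussian integral in the inner variable. *)
Definition comp_const : C :=
  rc ((2 * pi) ^+ q) * (rc (Num.sqrt (2 * pi) ^+ q) * pivot_inv_sqrt T).

(** Integration over the dual variable leaves only equal inner lattice vectors;
    summing over them turns the integral over a period into one over the whole
    space, a Gaussian. *)
Lemma kernel_comp (p : V2 m) (r : V2 n) :
  torus (fun w : V2 q => kernel S1 p w * kernel S2 w r) =
  comp_const * kernel comp_mx p r.
Proof.
have pT := posC_T; have uT := posC_unit pT.
pose f1 (kl : 'cV[int]_m * 'cV[int]_q) (w : V2 q) := kterm S1 kl (p, w).
pose f2 (lj : 'cV[int]_q * 'cV[int]_n) (w : V2 q) := kterm S2 lj (w, r).
have nf1 : normal_family f1 := normal_slicer p (kterm_normal p1).
have nf2 : normal_family f2 := normal_slicel r (kterm_normal p2).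
have nf12 := normal_prod nf1 nf2.
have [[N [NN hN]] eN] := bf_csum (@bounded_functional_torus R q) nf12.
transitivity (torus (fun w => csum (fun pr => f1 pr.1 w * f2 pr.2 w))).
  congr torus; apply/funext => w.
  have [M1 [MM1 hM1]] := nf1.2 `|w|; have [M2 [MM2 hM2]] := nf2.2 `|w|.
  by rewrite -(csumM MM1 MM2 (fun i => hM1 i w (lexx _)) (fun i => hM2 i w (lexx _))).
rewrite eN.
pose h (a : ('cV[int]_m * 'cV[int]_n) * ('cV[int]_q * 'cV[int]_q)) :=
  ((a.1.1, a.2.1), (a.2.2, a.1.2)).
pose h' (a : ('cV[int]_m * 'cV[int]_q) * ('cV[int]_q * 'cV[int]_n)) :=
  ((a.1.1, a.2.2), (a.1.2, a.2.1)).
have hK : cancel h h' by move=> [[? ?] [? ?]].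
have h'K : cancel h' h by move=> [[? ?] [? ?]].
rewrite (csum_reindex hK h'K NN hN).
have NN1 := majorant_inj (can_inj hK) NN.
rewrite (csum_fubini NN1 (fun a => hN (h a))).
have nf3 := normal_slicer p (kterm_normal posC_comp).
have [M3 [MM3 hM3]] := nf3.2 `|r|.
rewrite kernelE -(csumZ comp_const MM3 (fun i => hM3 i r (lexx _))).
congr csum; apply/funext => -[k j].
rewrite (csum_fubini (majorantM1 (k, j) NN1) (fun a => hN (h ((k, j), a)))).
pose e := echar k p.2 * echar (- j) r.2.
pose x := p.1 + (2 * pi) *: zvec R k; pose y := r.1 + (2 * pi) *: zvec R j.
pose b (l l' : 'cV[int]_q) (w : 'cV[R]_q) := cexp (bform S1 x (w + (2 * pi) *: zvec R l)) *
  cexp (bform S2 (w + (2 * pi) *: zvec R l') y).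
have cb l l' : ccont (b l l').
  apply: ccontM; under eq_fun do rewrite cexp_bform.
    exact: (ccont_comp (continuous_col_mx (@continuous_cst _ _ x)
      (@continuous_addr R q ((2 * pi) *: zvec R l))) (ccont_gaussn _ _)).
  exact: (ccont_comp (continuous_col_mx (@continuous_addr R q ((2 * pi) *: zvec R l'))
    (@continuous_cst _ _ y)) (ccont_gaussn _ _)).
have tE l l' : torus (fun w => f1 (k, l) w * f2 (l', j) w) =
    (if l' - l == 0 then rc ((2 * pi) ^+ q) else 0) * e * cbox (b l l').
  rewrite torusE -(bfZ (@bounded_functional_cbox R q) _ (cb l l')).
  congr cbox; apply/funext => w.
  rewrite mulrAC -mulrA -cbox_echar mulrC.
  rewrite -(bfZ (@bounded_functional_cbox R q) _ (@ccont_echar R q _)).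
  congr cbox; apply/funext => o.
  rewrite /f1 /f2 /kterm /b /e echarDl /= -/x -/y.
  move: (cexp _) (cexp _) => c1 c2.
  by ring.
have nfG := gaussn_normal (B^T *m toC x + L *m toC y) pT.
have [[MG [MMG hMG]] _] := bf_csum (@bounded_functional_cbox R q) nfG.
pose c0 := cexp (2^-1 * (dotc (toC x) (A *m toC x) + dotc (toC y) (M *m toC y))).
transitivity (csum (fun l => (rc ((2 * pi) ^+ q) * e * c0) *
    cbox (fun w => gaussn T (B^T *m toC x + L *m toC y) (w + (2 * pi) *: zvec R l)))).
  congr csum; apply/funext => l.
  rewrite (csum_eq1 (a := l)) => [|l' l'l]; last first.
    by rewrite tE subr_eq0 (negPf l'l) !mul0r.
  rewrite tE subrr eqxx -[RHS]mulrA; congr (_ * _).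
  rewrite -(bfZ (@bounded_functional_cbox R q)); last exact: nfG.1.
  by congr cbox; apply/funext => w; rewrite /b kernel_integrand.
rewrite (csumZ _ MMG hMG) (gaussian_lattice pT (mulKVmx uT _)).
rewrite /comp_const /kterm -[(p, r).1]/p -[(p, r).2]/r -[(k, j).1]/k -[(k, j).2]/j -/x -/y.
have -> : cexp (bform comp_mx x y) = c0 * cexp (2^-1 * dotc (B^T *m toC x + L *m toC y)
    (invmx T *m (B^T *m toC x + L *m toC y))).
  by rewrite -cexpD kernel_result.
have alg (a1 a2 a3 a4 a5 a6 a7 : C) :
  a1 * (a2 * a3) * a4 * (a5 * a6 * a7) = a1 * (a5 * a6) * (a4 * a7 * a2 * a3) by ring.
exact: alg.
Qed.

End Matrices.

(** With [Lf] the integral over a torus, this puts the function on which an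
    operator acts into the functional, so that the theta series remains as the
    only family of functions. *)
Lemma bounded_functional_weight (Y : topologicalType) (Lf : (Y -> C) -> C) (g : Y -> C) :
  bounded_functional Lf -> ccont g -> bounded_functional (fun f => Lf (fun y => f y * g y)).
Proof.
move=> [lin [B [c [cB c0 bd]]]] cg; split=> [a f1 f2 c1 c2|].
  rewrite -(lin a (fun y => f1 y * g y) (fun y => f2 y * g y)); try exact: ccontM.
  by congr Lf; apply/funext => y; ring.
have [G hG] : exists G : R, forall y, B y -> nc (g y) <= G.
  have cn : continuous (fun y => nc (g y)).
    have -> : (fun y => nc (g y)) = fun y => Num.sqrt (Re (g y) ^+ 2 + Im (g y) ^+ 2).
      by apply/funext => y; rewrite ncE.
    move=> y; have [gr gi] := cg y.
    apply: (@cvg_sqrt R _ (fun t => Re (g t) ^+ 2 + Im (g t) ^+ 2)).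
    by apply: cvgD; apply: cvgM.
  have := @continuous_compact _ _ _ B (continuous_subspaceT cn) cB.
  move=> /compact_bounded[r [_ hr]]; exists (r + 1) => y By.
  have := hr (r + 1) _ (nc (g y)); rewrite /= ltrDl => /(_ ltr01) h.
  by apply: (le_trans (ler_norm _)); apply: h; exists y.
exists B, (c * `|G|); split=> //; first by rewrite mulr_ge0.
move=> f e cf e0 fe; rewrite -mulrA; apply: bd.
- exact: ccontM.
- by rewrite mulr_ge0.
- move=> y By; rewrite ncM mulrC ler_pM ?nc_ge0 ?fe//.
  exact: le_trans (hG y By) (ler_norm _).
Qed.

Lemma Gspace_ccont n (g : V2 n -> C) : Gspace g -> ccont g.
Proof.
by move=> [sg _ _] x; have [cr ci] := sg 0; split; [apply: (Ck_cont cr)|apply: (Ck_cont ci)].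
Qed.

Definition Qconst m n : C := rc (((2 * pi) `^ (3 * (n + m)%:R / 4))^-1).

Lemma QopE n m (S : 'M[C]_(m + n)) (g : V2 n -> C) (p : V2 m) :
  Qop n m S g p = Qconst m n * torus (fun s => kernel S p s * g s).
Proof. by []. Qed.

(** The powers of [2 pi] produced by the composition of kernels add up to
    [3 q / 2], which explains the exponent [3 / 4] in the normalization. *)
Lemma Qconst_mul m q n :
  Qconst m q * Qconst q n * (rc ((2 * pi) ^+ q) * rc (Num.sqrt (2 * pi) ^+ q)) = Qconst m n.
Proof.
have tp : 0 < 2 * pi :> R by rewrite mulr_gt0 ?pi_gt0.
have tp0 : 2 * pi != 0 :> R by rewrite gt_eqF.
rewrite /Qconst -!(rmorphM rc); congr (rc _).
rewrite -(powR12_sqrt (ltW tp)) -!powR_mulrn ?powR_ge0 ?(ltW tp)// -!powRN -powRrM.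
rewrite -!powRD ?tp0 ?implybT//; congr (_ `^ _).
by rewrite !natrD; field.
Qed.

(** After an exchange of the order of integration the inner integral is the
    composed kernel. *)
Lemma Qop_comp m q n (A : 'M[C]_m) (B : 'M[C]_(m, q)) (D K : 'M[C]_q)
    (L : 'M[C]_(q, n)) (M : 'M[C]_n) (g : V2 n -> C) :
  posC (- block_mx A B B^T D) -> posC (- block_mx K L L^T M) -> ccont g ->
  Qop q m (block_mx A B B^T D) (Qop n q (block_mx K L L^T M) g) =
  (fun p => det_inv_sqrt (- D - K) * Qop n m (comp_mx A B D K L M) g p).
Proof.
move=> p1 p2 cg; apply/funext => p; rewrite !QopE.
set S1 := block_mx A B B^T D; set S2 := block_mx K L L^T M.
have HT k := @bounded_functional_torus R k.
have ck1 : ccont (fun w => kernel S1 p w) := ccont_slicer p (ccont_kernel p1).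
have ck2 := ccont_kernel p2.
have cgs : ccont (fun q0 : V2 q * V2 n => g q0.2) by exact: (ccont_comp (@continuous_snd _ _) cg).
have cF : ccont (fun q0 : V2 q * V2 n => kernel S2 q0.1 q0.2 * g q0.2) by exact: ccontM.
have cF1 : ccont (fun q0 : V2 q * V2 n => kernel S1 p q0.1 * (kernel S2 q0.1 q0.2 * g q0.2)).
  by apply: ccontM cF; exact: (ccont_comp (@continuous_fst _ _) ck1).
transitivity (Qconst m q * Qconst q n * torus (fun w => torus (fun s =>
    kernel S1 p w * (kernel S2 w s * g s)))).
  rewrite -mulrA; congr (_ * _); rewrite -(bfZ (HT q)); last exact: (bf_param (HT n) cF1).
  have cw w : ccont (fun s => kernel S2 w s * g s).
    exact: (@ccont_slicer R _ _ (fun w s => kernel S2 w s * g s) w cF).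
  congr torus; apply/funext => w; rewrite QopE mulrCA; congr (_ * _).
  by rewrite (bfZ (HT n) _ (cw w)).
rewrite (commuting_torus (HT n) cF1).
transitivity (Qconst m q * Qconst q n * torus (fun s => comp_const D K * (kernel (comp_mx A B D K L M) p s * g s))).
  congr (_ * _); congr torus; apply/funext => s.
  rewrite mulrA -(kernel_comp p1 p2) mulrC -(bfZ (HT q)); last first.
    by apply: ccontM ck1 _; exact: (ccont_slicel s ck2).
  by congr torus; apply/funext => w; ring.
have ck3 : ccont (fun s => kernel (comp_mx A B D K L M) p s).
  exact: ccont_slicer p (ccont_kernel (posC_comp p1 p2)).
rewrite (bfZ (HT n)); last exact: ccontM.
rewrite -(pivot_det_inv_sqrt (posC_T p1 p2)) -(Qconst_mul m q n) /comp_const.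
have alg (a b c d e f : C) : a * b * (c * (d * e) * f) = e * (a * b * (c * d) * f) by ring.
exact: alg.
Qed.

End Composition.

(** * The operators on quasi-periodic functions *)

Section Invariance.
Variable R : realType.
Local Notation C := R[i].
Local Notation Re := complex.Re.
Local Notation Im := complex.Im.
Local Notation rc := (real_complex R).
Local Notation V2 n := ('cV[R]_n * 'cV[R]_n)%type.

Lemma nc_dotc_mul_le N (S : 'M[C]_N) : exists2 q : R, 0 <= q &
  forall a b : 'cV[R]_N, nc (dotc (toC a) (S *m toC b)) <= q * (`|a| * `|b|).
Proof.
exists (\sum_(i < N) \sum_(j < N) nc (S i j)) => [|a b].
  by apply: sumr_ge0 => i _; apply: sumr_ge0 => j _; exact: nc_ge0.
rewrite dotcE (le_trans (nc_sum _ _ _))// mulr_suml ler_sum// => i _.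
rewrite ncM !mxE nc_real mulrCA ler_pM ?nc_ge0 ?norm_entry//.
rewrite (le_trans (nc_sum _ _ _))// mulr_suml ler_sum// => j _.
by rewrite ncM mxE nc_real ler_wpM2l ?nc_ge0 ?norm_entry.
Qed.

Lemma dotv_le n (k x : 'cV[R]_n) : `|dotv k x| <= n%:R * (`|k| * `|x|).
Proof.
rewrite /dotv (le_trans (ler_norm_sum _ _ _))//.
apply: (@le_trans _ _ (\sum_(i < n) `|k| * `|x|)).
  by apply: ler_sum => i _; rewrite normrM ler_pM ?norm_entry.
by rewrite sumr_const card_ord mulr_natl.
Qed.

Section Fixed.
Variables (m n : nat) (S : 'M[C]_(m + n)).
Hypothesis pS : posC (- S).

Lemma S_sym : S^T = S.
Proof. by case: pS => e _; apply: oppr_inj; rewrite -linearN. Qed.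

Let quad (z : 'cV[R]_(m + n)) : C := 2^-1 * dotc (toC z) (S *m toC z).

Definition lattice_point (kl : 'cV[int]_m * 'cV[int]_n) (y : V2 n) : 'cV[R]_(m + n) :=
  col_mx ((2 * pi) *: zvec R kl.1) (y.1 + (2 * pi) *: zvec R kl.2).

Definition frequency kl (y : V2 n) (u : V2 m) : C :=
  dotc (toC (col_mx u.1 (0 : 'cV[R]_n))) (S *m toC (lattice_point kl y)) +
  (0 +i* dotv (zvec R kl.1) u.2)%C.

Definition amplitude kl (y : V2 n) : C :=
  cexp (quad (lattice_point kl y)) * echar (- kl.2) y.2.

Definition prefactor (u : V2 m) : C := cexp (quad (col_mx u.1 (0 : 'cV[R]_n))).

(** Completing the lattice translation in the quadratic form leaves a Gaussian
    independent of the lattice vectors and an exponential of a linear form. *)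
Lemma kterm_split kl u y :
  kterm S kl (u, y) = prefactor u * (amplitude kl y * cexp (frequency kl y u)).
Proof.
rewrite /kterm /prefactor /amplitude /frequency cexpD.
rewrite -/(echar kl.1 u.2).
set X := col_mx u.1 0; set W := lattice_point kl y.
have -> : bform S ((u, y).1.1 + (2 * pi) *: zvec R kl.1) ((u, y).2.1 + (2 * pi) *: zvec R kl.2) =
    quad X + quad W + dotc (toC X) (S *m toC W).
  have -> : bform S ((u, y).1.1 + (2 * pi) *: zvec R kl.1) ((u, y).2.1 + (2 * pi) *: zvec R kl.2) =
      quad (X + W).
    rewrite /quad /bform /dotc /toC mulmxA /X /W /lattice_point add_col_mx.
    by rewrite add0r.
  rewrite /quad toCD !mulmxDr !dotcDl !dotcDr (dotc_sym (toC W) (toC X) S_sym).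
  have alg (a b c : C) : 2^-1 * (a + b + (b + c)) = 2^-1 * a + 2^-1 * c + b by field.
  exact: alg.
have alg (a b c d e : C) : a * b * c * d * e = a * (b * e * (c * d)) by ring.
by rewrite !cexpD alg.
Qed.

Lemma norm_lattice_point kl y : `|zvec R kl.1| <= `|lattice_point kl y|.
Proof.
have t1 : 1 <= 2 * pi :> R by have := pi_ge2 R; lra.
apply: (@le_trans _ _ `|(2 * pi) *: zvec R kl.1|).
  by rewrite normrZ ler_peMl// (le_trans t1)// ler_norm.
apply: norm_le_entries => // i.
by have := norm_entry (lattice_point kl y) (lshift n i); rewrite /lattice_point col_mxEu.
Qed.

Lemma norm_col_mx0 (u : 'cV[R]_m) : `|col_mx u (0 : 'cV[R]_n)| <= `|u|.
Proof. by apply: norm_col_mx_le => //; rewrite normr0. Qed.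

Lemma real_linear_frequency kl y : real_linear (frequency kl y).
Proof.
move=> h v u; rewrite /frequency /= -[X in col_mx _ X](addr0 (0 : 'cV[R]_n)).
rewrite -{1}(scaler0 _ h) -add_col_mx -scale_col_mx toCD toCZ dotcDl dotcZl.
rewrite dotvDr dotvZr.
by apply: complexP; rewrite ?Re_add ?Im_add ?Re_mul ?Im_mul ?Re_add ?Im_add /=; ring.
Qed.

Lemma ccont_lattice_point kl (F : 'cV[R]_(m + n) -> C) : ccont F ->
  ccont (fun y : V2 n => F (lattice_point kl y)).
Proof.
move=> cF; have ca := @continuous_cst (V2 n) _ ((2 * pi) *: zvec R kl.1).
have cb := continuous_compose (@continuous_fst 'cV[R]_n 'cV[R]_n)
  (@continuous_addr R n ((2 * pi) *: zvec R kl.2)).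
exact: (ccont_comp (continuous_col_mx ca cb) cF).
Qed.

(** The amplitude is a Gaussian in the lattice point and the frequency is linear in
    it, so that all exponential moments are finite. *)
Lemma laplace_kernel rho : laplace_family rho amplitude frequency.
Proof.
have [q q0 hq] := nc_dotc_mul_le S.
pose a := q + m%:R; have a0 : 0 <= a by rewrite addr_ge0.
split.
- move=> kl; apply: ccontM; last exact: (ccont_comp (@continuous_snd _ _) (@ccont_echar R n _)).
  apply: ccont_cexp; apply: ccont_lattice_point; apply: ccontM; first exact: ccont_cst.
  exact: ccont_dotc_mul.
- move=> kl u; apply: ccontD; last exact: ccont_cst.
  under eq_fun do rewrite dotc_mul.
  by apply: (@ccont_lattice_point kl (fun z => dotc _ (toC z))); exact: ccont_dotc.
- exact: real_linear_frequency.
exists (fun kl y => a * `|lattice_point kl y|); split=> [kl y|kl y u|r].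
- by rewrite mulr_ge0.
- apply: (le_trans (ncD _ _)).
  rewrite /a mulrDl mulrDl; apply: lerD.
    apply: (le_trans (hq _ _)); rewrite -mulrA ler_wpM2l// mulrC ler_wpM2l//.
    exact: le_trans (norm_col_mx0 _) (norm_fst_le _).
  have -> : nc (0 +i* dotv (zvec R kl.1) u.2)%C = `|dotv (zvec R kl.1) u.2|.
    by rewrite ncE /= expr0n add0r sqrtr_sqr.
  apply: (le_trans (dotv_le _ _)); rewrite -mulrA ler_wpM2l//.
  by rewrite ler_pM ?norm_snd_le// norm_lattice_point.
have [A A0 hA] := gaussn_decay 0 (rho * a + (m + n)%:R) pS.
have [|M [MM hM]] := @lattice_shift_majorant R (m + n)
    (fun z => nc (gaussn (- S) 0 z) * expR (rho * a * `|z|)) A r.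
  move=> z; apply: (le_trans (ler_wpM2r (expR_ge0 _) (hA z))).
  by rewrite -[leLHS]mulrA -expRD ler_wpM2l// ler_expR; lra.
exists (fun kl => M (col_mx kl.1 kl.2)); split.
  exact: (majorant_inj (@col_mx_pair_inj m n) MM).
move=> kl y yr; rewrite /amplitude ncM nc_echar mulr1.
have zE : lattice_point kl y = col_mx 0 y.1 + (2 * pi) *: zvec R (col_mx kl.1 kl.2).
  by rewrite zvec_col scale_col_mx add_col_mx add0r.
have -> : cexp (quad (lattice_point kl y)) = gaussn (- S) 0 (lattice_point kl y).
  rewrite -[lattice_point kl y]vsubmxK -cexp_bform; congr cexp.
  by rewrite /quad /bform /dotc /toC mulmxA.
rewrite mulrA {1 2}zE; apply: hM; apply: norm_col_mx_le; last exact: le_trans (norm_fst_le _) yr.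
by rewrite normr0; exact: le_trans (normr_ge0 _) yr.
Qed.

Lemma CkC_prefactor k : CkC k prefactor.
Proof.
have [q q0 hq] := nc_dotc_mul_le S.
pose X (u : V2 m) := toC (col_mx u.1 (0 : 'cV[R]_n)).
have XD h v u : X (h *: v + u) = rc h *: X v + X u.
  rewrite /X /= -[in LHS](addr0 (0 : 'cV[R]_n)) -{1}(scaler0 _ h) -add_col_mx -scale_col_mx.
  by rewrite toCD toCZ.
apply: (@CkC_gauss R _ _ (fun v => 2^-1 * dotc (X v) (S *m X v))
  (fun v u => dotc (X v) (S *m X u)) _ (fun v => q * `|v|)).
- move=> h v u; rewrite /quad -!/(X _) XD mulmxDr -scalemxAr !dotcDl !dotcDr !dotcZl !dotcZr.
  rewrite (dotc_sym (X u) (X v) S_sym) rmorphXn /=.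
  have alg (a b c d : C) : 2^-1 * (d * (d * a) + d * b + (d * b + c)) =
     2^-1 * c + d * b + d ^+ 2 * (2^-1 * a) by field.
  exact: alg.
- by move=> v h u w; rewrite XD mulmxDr -scalemxAr dotcDr dotcZr.
- move=> v u; apply: (le_trans (hq _ _)); rewrite -mulrA ler_wpM2l//.
  by apply: ler_pM => //; exact: le_trans (norm_col_mx0 _) (norm_fst_le _).
have ca := continuous_col_mx (@continuous_fst 'cV[R]_m 'cV[R]_m) (@continuous_cst (V2 m) _ (0 : 'cV[R]_n)).
apply: (ccont_comp ca (f := quad)); apply: ccontM; first exact: ccont_cst.
exact: ccont_dotc_mul.
Qed.

Lemma Qop_laplace (g : V2 n -> C) : ccont g ->
  Qop n m S g = fun u => Qconst R m n * prefactor u *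
    laplace (fun f => torus (fun y => f y * g y)) amplitude frequency u.
Proof.
move=> cg; apply/funext => u; rewrite QopE -mulrA; congr (_ * _).
have HL := bounded_functional_weight (@bounded_functional_torus R n) cg.
have nf := normal_slicer u (kterm_normal pS).
transitivity (csum (fun kl => torus (fun y => kterm S kl (u, y) * g y))).
  exact: (bf_csum HL nf).2.
have lf := laplace_kernel `|u|.
have [[M [MM hM]] _] := bf_csum HL (laplace_normal lf (lexx _)).
rewrite /laplace -(csumZ _ MM hM); congr csum; apply/funext => kl.
rewrite -(bfZ HL); last exact: laplace_ccont lf.
by congr torus; apply/funext => y; rewrite kterm_split.
Qed.

Lemma kernel_period (k : 'cV[int]_m) (x xi : 'cV[R]_m) (y : V2 n) :
  kernel S (x, xi + (2 * pi) *: zvec R k) y = kernel S (x, xi) y.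
Proof.
rewrite !kernelE; congr csum; apply/funext => kl.
by rewrite /kterm /= echar_period.
Qed.

(** A translation by a period is a shift of the first summation index. *)
Lemma kernel_quasiperiod (k : 'cV[int]_m) (x xi : 'cV[R]_m) (y : V2 n) :
  kernel S (x + (2 * pi) *: zvec R k, xi) y = echar (- k) xi * kernel S (x, xi) y.
Proof.
rewrite !kernelE.
have nf := normal_slicer (x, xi) (kterm_normal pS).
have [M [MM hM]] := nf.2 `|y|.
pose h (kl : 'cV[int]_m * 'cV[int]_n) := (kl.1 + k, kl.2).
pose h' (kl : 'cV[int]_m * 'cV[int]_n) := (kl.1 - k, kl.2).
have hK : cancel h h' by move=> [a b]; rewrite /h /h' /= addrK.
have h'K : cancel h' h by move=> [a b]; rewrite /h /h' /= subrK.
have hMy kl := hM kl y (lexx _).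
rewrite (csum_reindex hK h'K MM hMy).
rewrite -(csumZ _ (majorant_inj (can_inj hK) MM) (fun kl => hMy (h kl))).
congr csum; apply/funext => -[a b]; rewrite /kterm /h /=.
rewrite -addrA -scalerDr -zvecD (addrC k).
have -> : echar a xi = echar (- k) xi * echar (a + k) xi.
  by rewrite -echarDl addrCA addNr addr0.
have alg (c d e f : C) : c * (d * e) * f = d * (c * e * f) by ring.
exact: alg.
Qed.

Lemma Qop_Gspace (g : V2 n -> C) : ccont g -> Gspace (Qop n m S g).
Proof.
move=> cg; have HL := bounded_functional_weight (@bounded_functional_torus R n) cg.
have ck p : ccont (fun s => kernel S p s * g s).
  by apply: ccontM cg; exact: (@ccont_slicer R _ _ (kernel S) p (ccont_kernel pS)).
split.
- move=> k; rewrite (Qop_laplace cg); apply: CkC_M; last first.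
    by apply: (CkC_laplace HL) => rho; exact: laplace_kernel.
  by apply: CkC_M; [exact: CkC_cst|exact: CkC_prefactor].
- move=> k x xi; rewrite !QopE; congr (_ * torus _); apply/funext => y.
  by rewrite kernel_period.
move=> k x xi; rewrite !QopE mulrCA; congr (_ * _).
rewrite -(bfZ (@bounded_functional_torus R n) _ (ck _)); congr torus; apply/funext => y.
by rewrite kernel_quasiperiod mulrA.
Qed.

Lemma Qop_linear a (g1 g2 : V2 n -> C) : ccont g1 -> ccont g2 ->
  Qop n m S (fun p => a * g1 p + g2 p) =
  fun p => a * Qop n m S g1 p + Qop n m S g2 p.
Proof.
move=> c1 c2; apply/funext => p; rewrite !QopE.
have ck g : ccont g -> ccont (fun s => kernel S p s * g s).
  by move=> cg; apply: ccontM cg; exact: (@ccont_slicer R _ _ (kernel S) p (ccont_kernel pS)).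
rewrite mulrCA -mulrDr; congr (_ * _).
rewrite -((@bounded_functional_torus R n).1 a _ _ (ck _ c1) (ck _ c2)).
by congr torus; apply/funext => y; ring.
Qed.

End Fixed.
End Invariance.

(** * Potapov transforms of Lagrangian relations *)

Section Relations.
Variable R : realType.
Local Notation C := R[i].
Local Notation Re := complex.Re.
Local Notation Im := complex.Im.
Local Notation rc := (real_complex R).

Lemma det_inv_sqrt_neq0 n (T : 'M[C]_n) : posC T -> det_inv_sqrt T != 0.
Proof.
move=> pT; rewrite -(pivot_det_inv_sqrt pT); apply/eqP => p0.
by have := sqr_pivot pT; rewrite p0 expr0n mul0r => /eqP; rewrite eq_sym oner_eq0.
Qed.

(** If no matrix represents [P], then [potapov P] is the default value zero, which
    is negative definite only in dimension zero. *)
Lemma potapovP m n (P : set (V R m * V R n)) :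
  lagrangian P -> potapov_domain (potapov P) -> is_potapov P (potapov P).
Proof.
move=> [[U [PU _]] _]; rewrite /potapov; case: xgetP => [S _ //|no [_ neg]].
have [mn0|mn] := posnP (m + n); last first.
  have := neg (const_mx 1); rewrite (_ : map_mx _ 0 = 0); last first.
    by apply/matrixP => i j; rewrite !mxE.
  rewrite mulmx0 mul0mx mxE ltxx => h.
  suff : false by []. apply: h; apply/eqP => /matrixP/(_ (Ordinal mn) 0).
  by rewrite !mxE => /eqP; rewrite oner_eq0.
have [m0 n0] : m = 0%N /\ n = 0%N by move/eqP: mn0; rewrite addn_eq0 => /andP[/eqP-> /eqP->].
subst m n; apply: (no 0) => -[v1 v2] [w1 w2]; split=> _.
  exact: etrans (flatmx0 _) (esym (flatmx0 _)).
by rewrite PU /= (flatmx0 v1) (flatmx0 v2) (flatmx0 w1) (flatmx0 w2) mem0v.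
Qed.

Lemma LformE n (v w : V R n) : Lform v w = dotc v.1 w.2 - dotc v.2 w.1.
Proof. by rewrite /Lform sumrB !dotcE. Qed.

Section Graph.
Variables (m n : nat) (S : 'M[C]_(m + n)).

Definition graph_of (z : 'cV[C]_(m + n)) : V R m * V R n :=
  ((- usubmx (S *m z), usubmx z), (dsubmx (S *m z), dsubmx z)).

Lemma graph_of_linear : linear graph_of.
Proof.
move=> a z w; rewrite /graph_of.
by rewrite mulmxDr -scalemxAr !linearP.
Qed.
HB.instance Definition _ := GRing.isLinear.Build C _ _ _ graph_of graph_of_linear.

Lemma graph_of_inj : injective graph_of.
Proof. by move=> z w [_ h1 _ h2]; rewrite -[z]vsubmxK h1 h2 vsubmxK. Qed.

Lemma is_potapov_graph (P : set (V R m * V R n)) : is_potapov P S -> P = range graph_of.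
Proof.
move=> PS; apply/seteqP; split=> [[v w] /PS h|p [z _ <-]].
  exists (col_mx v.2 w.2) => //; rewrite /graph_of -h !col_mxKu !col_mxKd opprK.
  by case: v w {h} => [? ?] [? ?].
by rewrite /graph_of; apply/PS; rewrite /= opprK !vsubmxK.
Qed.

(** The graph has the right dimension, as it is parametrized by [m + n] coordinates,
    and its isotropy is the symmetry of [S]. *)
Lemma lagrangian_graph (P : set (V R m * V R n)) : S^T = S -> is_potapov P S -> lagrangian P.
Proof.
move=> sS /is_potapov_graph ->; split.
  exists (limg (linfun graph_of)); split.
    apply/seteqP; split=> [p [z _ <-]|p /memv_imgP[z _ ->]] /=.
      by rewrite -(lfunE graph_of) memv_img// memvf.
    by exists z => //; rewrite lfunE.
  rewrite limg_dim_eq; first by rewrite dimvf dim_matrix mulr1.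
  apply/eqP; rewrite -subv0; apply/subvP => z; rewrite memv_cap => /andP[_].
  rewrite memv_ker lfunE => /eqP h; rewrite memv0; apply/eqP/graph_of_inj.
  by rewrite h linear0.
move=> p q [z _ <-] [w _ <-]; rewrite /form2 !LformE /=.
have : dotc (S *m z) w = dotc z (S *m w) by rewrite dotc_mul sS.
rewrite -[X in dotc X w]vsubmxK -[X in dotc z X]vsubmxK -[X in dotc _ X = _]vsubmxK.
rewrite -[X in _ = dotc X _]vsubmxK !dotc_col dotcNl dotcNr => h.
move/eqP: h; rewrite -subr_eq0 => /eqP h; rewrite -[RHS]oppr0 -h.
by ring.
Qed.

End Graph.

Section Composite.
Variables (m q n : nat).
Variables (A : 'M[C]_m) (B : 'M[C]_(m, q)) (D K : 'M[C]_q) (L : 'M[C]_(q, n)) (M : 'M[C]_n).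
Hypotheses (p1 : posC (- block_mx A B B^T D)) (p2 : posC (- block_mx K L L^T M)).

(** Matching the inner plus components is a linear equation for the inner minus
    component, with matrix [- D - K]. *)
Lemma is_potapov_comp (P1 : set (V R m * V R q)) (P2 : set (V R q * V R n)) :
  is_potapov P1 (block_mx A B B^T D) -> is_potapov P2 (block_mx K L L^T M) ->
  is_potapov (rel_comp P1 P2) (comp_mx A B D K L M).
Proof.
move=> e1 e2 v y; have uT := posC_unit (posC_T p1 p2).
split=> [[w [/e1 h1 /e2 h2]]|h].
  rewrite mul_block_col in h1; rewrite mul_block_col in h2.
  move: h1 h2 => /= /eq_col_mx[h1 h2] /eq_col_mx[h3 h4].
  have we : w.2 = invmx (- D - K) *m (B^T *m v.2 + L *m y.2).
    rewrite -[LHS](mulKmx uT); congr (_ *m _).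
    have : - (B^T *m v.2 + D *m w.2) = K *m w.2 + L *m y.2 by rewrite -h2 h3.
    rewrite !mulmxDl !mulNmx opprD => e; apply/eqP.
    have -> : L *m y.2 = - (B^T *m v.2) - D *m w.2 - K *m w.2 by rewrite e addrC addKr.
    by rewrite -[- (_) - _ - _]addrA addNKr.
  by rewrite (comp_mx_mul A M we) h1 h4.
pose w2 := invmx (- D - K) *m (B^T *m v.2 + L *m y.2).
have sad := T_saddle p1 p2 (erefl w2).
move: h; rewrite (comp_mx_mul A M (erefl w2)) => /eq_col_mx[h1 h2].
exists (B^T *m v.2 + D *m w2, w2); split.
  by apply/e1; rewrite mul_block_col h1.
by apply/e2; rewrite mul_block_col h2 /= sad opprK.
Qed.

End Composite.

(** A Hermitian form is additive along composition, since the contributions of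
    the intermediate vector cancel. *)
Lemma form_pos_comp (H : forall n, V R n -> V R n -> C) m q n
    (P1 : set (V R m * V R q)) (P2 : set (V R q * V R n)) :
  (forall n, H n 0 0 = 0) ->
  (forall p, P1 p -> p != 0 -> 0 < form2 H p p) ->
  (forall p, P2 p -> p != 0 -> 0 < form2 H p p) ->
  forall p, rel_comp P1 P2 p -> p != 0 -> 0 < form2 H p p.
Proof.
move=> H0 h1 h2 [v y] [w /= [P1w P2w]] vy0.
have -> : form2 H (v, y) (v, y) = form2 H (v, w) (v, w) + form2 H (w, y) (w, y).
  by rewrite /form2 /=; ring.
have f0 a b : form2 H (0 : V R a * V R b) 0 = 0 by rewrite /form2 /= !H0 subrr.
have [e1|n1] := eqVneq (v, w) 0; have [e2|n2] := eqVneq (w, y) 0.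
- by move: vy0; case: e1 => -> _; case: e2 => _ ->; rewrite eqxx.
- by rewrite e1 f0 add0r h2.
- by rewrite e2 f0 addr0 h1.
- by rewrite addr_gt0 ?h1 ?h2.
Qed.

Lemma Hform0 n : Hform (0 : V R n) 0 = 0.
Proof. by rewrite /Hform big1 ?mulr0// => j _; rewrite /= !mxE !mul0r subrr. Qed.
Lemma Hform_re0 n : Hform_re (0 : V R n) 0 = 0.
Proof. by rewrite /Hform_re big1// => j _; rewrite /= !mxE !mul0r addr0. Qed.

Lemma sym_block m n (S : 'M[C]_(m + n)) : S^T = S ->
  S = block_mx (ulsubmx S) (ursubmx S) (ursubmx S)^T (drsubmx S).
Proof. by move=> sS; rewrite -{1}[S]submxK trmx_ursub sS. Qed.

Lemma MorSp_comp (H : forall n, V R n -> V R n -> C) m q n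
    (P1 : set (V R m * V R q)) (P2 : set (V R q * V R n)) :
  (forall n, H n 0 0 = 0) ->
  MorSp H q m P1 -> MorSp H n q P2 ->
  potapov_domain (potapov P1) -> potapov_domain (potapov P2) ->
  MorSp H n m (rel_comp P1 P2) /\ potapov_domain (potapov (rel_comp P1 P2)).
Proof.
move=> H0 [l1 h1] [l2 h2] d1 d2.
have e1 := potapovP l1 d1; have e2 := potapovP l2 d2.
have p1 := (posC_domain _).1 d1; have p2 := (posC_domain _).1 d2.
rewrite (sym_block d1.1) in e1 p1; rewrite (sym_block d2.1) in e2 p2.
have e := is_potapov_comp p1 p2 e1 e2.
rewrite (potapovE e); split; last by apply/posC_domain; exact: posC_comp.
split; first exact: lagrangian_graph (comp_mx_sym p1 p2) e.
exact: form_pos_comp.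
Qed.

Lemma Qop_rel_comp (H : forall n, V R n -> V R n -> C) m q n
    (P1 : set (V R m * V R q)) (P2 : set (V R q * V R n))
    (A : 'M[C]_m) (B : 'M[C]_(m, q)) (D K : 'M[C]_q) (L : 'M[C]_(q, n)) (M : 'M[C]_n) g :
  MorSp H q m P1 -> MorSp H n q P2 ->
  potapov_domain (potapov P1) -> potapov_domain (potapov P2) ->
  potapov P1 = block_mx A B B^T D -> potapov P2 = block_mx K L L^T M -> Gspace g ->
  Qop q m (potapov P1) (Qop n q (potapov P2) g) =
  (fun p => det_inv_sqrt (- D - K) * Qop n m (potapov (rel_comp P1 P2)) g p).
Proof.
move=> [l1 _] [l2 _] d1 d2 b1 b2 Gg.
have e1 := potapovP l1 d1; have e2 := potapovP l2 d2.
have p1 := (posC_domain _).1 d1; have p2 := (posC_domain _).1 d2.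
rewrite b1 in e1 p1 *; rewrite b2 in e2 p2 *.
rewrite (potapovE (is_potapov_comp p1 p2 e1 e2)).
exact: Qop_comp p1 p2 (Gspace_ccont Gg).
Qed.

End Relations.

(** * The projective representation *)

Theorem theorem3p3 (R : realType)
    (H : forall n, V R n -> V R n -> R[i])
    (hH : H = @Hform R \/ H = @Hform_re R) :
  (forall (m q n : nat) (P1 : set (V R m * V R q)) (P2 : set (V R q * V R n))
      (A : 'M[R[i]]_m) (B : 'M[R[i]]_(m, q)) (C : 'M[R[i]]_q)
      (K : 'M[R[i]]_q) (L : 'M[R[i]]_(q, n)) (M : 'M[R[i]]_n),
    MorSp H q m P1 -> MorSp H n q P2 ->
    potapov_domain (potapov P1) -> potapov_domain (potapov P2) ->
    potapov P1 = block_mx A B B^T C -> potapov P2 = block_mx K L L^T M ->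
    forall g, Gspace g ->
      Qop q m (potapov P1) (Qop n q (potapov P2) g) =
      (fun p => det_inv_sqrt (- C - K) * Qop n m (potapov (rel_comp P1 P2)) g p)) /\
  projective_representation
    (fun n m => [set P : set (V R m * V R n) | MorSp H n m P /\ potapov_domain (potapov P)])
    (fun n m P => Qop n m (potapov P)).
Proof.
have H0 n : H n 0 0 = 0 by case: hH => ->; [exact: Hform0|exact: Hform_re0].
split=> [m q n P1 P2 A B C K L M M1 M2 d1 d2 b1 b2 g Gg|].
  exact: Qop_rel_comp M1 M2 d1 d2 b1 b2 Gg.
split=> [m q n P1 P2 [M1 d1] [M2 d2]|m n P g [_ /posC_domain d] Gg|
         m n P a g1 g2 [_ /posC_domain d] G1 G2|m q n P1 P2 [M1 d1] [M2 d2]].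
- exact: MorSp_comp.
- exact (Qop_Gspace d (Gspace_ccont Gg)).
- exact (Qop_linear d a (Gspace_ccont G1) (Gspace_ccont G2)).
have b1 := sym_block d1.1; have b2 := sym_block d2.1.
exists (det_inv_sqrt (- drsubmx (potapov P1) - ulsubmx (potapov P2))); split.
  have p1 := (posC_domain _).1 d1; have p2 := (posC_domain _).1 d2.
  by rewrite b1 in p1; rewrite b2 in p2; apply: det_inv_sqrt_neq0; exact: posC_T p1 p2.
by move=> g Gg; exact: Qop_rel_comp M1 M2 d1 d2 b1 b2 Gg.
Qed.
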